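(* (1) Let $a: M^n \to H^{n+1}_1(-1)$ be a spacelike hypersurface with unit normal $b$. Then the Gauss map $G: M^n \to {Q^*}^n$, $p \mapsto [a(p)+ib(p)]$, is a Lagrangian immersion. Moreover, let $A\in\mathcal A$ be an almost product structure chosen such that, along the image of $G$, $$A (dG)_p v = -(d\pi)_{\widetilde G(p)}\left(d\overline{\widetilde G}\right)_p v \qquad (p\in M^n,\ v\in T_pM^n),$$ where $\widetilde G: M^n \to {V^*}^{2n+1}_1$, $p \mapsto \frac{1}{\sqrt 2}(a(p)+ib(p))$, is the canonical horizontal lift of $G$. Then the relation between the principal curvatures $\lambda_1,\ldots,\lambda_n$ of $a$, with respect to the shape operator associated to $b$, and the angle functions $\theta_1,\ldots,\theta_n$ of $G$ with respect to $A$ is $$\lambda_j = \cot\theta_j \qquad \text{for } j=1,\ldots,n.$$ (2) Conversely, if $f: M^n \to {Q^*}^n$ is a Lagrangian immersion, then for every point of $M^n$ there exist an open neighborhood $U$ of that point in $M^n$ and a spacelike immersion $a: U \to H^{n+1}_1(-1)$ with Gauss map $f|_U$. This immersion is not unique, nor are its principal curvature functions. However, for any choice of $a$, a local frame $\{e_1,\ldots,e_n\}$ of principal directions for $a$ is adapted to $f$ in the sense that, for any choice of $A\in\mathcal A$, there are local angle functions $\theta_1,\ldots,\theta_n$ with $Ae_j = \cos(2\theta_j)e_j-\sin(2\theta_j)Je_j$ for all $j$, and the principal curvature functions $\lambda_1,\ldots,\lambda_n$ of $a$ are related to the corresponding local angle functions $\theta_1,\ldots,\theta_n$ by $$\cot(\theta_j-\theta_k)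 = \pm \frac{\lambda_j \lambda_k + 1}{\lambda_j - \lambda_k}$$ for $j,k=1,\ldots,n$ at points where $\lambda_j \neq \lambda_k$.
   Context: $\mathbb R^d_i$ is $\mathbb R^d$ with the metric $\langle x,y\rangle_i=-x_1y_1-\cdots-x_iy_i+x_{i+1}y_{i+1}+\cdots+x_dy_d$. Anti-de Sitter space is $H^{n+1}_1(-1)=\{x\in\mathbb R^{n+2}_2 : \langle x,x\rangle_2=-1\}$. $\mathbb C^{n+2}_2$ is $\mathbb C^{n+2}$ with the metric $\langle\!\langle z,w\rangle\!\rangle_2=\mathrm{Re}(-z_0\bar w_0-z_1\bar w_1+z_2\bar w_2+\cdots+z_{n+1}\bar w_{n+1})$, and $H^{2n+3}_3(-1)=\{z\in\mathbb C^{n+2}_2 : \langle\!\langle z,z\rangle\!\rangle_2=-1\}$. Complex anti-de Sitter space $\mathbb CH^{n+1}_1(-4)$ is the set of complex lines in $\mathbb C^{n+2}_2$ on which $\langle\!\langle\cdot,\cdot\rangle\!\rangle_2$ is negative definite, with the pseudo-Riemannian metric $g$ making the Hopf fibration $\pi:H^{2n+3}_3(-1)\to\mathbb CH^{n+1}_1(-4)$, $z\mapsto[z]$, a pseudo-Riemannian submersion, and with the complex structure $J$ induced by multiplication by $i$. The complex hyperbolic quadric is ${Q^*}^n=\{[(z_0,\ldots,z_{n+1})]\in\mathbb CH^{n+1}_1(-4) : -z_0^2-z_1^2+z_2^2+\cdots+z_{n+1}^2=0\}$ with the induced metric and complex structure, again denoted $g$ and $J$; it is a Riemannian Kähler manifold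 of complex dimension $n$. Its inverse image under $\pi$ is ${V^*}^{2n+1}_1=\{u+iv : u,v\in\mathbb R^{n+2}_2,\ \langle u,u\rangle_2=\langle v,v\rangle_2=-\tfrac12,\ \langle u,v\rangle_2=0\}$; its normal space in $H^{2n+3}_3(-1)$ at $z$ is spanned by $\bar z$ and $i\bar z$. $\mathcal A$ is the set of shape operators $A$ of ${Q^*}^n$ as a submanifold of $\mathbb CH^{n+1}_1(-4)$ associated to (locally defined) unit normal vector fields $\zeta$ (with $g(\zeta,\zeta)=-1$), with the sign convention $\nabla^{\mathbb CH^{n+1}_1(-4)}_X\zeta=-AX+s(X)J\zeta$. Every $A\in\mathcal A$ is symmetric, involutive and anti-commutes with $J$; it is called an almost product structure. An immersion $f:M^n\to{Q^*}^n$ from a manifold of real dimension $n$ is Lagrangian if $J$ maps each tangent space of $M^n$ to the normal space at that point and vice versa. Tangent vectors to $M^n$ are identified with their images under $df$. Given $A\in\mathcal A$, there are locally an orthonormal frame $\{e_1,\ldots,e_n\}$ on $M^n$ and functions $\theta_1,\ldots,\theta_n$, defined up to integer multiples of $\pi$, with $Ae_j=\cos(2\theta_j)e_j-\sin(2\theta_j)Je_j$; these are the (local) angle functions of $f$ with respect to $A$. For a spacelike immersion $a:M^n\to H^{n+1}_1(-1)\subset\mathbb R^{n+2}_2$ with unit normal vector field $b$ tangent to $H^{n+1}_1(-1)$ (so $\langle b,b\rangle_2=-1$), the Gauss map is $G:M^n\to{Q^*}^n$, $p\mapsto[a(p)+ib(p)]$. The principal curvatures $\lambda_j$ are the eigenvalues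 of the shape operator $S$ associated to $b$, with the convention $db(X)=-da(SX)$. In part (1), the stated choice of $A$ along the image of $G$ is the shape operator associated to the unit normal field $\zeta_{G(p)}=(d\pi)_{\widetilde G(p)}(\overline{\widetilde G(p)})$, and it is extended to an element of $\mathcal A$ defined in a neighborhood (locally). The bar denotes complex conjugation in $\mathbb C^{n+2}$. *)

(* Defs.v *)
From HB Require Import structures.
From mathcomp Require Import all_boot all_order all_algebra.
From mathcomp Require Import all_classical all_reals all_analysis.
From mathcomp Require Import complex.

Set Implicit Arguments.
Unset Strict Implicit.
Unset Printing Implicit Defensive.

Import Order.TTheory GRing.Theory Num.Theory.
Import numFieldNormedType.Exports.

Local Open Scope classical_set_scope.
Local Open Scope complex_scope.
Local Open Scope ring_scope.

Section Smooth.
Context {R : realType}.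

(* Only meaningful for an open set [D]. *)
Fixpoint Ck {V W : normedModType R} (k : nat) (D : set V) (F : V -> W) : Prop :=
  match k with
  | 0 => forall x, D x -> {for x, continuous F}
  | k'.+1 => (forall x, D x -> differentiable F x) /\
             (forall v, Ck k' D (fun x => 'D_v F x))
  end.

Definition smooth_on {V W : normedModType R} (D : set V) (F : V -> W) : Prop :=
  forall k, Ck k D F.

Definition cot (x : R) : R := cos x / sin x.

End Smooth.

(* [cinv] is the inverse of [cmap : cdom -> cmap @` cdom]; both maps are
   irrelevant outside these sets. *)
Record chart (R : realType) (n : nat) (T : topologicalType) := Chart {
  cdom : set T;
  cmap : T -> 'rV[R]_n;
  cinv : 'rV[R]_n -> T;
  cdom_open : open cdom;
  cimg_open : open (cmap @` cdom);
  cmapK : forall p, cdom p -> cinv (cmap p) = p;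
  cmap_cont : forall p, cdom p -> {for p, continuous cmap};
  cinv_cont : forall x, (cmap @` cdom) x -> {for x, continuous cinv} }.

Record manifold (R : realType) (n : nat) := Manifold {
  mpoint :> topologicalType;
  atlas : set (chart R n mpoint);
  atlas_cover : forall p, exists2 phi, atlas phi & cdom phi p;
  atlas_smooth : forall phi psi, atlas phi -> atlas psi ->
    smooth_on (cmap phi @` (cdom phi `&` cdom psi)) (cmap psi \o cinv phi);
  manifold_hausdorff : hausdorff_space mpoint;
  manifold_second_countable : @second_countable mpoint }.

Section Maps.
Context {R : realType} {n : nat} {M : manifold R n}.

Definition smooth_map {W : normedModType R} (U : set M) (F : M -> W) : Prop :=
  forall phi, atlas phi -> smooth_on (cmap phi @` (U `&` cdom phi)) (F \o cinv phi).

(* Tangent vectors of [M] at [p] are written in coordinates: [v : 'rV_n] stands,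
   relative to a chart [phi] around [p], for the vector
   \sum_k v_k (d / d x_k) at p. *)
Definition dmap {W : normedModType R} (phi : chart R n M) (F : M -> W)
  (p : M) (v : 'rV[R]_n) : W := 'D_v (F \o cinv phi) (cmap phi p).

End Maps.

Section RealForm.
Context {R : realType} {n : nat}.

Definition eps (j : 'I_n.+2) : R := if (j < 2)%N then -1 else 1.

Definition rform (x y : 'rV[R]_n.+2) : R :=
  \sum_(j < n.+2) eps j * x 0 j * y 0 j.

End RealForm.

Section ComplexSpace.
Context {R : realType} {n : nat}.
Local Notation V := 'rV[R[i]]_n.+2.
Local Notation VR := ('rV[R]_n.+2 * 'rV[R]_n.+2)%type.

(* The normed space structure of C^(n+2) over the reals is that of
   R^(n+2) x R^(n+2), through u + i v <-> (u, v). *)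
Definition realify (z : V) : VR := (map_mx (@complex.Re R) z, map_mx (@complex.Im R) z).
Definition cplx (w : VR) : V := \row_j (w.1 0 j +i* w.2 0 j).

Definition conjv (z : V) : V := map_mx (@conjc R) z.

(* The complex Hermitian form, linear in its first argument, whose real part is
   the metric of C^(n+2)_2. *)
Definition hform (z w : V) : R[i] :=
  \sum_(j < n.+2) (eps j)%:C * z 0 j * conjc (w 0 j).

Definition cform (z w : V) : R := complex.Re (hform z w).

Definition quad (z : V) : R[i] := \sum_(j < n.+2) (eps j)%:C * z 0 j ^+ 2.

(* H^(2n+3)_3(-1) *)
Definition Hsphere : set V := [set z | cform z z = -1].

(* CH^(n+1)_1(-4), as a set of complex lines; the Hopf fibration is
   z |-> <[z]>%VS. *)
Definition CH : set {vspace V} :=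
  [set L | \dim L = 1%N /\ forall z, z \in L -> z != 0 -> cform z z < 0].

(* T_L CH is Hom_C(L, L^perp); an element is extended by 0 to L^perp, and so is
   a matrix [X] acting on row vectors, whose horizontal lift at a point [z] of
   the fibre over [L] is [z *m X]. The complex structure J is 'i *: _. *)
Definition tangentCH (L : {vspace V}) : set 'M[R[i]]_n.+2 :=
  [set X | (forall z w, z \in L -> w \in L -> hform (z *m X) w = 0) /\
           (forall v, (forall w, w \in L -> hform v w = 0) -> v *m X = 0)].

(* The differential of the Hopf fibration at z in H^(2n+3)_3(-1): it maps w to
   the tangent vector v |-> - hform v z *: w', where w' = w + hform w z *: z is
   the horizontal part of w. In particular z *m dhopf z w = w'. *)
Definition dhopf (z w : V) : 'M[R[i]]_n.+2 :=
  - (\col_i ((eps i)%:C * conjc (z 0 i)) *m (w + hform w z *: z)).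

(* A point of the fibre of the Hopf fibration over [L]. *)
Definition fibre (L : {vspace V}) : V :=
  xget 0 [set z | Hsphere z /\ <[z]>%VS = L].

(* The metric making the Hopf fibration a pseudo-Riemannian submersion; it does
   not depend on the choice made in [fibre], nor does [vderiv] below. *)
Definition gCH (L : {vspace V}) (X Y : 'M[R[i]]_n.+2) : R :=
  cform (fibre L *m X) (fibre L *m Y).

Definition openCH (O : set {vspace V}) : Prop :=
  O `<=` CH /\ open [set w : VR | O <[cplx w]>%VS].

Definition smooth_fun (O : set {vspace V}) (k : {vspace V} -> R) : Prop :=
  smooth_on [set w : VR | O <[cplx w]>%VS] (fun w => k <[cplx w]>%VS).

(* Smoothness of a vector field is that of its horizontal lift, which is
   extended C-homogeneously to the cone over H^(2n+3)_3(-1). *)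
Definition smooth_field (O : set {vspace V})
    (X : {vspace V} -> 'M[R[i]]_n.+2) : Prop :=
  (forall L, O L -> tangentCH L (X L)) /\
  smooth_on [set w : VR | O <[cplx w]>%VS]
            (fun w => realify (cplx w *m X <[cplx w]>%VS)).

Definition vderiv (X : {vspace V} -> 'M[R[i]]_n.+2) (k : {vspace V} -> R)
    (L : {vspace V}) : R :=
  'D_(realify (fibre L *m X L)) (fun w : VR => k <[cplx w]>%VS)
    (realify (fibre L)).

Definition levi_civita (nabla : ({vspace V} -> 'M[R[i]]_n.+2) ->
    ({vspace V} -> 'M[R[i]]_n.+2) -> {vspace V} -> 'M[R[i]]_n.+2) : Prop :=
  forall (O : set {vspace V}) X Y Z k, openCH O ->
  smooth_field O X -> smooth_field O Y -> smooth_field O Z -> smooth_fun O k ->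
  smooth_field O (nabla X Y) /\
  forall L, O L ->
  [/\ nabla (fun L' => X L' + Y L') Z L = nabla X Z L + nabla Y Z L /\
      nabla (fun L' => (k L')%:C *: X L') Y L = (k L)%:C *: nabla X Y L,
      nabla X (fun L' => Y L' + Z L') L = nabla X Y L + nabla X Z L,
      nabla X (fun L' => (k L')%:C *: Y L') L =
        (k L)%:C *: nabla X Y L + (vderiv X k L)%:C *: Y L,
      vderiv X (fun L' => gCH L' (Y L') (Z L')) L =
        gCH L (nabla X Y L) (Z L) + gCH L (Y L) (nabla X Z L) &
      vderiv (fun L' => nabla X Y L' - nabla Y X L') k L =
        vderiv X (vderiv Y k) L - vderiv Y (vderiv X k) L].

(* The complex hyperbolic quadric. *)
Definition Qstar : set {vspace V} :=
  [set L | CH L /\ forall z, z \in L -> quad z = 0].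

(* Horizontal vectors at z that are orthogonal to the vectors conj z and
   i conj z spanning the normal space of the inverse image of the quadric. *)
Definition tangentQ (L : {vspace V}) : set 'M[R[i]]_n.+2 :=
  [set X | tangentCH L X /\ forall z, z \in L ->
     cform (z *m X) (conjv z) = 0 /\ cform (z *m X) ('i *: conjv z) = 0].

Definition openQ (O : set {vspace V}) : Prop :=
  exists2 O', openCH O' & O = O' `&` Qstar.

Definition unit_normal (L : {vspace V}) (zeta : 'M[R[i]]_n.+2) : Prop :=
  [/\ tangentCH L zeta, forall Y, tangentQ L Y -> gCH L zeta Y = 0 &
      gCH L zeta zeta = -1].

Definition local_extension (O : set {vspace V})
    (zeta : {vspace V} -> 'M[R[i]]_n.+2) (O' : set {vspace V})
    (Z : {vspace V} -> 'M[R[i]]_n.+2) : Prop :=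
  [/\ openCH O', smooth_field O' Z & forall L, O L -> O' L -> Z L = zeta L].

Definition unit_normal_field (O : set {vspace V})
    (zeta : {vspace V} -> 'M[R[i]]_n.+2) : Prop :=
  (forall L, O L -> unit_normal L (zeta L)) /\
  (forall L, O L -> exists2 O', O' L & exists Z, local_extension O zeta O' Z).

Definition shape_operator
    (nabla : ({vspace V} -> 'M[R[i]]_n.+2) -> ({vspace V} -> 'M[R[i]]_n.+2) ->
             {vspace V} -> 'M[R[i]]_n.+2)
    (O : set {vspace V}) (zeta : {vspace V} -> 'M[R[i]]_n.+2)
    (A : {vspace V} -> 'M[R[i]]_n.+2 -> 'M[R[i]]_n.+2) : Prop :=
  forall L X, O L -> tangentQ L X ->
  tangentQ L (A L X) /\
  exists s : R, forall O' X' Z, O' L -> smooth_field O' X' -> X' L = X ->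
    local_extension O zeta O' Z ->
    nabla X' Z L = - A L X + s%:C *: ('i *: zeta L).

(* The elements of the set of almost product structures that are defined on the
   open subset [O] of the quadric. Only the values of [A L] on [tangentQ L], for
   [L] in [O], are relevant. *)
Definition almost_product (O : set {vspace V})
    (A : {vspace V} -> 'M[R[i]]_n.+2 -> 'M[R[i]]_n.+2) : Prop :=
  openQ O /\
  exists zeta, unit_normal_field O zeta /\
  exists2 nabla, levi_civita nabla & shape_operator nabla O zeta A.

End ComplexSpace.

Section Immersions.
Context {R : realType} {n : nat} {M : manifold R n}.
Local Notation V := 'rV[R[i]]_n.+2.

Definition smooth_cmap (U : set M) (F : M -> V) : Prop :=
  smooth_map U (realify \o F).

Definition dcmap (phi : chart R n M) (F : M -> V) (p : M) (v : 'rV[R]_n) : V :=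
  cplx (dmap phi (realify \o F) p v).

Definition local_lift (f : M -> {vspace V}) (p : M) (F : M -> V) : Prop :=
  exists U : set M, [/\ open U, U p, smooth_cmap U F &
    forall q, U q -> Hsphere (F q) /\ <[F q]>%VS = f q].

(* The Hopf fibration being a submersion, a map to CH^(n+1)_1(-4) is smooth when
   it has smooth local lifts. *)
Definition smooth_to_CH (f : M -> {vspace V}) : Prop :=
  forall p, exists F, local_lift f p F.

(* The differential of [f]; the result does not depend on the chosen lift. *)
Definition dCH (phi : chart R n M) (f : M -> {vspace V}) (p : M)
    (v : 'rV[R]_n) : 'M[R[i]]_n.+2 :=
  let F := xget (fun=> 0) [set F | local_lift f p F] in
  dhopf (F p) (dcmap phi F p v).

Definition immersion_to_Q (f : M -> {vspace V}) : Prop :=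
  [/\ smooth_to_CH f, forall p, Qstar (f p) &
      forall phi p v, atlas phi -> cdom phi p -> dCH phi f p v = 0 -> v = 0].

Definition normalM (phi : chart R n M) (f : M -> {vspace V}) (p : M) :
    set 'M[R[i]]_n.+2 :=
  [set Y | tangentQ (f p) Y /\ forall v, gCH (f p) Y (dCH phi f p v) = 0].

Definition lagrangian_immersion (f : M -> {vspace V}) : Prop :=
  immersion_to_Q f /\
  forall phi p, atlas phi -> cdom phi p ->
    (forall v, normalM phi f p ('i *: dCH phi f p v)) /\
    (forall Y, normalM phi f p Y -> exists v, 'i *: Y = dCH phi f p v).

Definition angle_relation (A : {vspace V} -> 'M[R[i]]_n.+2 -> 'M[R[i]]_n.+2)
    (phi : chart R n M) (f : M -> {vspace V}) (p : M)
    (e : 'I_n -> 'rV[R]_n) (theta : 'I_n -> R) : Prop :=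
  forall j, A (f p) (dCH phi f p (e j)) =
    (cos (2 * theta j))%:C *: dCH phi f p (e j) -
    (sin (2 * theta j))%:C *: ('i *: dCH phi f p (e j)).

Definition orthonormal_family (phi : chart R n M) (f : M -> {vspace V}) (p : M)
    (e : 'I_n -> 'rV[R]_n) : Prop :=
  forall j k, gCH (f p) (dCH phi f p (e j)) (dCH phi f p (e k)) = (j == k)%:R.

(* A spacelike immersion of the open set [U] into H^(n+1)_1(-1). Positive
   definiteness of the induced metric contains the injectivity of [da]. *)
Definition spacelike_immersion (U : set M) (a : M -> 'rV[R]_n.+2) : Prop :=
  [/\ smooth_map U a, forall p, U p -> rform (a p) (a p) = -1 &
      forall phi p v, atlas phi -> U p -> cdom phi p -> v != 0 ->
        0 < rform (dmap phi a p v) (dmap phi a p v)].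

Definition hypersurface_normal (U : set M) (a b : M -> 'rV[R]_n.+2) : Prop :=
  [/\ smooth_map U b,
      forall p, U p -> rform (b p) (b p) = -1 /\ rform (b p) (a p) = 0 &
      forall phi p v, atlas phi -> U p -> cdom phi p ->
        rform (b p) (dmap phi a p v) = 0].

Definition spacelike_hypersurface (U : set M) (a b : M -> 'rV[R]_n.+2) : Prop :=
  spacelike_immersion U a /\ hypersurface_normal U a b.

Definition gauss_map (a b : M -> 'rV[R]_n.+2) (p : M) : {vspace V} :=
  <[cplx (a p, b p)]>%VS.

Definition gauss_lift (a b : M -> 'rV[R]_n.+2) (p : M) : V :=
  (Num.sqrt 2)^-1%:C *: cplx (a p, b p).

(* The shape operator associated to [b], acting on row vectors of coordinates.
   The equation determines it, [da] being injective. *)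
Definition hypersurface_shape (phi : chart R n M) (a b : M -> 'rV[R]_n.+2)
    (p : M) : 'M[R]_n :=
  xget 0 [set S | forall v, dmap phi b p v = - dmap phi a p (v *m S)].

Definition frame (e : 'I_n -> 'rV[R]_n) : Prop := row_free (\matrix_(j < n) e j).

Definition principal_frame (phi : chart R n M) (a b : M -> 'rV[R]_n.+2) (p : M)
    (e : 'I_n -> 'rV[R]_n) (lambda : 'I_n -> R) : Prop :=
  frame e /\
  forall j, e j *m hypersurface_shape phi a b p = lambda j *: e j.

End Immersions.

(* Main.v *)
Require Import Defs.
From HB Require Import structures.
From mathcomp Require Import all_boot all_order all_algebra.
From mathcomp Require Import all_classical all_reals all_analysis.
From mathcomp Require Import complex.
From mathcomp Require Import ring lra.

Set Implicit Arguments.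
Unset Strict Implicit.
Unset Printing Implicit Defensive.

Import Order.TTheory GRing.Theory Num.Theory.
Import numFieldNormedType.Exports.

Local Open Scope classical_set_scope.
Local Open Scope complex_scope.
Local Open Scope ring_scope.


(** A spacelike hypersurface [a] with unit normal [b] is the same thing as the
    map [G = (a + i b) / sqrt 2] into the inverse image of the quadric under the
    Hopf fibration, and the proof works with [G]. The derivatives of the
    products of [a] and [b] show that [G] is horizontal ([hypersurface_lift]).
    Conversely the real and imaginary parts of a horizontal map into this
    inverse image are a hypersurface and its normal wherever the differential of
    the real part is injective ([lift_hypersurface]): these parts span a negative
    definite plane, and the orthogonal of such a plane is positive definite.

    A horizontal map is isotropic ([horizontal_isotropic]). This is at the same
    time the Lagrangian property of the Gauss map and the symmetry of the shape
    operator. In a principal direction [e] of principal curvature [l], the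
    differential of [G] is [(1 - i l) da e / sqrt 2]. The almost product
    structure of the first part lifts to minus the conjugation, so that it
    multiplies this vector by [- (1 + i l) / (1 - i l)], which is
    [exp (- 2 i theta)] exactly when [l = cot theta] ([angle_principal]).

    For a Lagrangian immersion [f], the vertical part of the differential of a
    local lift is, up to a factor [i], a closed one-form. Its primitive, given by
    the Poincare lemma, is the phase by which the lift has to be rotated to
    become horizontal ([exists_horizontal_lift]). Horizontality determines the
    lift up to a constant phase. For all but finitely many constant phases the
    real part is an immersion at a given point, because the kernels that occur
    for different phases are orthogonal ([exists_injective_combination]), and
    then near this point ([horizontal_lift_near]); this gives a hypersurface
    with Gauss map [f]. A further rotation by a small phase gives another one.
    It changes the angle [phi] of each principal curvature [cot phi] by the same
    amount, so that the largest principal curvature is no longer attained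
    ([other_hypersurface]).

    An arbitrary almost product structure is the shape operator of a unit normal
    field, whose lift along [G] is [c] times the conjugate of [G] for a smooth
    function [c] of modulus one ([normal_phase]). A Levi-Civita connection is the
    horizontal part of the derivative in the flat space ([levi_civitaE]), being
    unique. Hence the almost product structure lifts to [- c] times the
    conjugation ([product_structure_phase]), and the angle relation of the
    principal direction [e j] is
    [exp (- 2 i theta_j) = - c (1 + i l_j) / (1 - i l_j)].
    The right-hand side has modulus one and is smooth when the frame is, which
    gives angles ([angle_functions_exist], [smooth_angle_functions]). The factor
    [c] cancels in the quotient of two such relations, and what remains is the
    formula for [cot (theta_j - theta_k)], always with the sign [-1]
    ([angle_difference]). *)

(** * Calculus of C^k maps between normed spaces *)

Section Differentiability.
Context {R : realType} {V W : normedModType R}.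

Lemma differentiable_eps (f : V -> W) (x : V) (df : {linear V -> W}) :
  continuous df ->
  (forall e : R, 0 < e ->
    \forall h \near (0 : V), `|f (h + x) - f x - df h| <= e * `|h|) ->
  differentiable f x /\ 'd f x = df :> (V -> W).
Proof.
move=> cdf H.
have E : f \o shift x = cst (f x) + df +o_ (0 : V) id.
  apply/eqaddoP => e e0 /=; near=> h.
  rewrite [leLHS](_ : _ = `|f (h + x) - f x - df h|); last first.
    by congr (`| _ |); rewrite /= !fctE opprD addrA.
  by near: h; exact: H.
have dE := diff_unique cdf E.
by split=> //; apply/diff_locallyP; rewrite dE.
Unshelve. all: by end_near. Qed.

Lemma differentiableE_eps (f : V -> W) (x : V) : differentiable f x ->
  forall e : R, 0 < e ->
    \forall h \near (0 : V), `|f (h + x) - f x - 'd f x h| <= e * `|h|.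
Proof.
move=> /diff_locally/eqaddoP H e e0.
apply: filterS (H e e0) => h /=.
by rewrite !fctE opprD addrA.
Qed.

Lemma near_eq_differentiable (f g : V -> W) (x : V) :
  (\near x, f x = g x) -> differentiable f x -> differentiable g x.
Proof.
move=> fg df; have fgx := nbhs_singleton fg.
have cd : continuous ('d f x) by apply: diff_continuous.
suff [] : differentiable g x /\ 'd g x = 'd f x :> (V -> W) by [].
apply: differentiable_eps => // e e0.
have fg0 : \forall h \near (0 : V), f (h + x) = g (h + x).
  by move: fg; rewrite (near_shift 0 x) subr0; apply: filterS => h.
have := differentiableE_eps df e0.
apply: filterS2 fg0 => h <-; by rewrite fgx.
Qed.

Lemma derive_sum_dir (I : Type) (s : seq I) (f : V -> W) (x : V) (c : I -> R) (b : I -> V) :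
  differentiable f x ->
  'D_(\sum_(i <- s) c i *: b i) f x = \sum_(i <- s) c i *: 'D_(b i) f x.
Proof.
move=> df; rewrite deriveE// linear_sum; apply: eq_bigr => i _.
by rewrite linearZ /= deriveE.
Qed.

End Differentiability.

Section CkCalculus.
Context {R : realType} {V : normedModType R}.
Implicit Types (W : normedModType R) (D : set V) (k : nat).

Lemma open_near (T : topologicalType) (D : set T) (P : T -> Prop) x : open D -> D x ->
  (forall y, D y -> P y) -> \near x, P x.
Proof. by move=> oD Dx DP; apply: filterS (open_nbhs_nbhs (conj oD Dx)). Qed.

Lemma Ck_sub W k D D' (F : V -> W) : D' `<=` D -> Ck k D F -> Ck k D' F.
Proof.
move=> DD'; elim: k F => [|k IH] F /=; first by move=> h x /DD'/h.
by case=> h1 h2; split=> [x /DD'/h1//|v]; apply: IH.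
Qed.

Lemma Ck_eq W k D (F G : V -> W) : open D ->
  (forall x, D x -> F x = G x) -> Ck k D F -> Ck k D G.
Proof.
move=> oD; elim: k F G => [|k IH] F G FG /=.
  move=> cF x Dx; have xD : \near x, F x = G x by apply: (open_near oD).
  have := cF x Dx; rewrite /prop_for /continuous_at (FG x Dx) => h.
  by apply: cvg_trans h; apply: near_eq_cvg; apply: filterS xD => y ->.
have nFG x : D x -> \near x, F x = G x by move=> Dx; apply: (open_near oD).
case=> dF CF; split=> [x Dx|v].
  exact: near_eq_differentiable (nFG x Dx) (dF x Dx).
apply: IH (CF v) => x Dx.
exact: near_eq_derive (nFG x Dx).
Qed.

Lemma CkS W k D (F : V -> W) : Ck k.+1 D F -> Ck k D F.
Proof.
elim: k F => [|k IH] F [dF CF].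
  by move=> x Dx; exact: differentiable_continuous (dF x Dx).
by split=> // v; apply: IH.
Qed.

Lemma Ck_cst W k D (c : W) : Ck k D (fun=> c).
Proof.
elim: k c => [|k IH] c /=; first by move=> x _; exact: cst_continuous.
split=> [x _|v]; first exact: differentiable_cst.
have -> : (fun x : V => 'D_v (fun=> c) x) = fun=> 0.
  by apply/funext => x; exact: derive_cst.
exact: IH.
Qed.

Lemma CkD W k D (F G : V -> W) : open D ->
  Ck k D F -> Ck k D G -> Ck k D (fun x => F x + G x).
Proof.
move=> oD; elim: k F G => [|k IH] F G /=.
  by move=> cF cG x Dx; apply: continuousD; [exact: cF|exact: cG].
move=> [dF CF] [dG CG]; split=> [x Dx|v].
  by apply: differentiableD; [exact: dF|exact: dG].
apply: Ck_eq (IH _ _ (CF v) (CG v)) => // x Dx.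
by rewrite -deriveD //; apply: diff_derivable; [exact: dF|exact: dG].
Qed.

Lemma Ck_sum W k D (I : Type) (s : seq I) (F : I -> V -> W) : open D ->
  (forall i, Ck k D (F i)) -> Ck k D (fun x => \sum_(i <- s) F i x).
Proof.
move=> oD CF; elim: s => [|i s IH].
  by apply: Ck_eq (Ck_cst k D 0) => // x _; rewrite big_nil.
by apply: Ck_eq (CkD oD (CF i) IH) => // x _; rewrite big_cons.
Qed.

Lemma derive_lin_comp W W' (L : {linear W -> W'}) (F : V -> W) x v :
  continuous L -> differentiable F x -> 'D_v (L \o F) x = L ('D_v F x).
Proof.
move=> cL dF.
have dL y : differentiable L y by exact: linear_differentiable.
rewrite deriveE; last exact: differentiable_comp.
by rewrite diff_comp //= diff_lin // deriveE.
Qed.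

Lemma Ck_lin W W' k D (L : {linear W -> W'}) (F : V -> W) : open D ->
  continuous L -> Ck k D F -> Ck k D (L \o F).
Proof.
move=> oD cL; elim: k F => [|k IH] F /=.
  by move=> cF x Dx; apply: continuous_comp; [exact: cF|exact: cL].
move=> [dF CF]; split=> [x Dx|v].
  by apply: differentiable_comp; [exact: dF|exact: linear_differentiable].
apply: Ck_eq (IH _ (CF v)) => // x Dx.
by rewrite derive_lin_comp //; exact: dF.
Qed.

Lemma Ck_id_lin W k D (L : {linear V -> W}) : open D -> continuous L -> Ck k D L.
Proof.
move=> oD cL; case: k => [|k] /=; first by move=> x _; exact: cL.
split=> [x _|v]; first exact: linear_differentiable.
apply: Ck_eq (Ck_cst k D (L v)) => // x Dx.
by rewrite deriveE ?diff_lin//; exact: linear_differentiable.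
Qed.

Lemma CkM k D (f g : V -> R) : open D ->
  Ck k D f -> Ck k D g -> Ck k D (fun x => f x * g x).
Proof.
move=> oD; elim: k f g => [|k IH] f g.
  by move=> cF cG x Dx; apply: continuousM; [exact: cF|exact: cG].
move=> Cf Cg; have [Cf' Cg'] := (CkS Cf, CkS Cg).
move: Cf Cg => [dF CF] [dG CG]; split=> [x Dx|v].
  by apply: differentiableM; [exact: dF|exact: dG].
have H := CkD oD (IH _ _ Cf' (CG v)) (IH _ _ Cg' (CF v)).
apply: Ck_eq oD _ H => x Dx.
by rewrite [RHS]deriveM //; apply: diff_derivable; [exact: dF|exact: dG].
Qed.

Lemma CkN k D (f : V -> R) : open D -> Ck k D f -> Ck k D (fun x => - f x).
Proof.
move=> oD Cf; have H := CkM oD (Ck_cst k D (-1 : R)) Cf.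
apply: Ck_eq oD _ H => x _.
by rewrite mulN1r.
Qed.

Lemma CkV k D (f : V -> R) : open D -> (forall x, D x -> f x != 0) ->
  Ck k D f -> Ck k D (fun x => (f x)^-1).
Proof.
move=> oD f0; elim: k => [|k IH] Cf.
  by move=> x Dx; apply: continuousV; [exact: f0|exact: Cf].
have Ci := IH (CkS Cf); case: Cf => dF CF; split=> [x Dx|v].
  by apply: differentiableV; [exact: dF|exact: f0].
have H := CkN oD (CkM oD (CkM oD Ci Ci) (CF v)).
apply: Ck_eq oD _ H => x Dx.
rewrite [RHS]deriveV ?f0//; last by apply: diff_derivable; exact: dF.
by rewrite -mulNr; congr (_ * _); rewrite -expr2 exprVn.
Qed.

End CkCalculus.

(** * Symmetry of second derivatives *)

Section Lines.
Context {R : realType} {V : normedModType R}.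

Lemma is_derive_line (W : normedModType R) (f : V -> W) (x u : V) (s : R) :
  derivable f (x + s *: u) u ->
  is_derive s (1 : R) (fun t : R => f (x + t *: u)) ('D_u f (x + s *: u)).
Proof.
move=> df.
have E : (fun h : R => h^-1 *: (((fun t : R => f (x + t *: u)) \o shift s) (h *: (1 : R))
            - f (x + s *: u))) =
         (fun h => h^-1 *: ((f \o shift (x + s *: u)) (h *: u) - f (x + s *: u))).
  apply/funext => h /=; congr (_ *: (f _ - _)).
  by rewrite scaler1 scalerDl addrCA addrA.
apply: DeriveDef; first by rewrite /derivable E; exact: df.
by rewrite /derive E.
Qed.

Lemma MVT_line (f g : R -> R) (h : R) : 0 < h ->
  (forall s : R, 0 <= s <= h -> is_derive s (1 : R) f (g s)) ->
  exists2 s : R, 0 <= s <= h & f h - f 0 = h * g s.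
Proof.
move=> h0 df.
have [||s] := @MVT R f g 0 h h0.
- move=> s /andP[]; rewrite !bnd_simp => s0 sh; apply: df.
  by rewrite (ltW s0) (ltW sh).
- apply: derivable_within_continuous => s /andP[]; rewrite !bnd_simp => s0 sh.
  have Hs := df s; by case: Hs => //; rewrite s0 sh.
move=> /andP[]; rewrite !bnd_simp => s0 sh E.
by exists s; [rewrite (ltW s0) (ltW sh) | rewrite E subr0 mulrC].
Qed.

(** The mean value theorem is applied twice, along [u] and then along [v]. *)
Lemma second_difference (D : set V) (f : V -> R) (x u v : V) (h : R) : 0 < h ->
  Ck 2 D f ->
  (forall s t : R, 0 <= s <= h -> 0 <= t <= h -> D (x + s *: u + t *: v)) ->
  exists s t : R, [/\ 0 <= s <= h, 0 <= t <= h &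
    f (x + h *: u + h *: v) - f (x + h *: u) - (f (x + h *: v) - f x)
    = h * (h * 'D_v (fun y => 'D_u f y) (x + s *: u + t *: v))].
Proof.
move=> h0 [df Cf] HD; have ddf y : D y -> differentiable ('D_u f) y := (Cf u).1 y.
have hh : 0 <= h <= h by rewrite lexx ltW.
have h00 : (0 : R) <= 0 <= h by rewrite lexx ltW.
pose g s := f (x + s *: u + h *: v) - f (x + s *: u).
have [s hs|s hs Es] := @MVT_line g (fun s => 'D_u f (x + s *: u + h *: v)
          - 'D_u f (x + s *: u)) h h0.
  apply: is_deriveB.
    have -> : (fun s => f (x + s *: u + h *: v)) = (fun s => f ((x + h *: v) + s *: u)).
      by apply/funext => y; rewrite addrAC.
    rewrite addrAC; apply: is_derive_line; apply: diff_derivable; apply: df; rewrite addrAC; exact: HD.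
  apply: is_derive_line; apply: diff_derivable; apply: df.
  by have := HD s 0 hs h00; rewrite scale0r addr0.
have [t ht|t ht Et] := @MVT_line (fun t => 'D_u f (x + s *: u + t *: v))
   (fun t => 'D_v (fun y => 'D_u f y) (x + s *: u + t *: v)) h h0.
  by apply: is_derive_line; apply: diff_derivable; apply: ddf; exact: HD.
exists s, t; split=> //; rewrite -Et !scale0r !addr0.
by move: Es; rewrite /g !scale0r !addr0.
Qed.

(** Schwarz's theorem. By the previous lemma, for both orders of [u] and [v],
    the two mixed derivatives take equal values at points arbitrarily close to
    [x], and both are continuous. *)
Lemma derive_comm (D : set V) (f : V -> R) (x u v : V) :
  open D -> D x -> Ck 2 D f ->
  'D_v (fun y => 'D_u f y) x = 'D_u (fun y => 'D_v f y) x.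
Proof.
move=> oD Dx Cf.
have [df CfD] := Cf.
have cuv := (CfD u).2 v x Dx; have cvu := (CfD v).2 u x Dx.
apply/eqP; rewrite -subr_eq0 -normr_le0; apply/ler_addgt0Pr => e e0; rewrite add0r.
have e2 : 0 < e / 2 by rewrite divr_gt0.
move/cvgrPdist_le: (cuv) => /(_ _ e2) Huv.
move/cvgrPdist_le: (cvu) => /(_ _ e2) Hvu.
have HD := open_nbhs_nbhs (conj oD Dx).
have [r /= r0 Hr] := (nbhs_ballP _ _).1 (filterI HD (filterI Huv Hvu)).
(* the parallelogram with sides [h u] and [h v] stays in the ball *)
pose h := r / (2 * (`|u| + `|v| + 1)).
have K0 : 0 < `|u| + `|v| + 1 by rewrite ltr_wpDl// addr_ge0.
have h0 : 0 < h by rewrite divr_gt0// mulr_gt0.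
have Hb s t : 0 <= s <= h -> 0 <= t <= h -> ball x r (x + s *: u + t *: v).
  move=> /andP[s0 sh] /andP[t0 th]; rewrite -ball_normE /ball_ /=.
  rewrite -addrA opprD addNKr normrN.
  apply: le_lt_trans (ler_normD _ _) _; rewrite !normrZ !ger0_norm//.
  apply: (@le_lt_trans _ _ (h * (`|u| + `|v|))).
    by rewrite mulrDr lerD// ler_wpM2r.
  apply: (@lt_trans _ _ (h * (`|u| + `|v| + 1))).
    by rewrite ltr_pM2l// ltrDl.
  rewrite /h invfM mulrA divfK ?gt_eqF//.
  by rewrite ltr_pdivrMr// ltr_pMr// ltr1n.
have [s [t [hs ht E1]]] := second_difference h0 Cf
  (fun s t hs ht => (Hr _ (Hb s t hs ht)).1).
have Hb' s' t' : 0 <= s' <= h -> 0 <= t' <= h -> ball x r (x + s' *: v + t' *: u).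
  by move=> ? ?; rewrite addrAC; apply: Hb.
have [s' [t' [hs' ht' E2]]] := second_difference h0 Cf
  (fun s t hs ht => (Hr _ (Hb' s t hs ht)).1).
have A1 := (Hr _ (Hb s t hs ht)).2.1.
have A2 := (Hr _ (Hb' s' t' hs' ht')).2.2.
move: E1 E2 A1 A2; rewrite /= [x + h *: v + _]addrAC.
move: ('D_v _ (x + s *: u + t *: v)) ('D_u _ (x + s' *: v + t' *: u)) => a b.
move: ('D_v _ x) ('D_u _ x) => a' b'.
move: (f _) (f _) (f _) (f x) => p1 p2 p3 p4 E1 E2 A1 A2.
have E : a = b.
  have hn : h != 0 by rewrite gt_eqF.
  apply: (mulfI hn); apply: (mulfI hn); rewrite -E1 -E2; ring.
rewrite -(subrKA a) (splitr e); apply: le_trans (ler_normD _ _) _.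
by rewrite lerD// distrC E.
Qed.

End Lines.

(** Regularity is defined through derivatives in fixed directions. A finite
    family of linear coordinates reduces to them the derivatives in varying
    directions that occur in the chain rule. *)
Record coordinates (R : realType) (W : normedModType R) := Coordinates {
  cidx : finType;
  cvec : cidx -> W;
  coor : cidx -> {linear W -> R};
  coor_cont : forall i, continuous (coor i);
  coorK : forall w, w = \sum_i coor i w *: cvec i }.

Section Coordinates.
Context {R : realType}.

Definition row_coor n (i : 'I_n) (w : 'rV[R]_n) : R := w 0 i.

Lemma row_coor_linear n (i : 'I_n) : linear (row_coor i).
Proof. by move=> a u v; rewrite /row_coor !mxE. Qed.
HB.instance Definition _ n (i : 'I_n) :=
  GRing.isLinear.Build R 'rV[R]_n R *:%R (row_coor i) (row_coor_linear i).

Lemma row_coor_cont n (i : 'I_n) : continuous (row_coor i).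
Proof. exact: coord_continuous. Qed.

Lemma row_coorK n (w : 'rV[R]_n) : w = \sum_i row_coor i w *: delta_mx 0 i.
Proof. exact: row_sum_delta. Qed.

Definition row_coordinates n : coordinates 'rV[R]_n :=
  @Coordinates R 'rV[R]_n 'I_n (fun i => delta_mx 0 i)
    (fun i => (row_coor i : {linear 'rV[R]_n -> R})) (@row_coor_cont n) (@row_coorK n).

End Coordinates.

(** * Coordinates and composition of C^k maps *)

Section FiniteDimension.
Context {R : realType}.

Definition pair_cvec (V W : normedModType R) (cV : coordinates V)
    (cW : coordinates W) (i : cidx cV + cidx cW) : V * W :=
  match i with inl i => (cvec i, 0) | inr i => (0, cvec i) end.

Definition pair_coor (V W : normedModType R) (cV : coordinates V)
    (cW : coordinates W) (i : cidx cV + cidx cW) : V * W -> R :=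
  match i with inl i => fun w => coor i w.1 | inr i => fun w => coor i w.2 end.

Lemma pair_coor_linear (V W : normedModType R) (cV : coordinates V)
    (cW : coordinates W) (i : cidx cV + cidx cW) : linear (pair_coor i).
Proof. by case: i => i a u v /=; rewrite linearP. Qed.
HB.instance Definition _ (V W : normedModType R) (cV : coordinates V)
    (cW : coordinates W) (i : cidx cV + cidx cW) :=
  GRing.isLinear.Build R (V * W)%type R *:%R (pair_coor i) (pair_coor_linear i).

Lemma pair_coor_cont (V W : normedModType R) (cV : coordinates V)
    (cW : coordinates W) (i : cidx cV + cidx cW) : continuous (pair_coor i).
Proof.
case: i => i w /=.
  by apply: (@continuous_comp _ _ _ fst (coor i)); [exact: cvg_fst|exact: coor_cont].
by apply: (@continuous_comp _ _ _ snd (coor i)); [exact: cvg_snd|exact: coor_cont].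
Qed.

Lemma pair_coorK (V W : normedModType R) (cV : coordinates V)
    (cW : coordinates W) (w : V * W) :
  w = \sum_(i : cidx cV + cidx cW) pair_coor i w *: pair_cvec i.
Proof.
rewrite big_sumType /=; case: w => x y /=.
apply/eqP; rewrite -pair_eqE /pair_eq /=.
have F1 (I : Type) (s : seq I) (G : I -> V * W) : (\sum_(i <- s) G i).1 = \sum_(i <- s) (G i).1.
  by elim/big_rec2: _ => //= i u v _ ->.
have F2 (I : Type) (s : seq I) (G : I -> V * W) : (\sum_(i <- s) G i).2 = \sum_(i <- s) (G i).2.
  by elim/big_rec2: _ => //= i u v _ ->.
rewrite !F1 !F2 /=.
rewrite [X in _ == _ + X]big1 ?[X in _ && (_ == X + _)]big1 ?addr0 ?add0r; last 2 first.
- by move=> i _; rewrite scaler0.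
- by move=> i _; rewrite scaler0.
by rewrite -!coorK !eqxx.
Qed.

Definition pair_coordinates (V W : normedModType R) (cV : coordinates V)
    (cW : coordinates W) : coordinates (V * W)%type :=
  @Coordinates R (V * W)%type _ (@pair_cvec V W cV cW)
    (fun i => (pair_coor i : {linear (V * W)%type -> R})) (@pair_coor_cont V W cV cW)
    (@pair_coorK V W cV cW).

Context {V W : normedModType R}.

Lemma Ck_coords (cW : coordinates W) k (D : set V) (F : V -> W) : open D ->
  (forall i, Ck k D (fun x => coor (c := cW) i (F x))) -> Ck k D F.
Proof.
move=> oD CF.
have scl (w : W) : linear ( *:%R ^~ w : R -> W).
  by move=> a u v; rewrite scalerDl scalerA.
pose L w : {linear R -> W} := HB.pack ( *:%R ^~ w : R -> W)
   (GRing.isLinear.Build R R W *:%R ( *:%R ^~ w) (scl w)).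
have H : Ck k D (fun x => \sum_i coor (c := cW) i (F x) *: cvec i).
  apply: Ck_sum => // => i.
  have := @Ck_lin R V R W k D (L (cvec i)) (fun x => coor (c := cW) i (F x)) oD.
  by apply; [exact: scalel_continuous | exact: CF].
by apply: Ck_eq oD _ H => x _; rewrite -coorK.
Qed.

Lemma derive_coords (cV : coordinates V) (f : V -> R) (x v : V) :
  differentiable f x ->
  'D_v f x = \sum_i coor (c := cV) i v * 'D_(cvec i) f x.
Proof. by move=> df; rewrite {1}(coorK cV v) derive_sum_dir. Qed.

(** In coordinates, a derivative of the composite is a sum of products of
    derivatives of [T] and of composites of [T] with first derivatives of [G],
    to which induction applies. *)
Lemma Ck_comp (X : normedModType R) (cV : coordinates V) k (D : set X) (D' : set V)
    (T : X -> V) (G : V -> R) : open D ->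
  (forall x, D x -> D' (T x)) -> Ck k D T -> Ck k D' G -> Ck k D (G \o T).
Proof.
move=> oD DT; elim: k G => [|k IH] G.
  by move=> cT cG x Dx; apply: continuous_comp; [exact: cT|apply: cG; exact: DT].
move=> CT CG; have CT' := CkS CT; case: CT CG => dT CT [dG CG].
split=> [x Dx|v].
  by apply: differentiable_comp; [exact: dT|apply: dG; exact: DT].
have H : Ck k D (fun x => \sum_i coor (c := cV) i ('D_v T x) * 'D_(cvec i) G (T x)).
  apply: Ck_sum => // => i; apply: CkM => //; first exact: (@Ck_lin R X V R k D (coor i) ('D_v T) oD (@coor_cont _ _ cV i) (CT v)).
  exact: (IH _ CT' (CG (cvec i))).
apply: Ck_eq oD _ H => x Dx.
have dTx := dT x Dx; have dGx := dG _ (DT x Dx).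
rewrite -derive_coords // !deriveE //; last exact: differentiable_comp.
have := diff_comp dTx dGx => ->.
reflexivity.
Qed.

(** A product rule: in coordinates the expression is a sum of products of a
    component of [Y] and a first derivative of [K]. *)
Lemma derive_along (cV : coordinates V) (D : set V) (K : V -> R) (Y : V -> V) (z v : V) :
  open D -> D z -> Ck 2 D K -> differentiable Y z ->
  'D_v (fun w => 'D_(Y w) K w) z =
  'D_('D_v Y z) K z + 'D_v (fun w => 'D_(Y z) K w) z.
Proof.
move=> oD Dz [dK CK] dY; have dKz := dK z Dz.
have ddK i : differentiable ('D_(cvec (c := cV) i) K) z by exact: (CK (cvec i)).1.
have dc i : differentiable (fun w => coor (c := cV) i (Y w)) z.
  apply: (@differentiable_comp _ _ _ _ Y (coor (c := cV) i)) => //.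
  by apply: linear_differentiable; exact: coor_cont.
have expand (G : V -> V) : (forall i, differentiable (fun w => coor (c := cV) i (G w)) z) ->
  'D_v (fun w => 'D_(G w) K w) z = \sum_(i : cidx cV) (coor i (G z) * 'D_v ('D_(cvec i) K) z +
      'D_(cvec i) K z * 'D_v (fun w => coor i (G w)) z).
  move=> dG.
  have E : \near z, 'D_(G z) K z = (\sum_(i : cidx cV) (fun w => coor i (G w) * 'D_(cvec i) K w)) z.
    apply: (open_near oD Dz) => w Dw.
    by rewrite fct_sumE -derive_coords //; exact: dK.
  rewrite (near_eq_derive v E).
  elim: (index_enum _) => [|i s IH].
    by rewrite !big_nil; exact: derive_cst.
  have dsum : differentiable (\sum_(i <- s) (fun w => coor i (G w) * 'D_(cvec i) K w)) z.
    elim: s {IH} => [|j s IH]; first by rewrite big_nil; exact: differentiable_cst.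
    rewrite big_cons; apply: differentiableD IH.
    by apply: differentiableM.
  rewrite !big_cons deriveD ?IH; last 2 first.
  - by apply: diff_derivable; apply: differentiableM.
  - exact: diff_derivable.
  by congr (_ + _); rewrite [LHS]deriveM //; apply: diff_derivable.
have d0 i : differentiable (fun _ : V => coor (c := cV) i (Y z)) z.
  exact: differentiable_cst.
rewrite (expand Y dc) (expand (fun=> Y z) d0).
rewrite (derive_coords cV ('D_v Y z) dKz) -big_split /=; apply: eq_bigr => i _.
rewrite (@derive_cst _ _ _ (coor i (Y z))) mulr0 addr0 addrC; congr (_ + _).
have E := @derive_lin_comp R V V R (coor i) Y z v (@coor_cont _ _ cV i) dY.
by rewrite -E mulrC.
Qed.

(** The mean value theorem along segments compares the increments of [f] with
    the form at the base point. *)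
Lemma differentiable_form (cV : coordinates V) (D : set V) (f : V -> R)
    (om : cidx cV -> V -> R) (x0 : V) : open D -> D x0 ->
  (forall x v, D x -> is_derive x v f (\sum_i coor i v * om i x)) ->
  (forall i, {for x0, continuous (om i)}) ->
  differentiable f x0.
Proof.
move=> oD Dx0 df com.
pose L v := \sum_i coor (c := cV) i v * om i x0.
have linL : linear L.
  move=> a u v; rewrite /L scaler_sumr -big_split /=; apply: eq_bigr => i _.
  by rewrite linearP mulrDl scalerAl.
pose LL : {linear V -> R} := HB.pack L (GRing.isLinear.Build R V R *:%R L linL).
have cL : continuous LL.
  rewrite /LL /= /L; elim: (index_enum _) => [|i s IH] v.
    under eq_fun do rewrite big_nil.
    exact: cst_continuous.
  have -> : (fun v => \sum_(j <- i :: s) coor j v * om j x0) =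
     (fun v => coor i v * om i x0) \+ (fun v => \sum_(j <- s) coor j v * om j x0).
    by apply/funext => w; rewrite big_cons.
  apply: continuousD; last exact: IH.
  by apply: continuousM; [exact: coor_cont|exact: cst_continuous].
have kex i : exists k : R, 0 < k /\ forall v, `|coor (c := cV) i v| <= k * `|v|.
  by have [k k0 Hk] := linear_lipschitz (@coor_cont _ _ cV i); exists k.
have [kk Hkk] := choice kex.
pose K := 1 + \sum_i kk i.
have K0 : 0 < K by rewrite /K ltr_wpDr// sumr_ge0// => i _; have [/ltW] := Hkk i.
suff [] : differentiable f x0 /\ 'd f x0 = LL :> (V -> R) by [].
apply: differentiable_eps => // e e0.
have eK : 0 < e / K by rewrite divr_gt0.
have N1 : \forall x \near x0, forall i, `|om i x0 - om i x| <= e / K.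
  apply: filter_forall => i.
  by have /cvgrPdist_le/(_ _ eK) := com i.
have [r /= r0 Hr] := (nbhs_ballP _ _).1 (filterI (open_nbhs_nbhs (conj oD Dx0)) N1).
apply/nbhs_ballP; exists r => // h; rewrite -ball_normE /ball_ /= sub0r normrN => hr.
have Hb s : 0 <= s <= 1 -> ball x0 r (x0 + s *: h).
  move=> /andP[s0 s1]; rewrite -ball_normE /ball_ /= opprD addNKr normrN normrZ.
  by apply: le_lt_trans hr; rewrite ger0_norm// ler_piMl.
have [s hs|s hs E] := @MVT_line R (fun s => f (x0 + s *: h))
   (fun s => \sum_i coor i h * om i (x0 + s *: h)) 1 ltr01.
  have Hd := df _ h (Hr _ (Hb s hs)).1.
  by apply: is_derive_eq (is_derive_line _) _; case: Hd.
rewrite [h + x0]addrC; move: E; rewrite scale1r scale0r addr0 mul1r => ->.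
rewrite /LL /= /L -sumrB.
apply: le_trans (ler_norm_sum _ _ _) _.
apply: (@le_trans _ _ (\sum_i (kk i * `|h|) * (e / K))).
  apply: ler_sum => i _; rewrite -mulrBr normrM ler_pM//.
    by have [_] := Hkk i; apply.
  by rewrite distrC; apply: (Hr _ (Hb s hs)).2.
rewrite -!mulr_suml mulrAC ler_wpM2r// mulrA ler_pdivrMr// mulrC ler_wpM2l ?(ltW e0)//.
by rewrite /K lerDr.
Qed.
End FiniteDimension.

Section Trigonometry.
Context {R : realType} {V : normedModType R}.

Lemma derive_comp1 (g : R -> R) (f : V -> R) (x v : V) (dg : R) :
  is_derive (f x) (1 : R) g dg -> differentiable f x ->
  differentiable (g \o f) x /\ 'D_v (g \o f) x = dg * 'D_v f x.
Proof.
move=> [dgx gE] df.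
have dg' : differentiable g (f x) by exact/derivable1_diffP.
split; first exact: differentiable_comp.
rewrite deriveE; last exact: differentiable_comp.
have -> := diff_comp df dg'.
by rewrite /= -(deriveE v df) diff1E//= derive1E gE mulrC.
Qed.

Lemma Ck_cos_sin k (D : set V) (f : V -> R) : open D -> Ck k D f ->
  Ck k D (fun x => cos (f x)) /\ Ck k D (fun x => sin (f x)).
Proof.
move=> oD; elim: k => [|k IH] Cf.
  split=> x Dx.
    by apply: (@continuous_comp _ _ _ f (@cos R)); [exact: Cf|exact: continuous_cos].
  by apply: (@continuous_comp _ _ _ f (@sin R)); [exact: Cf|exact: continuous_sin].
have [Cc Cs] := IH (CkS Cf); case: Cf => df CF.
have dc x v : D x -> differentiable (@cos R \o f) x /\
    'D_v (@cos R \o f) x = - sin (f x) * 'D_v f x.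
  by move=> Dx; apply: derive_comp1; exact: df.
have ds x v : D x -> differentiable (@sin R \o f) x /\
    'D_v (@sin R \o f) x = cos (f x) * 'D_v f x.
  by move=> Dx; apply: derive_comp1; exact: df.
split; split=> [x Dx|v].
- by have [] := dc x 0 Dx.
- have H := CkM oD (CkN oD Cs) (CF v).
  by apply: Ck_eq oD _ H => x Dx; have [_ ->] := dc x v Dx.
- by have [] := ds x 0 Dx.
- have H := CkM oD Cc (CF v).
  by apply: Ck_eq oD _ H => x Dx; have [_ ->] := ds x v Dx.
Qed.

Lemma Ck_atan k (D : set V) (f : V -> R) : open D -> Ck k D f ->
  Ck k D (fun x => atan (f x)).
Proof.
move=> oD; case: k => [|k] Cf.
  move=> x Dx.
  by apply: (@continuous_comp _ _ _ f (@atan R)); [exact: Cf|exact: continuous_atan].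
have Cf' := CkS Cf; case: Cf => df CF.
have dc x v : D x -> differentiable (@atan R \o f) x /\
    'D_v (@atan R \o f) x = (1 + f x ^+ 2)^-1 * 'D_v f x.
  by move=> Dx; apply: derive_comp1; exact: df.
split=> [x Dx|v]; first by have [] := dc x 0 Dx.
have n0 x : D x -> 1 + f x * f x != 0.
  by move=> _; rewrite gt_eqF// ltr_pwDl// -expr2 sqr_ge0.
have H := CkM oD (CkV oD n0 (CkD oD (Ck_cst k D (1 : R)) (CkM oD Cf' Cf'))) (CF v).
by apply: Ck_eq oD _ H => x Dx; have [_ ->] := dc x v Dx; rewrite expr2.
Qed.

End Trigonometry.

(** * Differentiation of complex-valued maps *)

Section ComplexParts.
Context {R : realType}.
Implicit Types x y : R[i].
Local Notation Re := (@complex.Re R).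
Local Notation Im := (@complex.Im R).

Lemma complexP x y : Re x = Re y -> Im x = Im y -> x = y.
Proof. by case: x y => [a b] [c d] /= -> ->. Qed.

Lemma ReD x y : Re (x + y) = Re x + Re y. Proof. by case: x y => [? ?] [? ?]. Qed.
Lemma ImD x y : Im (x + y) = Im x + Im y. Proof. by case: x y => [? ?] [? ?]. Qed.
Lemma ReN x : Re (- x) = - Re x. Proof. by case: x. Qed.
Lemma ImN x : Im (- x) = - Im x. Proof. by case: x. Qed.
Lemma ReM x y : Re (x * y) = Re x * Re y - Im x * Im y.
Proof. by case: x y => [? ?] [? ?]. Qed.
Lemma ImM x y : Im (x * y) = Re x * Im y + Im x * Re y.
Proof. by case: x y => [? ?] [? ?]. Qed.
Lemma ReJ x : Re (conjc x) = Re x. Proof. by case: x. Qed.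
Lemma ImJ x : Im (conjc x) = - Im x. Proof. by case: x. Qed.
Lemma ReV x : Re x^-1 = Re x * (Re x ^+ 2 + Im x ^+ 2)^-1. Proof. by case: x. Qed.
Lemma ImV x : Im x^-1 = - (Im x * (Re x ^+ 2 + Im x ^+ 2)^-1).
Proof. by case: x. Qed.
Definition ReImE := (ReD, ImD, ReN, ImN, ReM, ImM, ReJ, ImJ).

Lemma complex_eq0 x : (x == 0) = (Re x ^+ 2 + Im x ^+ 2 == 0).
Proof.
case: x => a b; rewrite eq_complex /= paddr_eq0 ?sqr_ge0//.
by rewrite !sqrf_eq0.
Qed.

End ComplexParts.

Section ProductRules.
Context {R : realType} {X : normedModType R}.
Implicit Types (f g h k : X -> R) (x v : X).

Lemma derive_mul f g x v : differentiable f x -> differentiable g x ->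
  differentiable (fun y => f y * g y) x /\
  'D_v (fun y => f y * g y) x = 'D_v f x * g x + f x * 'D_v g x.
Proof.
move=> df dg; split; first by apply: differentiableM.
rewrite [LHS]deriveM; [|exact: diff_derivable..].
by rewrite addrC; congr (_ + _); exact: mulrC.
Qed.

Lemma derive_re f g h k x v : differentiable f x -> differentiable g x ->
  differentiable h x -> differentiable k x ->
  'D_v (fun y => f y * h y - g y * k y) x =
  'D_v f x * h x - 'D_v g x * k x + (f x * 'D_v h x - g x * 'D_v k x).
Proof.
move=> df dg dh dk.
have [d1 e1] := derive_mul v df dh; have [d2 e2] := derive_mul v dg dk.
have := deriveB (diff_derivable (v:=v) d1) (diff_derivable (v:=v) d2).
rewrite e1 e2 opprD addrACA => <-; reflexivity.
Qed.

Lemma derive_im f g h k x v : differentiable f x -> differentiable g x ->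
  differentiable h x -> differentiable k x ->
  'D_v (fun y => f y * k y + g y * h y) x =
  'D_v f x * k x + 'D_v g x * h x + (f x * 'D_v k x + g x * 'D_v h x).
Proof.
move=> df dg dh dk.
have [d1 e1] := derive_mul v df dk; have [d2 e2] := derive_mul v dg dh.
have := deriveD (diff_derivable (v:=v) d1) (diff_derivable (v:=v) d2).
rewrite e1 e2 addrACA => <-; reflexivity.
Qed.

End ProductRules.

Section ComplexCalculus.
Context {R : realType} {X : normedModType R}.
Implicit Types (D : set X) (c d : X -> R[i]).
Local Notation Re := (@complex.Re R).
Local Notation Im := (@complex.Im R).

Definition csmooth D c : Prop :=
  smooth_on D (fun x => Re (c x)) /\ smooth_on D (fun x => Im (c x)).

Definition cder (v : X) c (x : X) : R[i] :=
  'D_v (fun y => Re (c y)) x +i* 'D_v (fun y => Im (c y)) x.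

Lemma smooth_diff (W : normedModType R) D (F : X -> W) x :
  smooth_on D F -> D x -> differentiable F x.
Proof. by move=> /(_ 1%N) [+ _] Dx; apply. Qed.

Lemma smooth_derivable (W : normedModType R) D (F : X -> W) x v :
  smooth_on D F -> D x -> derivable F x v.
Proof. by move=> sF Dx; apply/diff_derivable/(smooth_diff sF). Qed.

Lemma smooth_derive (W : normedModType R) D (F : X -> W) v :
  smooth_on D F -> smooth_on D ('D_v F).
Proof. by move=> sF k; have [_] := sF k.+1; apply. Qed.

Lemma smooth_eq (W : normedModType R) D (F G : X -> W) : open D ->
  (forall x, D x -> F x = G x) -> smooth_on D F -> smooth_on D G.
Proof. by move=> oD FG sF k; apply: Ck_eq oD FG (sF k). Qed.

Lemma smooth_sub (W : normedModType R) D D' (F : X -> W) :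
  D' `<=` D -> smooth_on D F -> smooth_on D' F.
Proof. by move=> DD sF k; apply: Ck_sub DD (sF k). Qed.

Lemma csmooth_eq D c d : open D ->
  (forall x, D x -> c x = d x) -> csmooth D c -> csmooth D d.
Proof.
by move=> oD cd [h1 h2]; split; [apply: smooth_eq h1|apply: smooth_eq h2];
  move=> // x Dx; rewrite cd.
Qed.

Lemma cder_near (v x : X) c d : (\near x, c x = d x) -> cder v c x = cder v d x.
Proof.
move=> cd; rewrite /cder; congr (_ +i* _); apply: near_eq_derive;
  by apply: filterS cd => y ->.
Qed.

Lemma cder_eq D v x c d : open D -> D x -> (forall x, D x -> c x = d x) ->
  cder v c x = cder v d x.
Proof. by move=> oD Dx cd; apply: cder_near; apply: open_near cd. Qed.

Lemma csmooth_cst D (a : R[i]) : csmooth D (fun=> a).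
Proof. by split=> k; exact: Ck_cst. Qed.

Lemma cder_cst (a : R[i]) (v x : X) : cder v (fun=> a) x = 0.
Proof. by rewrite /cder !derive_cst. Qed.

Lemma csmoothR D (f : X -> R) : smooth_on D f -> csmooth D (fun x => (f x)%:C).
Proof. by move=> sf; split=> // k; exact: Ck_cst. Qed.

Section Open.
Variables (D : set X) (oD : open D).

Lemma csmoothD c d : csmooth D c -> csmooth D d -> csmooth D (fun x => c x + d x).
Proof.
move=> [c1 c2] [d1 d2]; split.
  by apply: (smooth_eq oD _ (fun k => CkD oD (c1 k) (d1 k))) => x _; rewrite ReD.
by apply: (smooth_eq oD _ (fun k => CkD oD (c2 k) (d2 k))) => x _; rewrite ImD.
Qed.

Lemma csmoothN c : csmooth D c -> csmooth D (fun x => - c x).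
Proof.
move=> [c1 c2]; split.
  by apply: (smooth_eq oD _ (fun k => CkN oD (c1 k))) => x _; rewrite ReN.
by apply: (smooth_eq oD _ (fun k => CkN oD (c2 k))) => x _; rewrite ImN.
Qed.

Lemma csmoothJ c : csmooth D c -> csmooth D (fun x => conjc (c x)).
Proof.
move=> [c1 c2]; split.
  by apply: smooth_eq oD _ c1 => x _; rewrite ReJ.
by apply: (smooth_eq oD _ (fun k => CkN oD (c2 k))) => x _; rewrite ImJ.
Qed.

Lemma csmoothM c d : csmooth D c -> csmooth D d -> csmooth D (fun x => c x * d x).
Proof.
move=> [c1 c2] [d1 d2]; split.
  apply: (smooth_eq oD _ (fun k => CkD oD (CkM oD (c1 k) (d1 k))
    (CkN oD (CkM oD (c2 k) (d2 k))))) => x _.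
  by rewrite ReM.
apply: (smooth_eq oD _ (fun k => CkD oD (CkM oD (c1 k) (d2 k))
  (CkM oD (c2 k) (d1 k)))) => x _.
by rewrite ImM.
Qed.

Lemma csmoothV c : (forall x, D x -> c x != 0) -> csmooth D c ->
  csmooth D (fun x => (c x)^-1).
Proof.
move=> c0 [c1 c2].
have n0 x : D x -> Re (c x) * Re (c x) + Im (c x) * Im (c x) != 0.
  by move=> Dx; have := c0 x Dx; rewrite complex_eq0 !expr2.
have H k := CkV oD n0 (CkD oD (CkM oD (c1 k) (c1 k)) (CkM oD (c2 k) (c2 k))).
split.
  apply: (smooth_eq oD _ (fun k => CkM oD (c1 k) (H k))) => x _.
  by rewrite ReV !expr2.
apply: (smooth_eq oD _ (fun k => CkN oD (CkM oD (c2 k) (H k)))) => x _.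
by rewrite ImV !expr2.
Qed.

Lemma csmooth_sum (I : Type) (s : seq I) (c : I -> X -> R[i]) :
  (forall i, csmooth D (c i)) -> csmooth D (fun x => \sum_(i <- s) c i x).
Proof.
move=> sc; elim: s => [|i s IH].
  by apply: csmooth_eq oD _ (csmooth_cst D 0) => x _; rewrite big_nil.
by apply: csmooth_eq oD _ (csmoothD (sc i) IH) => x _; rewrite big_cons.
Qed.

Variables (x : X) (Dx : D x) (v : X).

Lemma cderD c d : csmooth D c -> csmooth D d ->
  cder v (fun x => c x + d x) x = cder v c x + cder v d x.
Proof.
move=> [c1 c2] [d1 d2]; apply: complexP; rewrite ReImE /=.
  rewrite -deriveD; [|exact: smooth_derivable Dx..].
  by congr ('D_v _ x); apply/funext => y; rewrite ReD.
rewrite -deriveD; [|exact: smooth_derivable Dx..].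
by congr ('D_v _ x); apply/funext => y; rewrite ImD.
Qed.

Lemma cderJ c : csmooth D c ->
  cder v (fun x => conjc (c x)) x = conjc (cder v c x).
Proof.
move=> [c1 c2]; apply: complexP; rewrite ReImE /=.
  by congr ('D_v _ x); apply/funext => y; rewrite ReJ.
rewrite -deriveN; last exact: smooth_derivable Dx.
by congr ('D_v _ x); apply/funext => y; rewrite ImJ.
Qed.

Lemma cderM c d : csmooth D c -> csmooth D d ->
  cder v (fun x => c x * d x) x = cder v c x * d x + c x * cder v d x.
Proof.
move=> [c1 c2] [d1 d2].
have [e1 e2] := (smooth_diff c1 Dx, smooth_diff c2 Dx).
have [e3 e4] := (smooth_diff d1 Dx, smooth_diff d2 Dx).
apply: complexP; rewrite !ReImE /=.
  rewrite -[RHS](derive_re _ e1 e2 e3 e4).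
  by congr ('D_v _ x); apply/funext => y; rewrite ReM.
rewrite -[RHS](derive_im _ e1 e2 e3 e4).
by congr ('D_v _ x); apply/funext => y; rewrite ImM.
Qed.

Lemma cder_sum (I : Type) (s : seq I) (c : I -> X -> R[i]) :
  (forall i, csmooth D (c i)) ->
  cder v (fun x => \sum_(i <- s) c i x) x = \sum_(i <- s) cder v (c i) x.
Proof.
move=> sc; elim: s => [|i s IH].
  rewrite big_nil; transitivity (cder v (fun=> 0) x); last exact: cder_cst.
  by apply: (cder_eq _ oD Dx) => y _; rewrite big_nil.
rewrite big_cons -IH -cderD//; last exact: csmooth_sum.
by apply: (cder_eq _ oD Dx) => y _; rewrite big_cons.
Qed.

End Open.
End ComplexCalculus.

HB.lock Definition vder (R : realType) (n : nat) (X : normedModType R) (v : X)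
    (F : X -> 'rV[R[i]]_n.+2) (x : X) : 'rV[R[i]]_n.+2 :=
  cplx ('D_v (fun y => realify (F y)) x).

Section VectorCalculus.
Context {R : realType} {n : nat} {X : normedModType R}.
Local Notation V := 'rV[R[i]]_n.+2.
Local Notation VR := ('rV[R]_n.+2 * 'rV[R]_n.+2)%type.
Implicit Types (D : set X) (c : X -> R[i]) (F G : X -> V).
Local Notation Re := (@complex.Re R).
Local Notation Im := (@complex.Im R).

Lemma rowD (z w : V) j : (z + w) 0 j = z 0 j + w 0 j. Proof. exact: mxE. Qed.
Lemma rowZ (a : R[i]) (z : V) j : (a *: z) 0 j = a * z 0 j. Proof. exact: mxE. Qed.
Lemma rowJ (z : V) j : conjv z 0 j = conjc (z 0 j). Proof. exact: mxE. Qed.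

Lemma realifyK : cancel (@realify R n) (@cplx R n).
Proof. by move=> z; apply/rowP => j; rewrite !mxE; case: (z 0 j). Qed.
Lemma cplxK : cancel (@cplx R n) (@realify R n).
Proof. by move=> [u w]; congr pair; apply/rowP => j; rewrite !mxE. Qed.

Lemma realifyD (z w : V) : realify (z + w) = realify z + realify w.
Proof. by congr pair; apply/rowP => j; rewrite !mxE ?ReD ?ImD. Qed.
Lemma realifyZ (a : R) (z : V) : realify (a%:C *: z) = a *: realify z.
Proof. by congr pair; apply/rowP => j; rewrite !mxE ?ReM ?ImM /= mul0r ?subr0 ?addr0. Qed.
Lemma cplxD (z w : VR) : cplx (z + w) = cplx z + cplx w.
Proof. by apply: (can_inj realifyK); rewrite realifyD !cplxK. Qed.
Lemma cplxZ (a : R) (z : VR) : cplx (a *: z) = a%:C *: cplx z.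
Proof. by apply: (can_inj realifyK); rewrite realifyZ !cplxK. Qed.

Definition VR_coordinates : coordinates VR :=
  pair_coordinates (row_coordinates n.+2) (row_coordinates n.+2).

Definition vsmooth D F : Prop := smooth_on D (fun x => realify (F x)).

Lemma vsmoothP D F : open D ->
  (vsmooth D F <-> forall j, csmooth D (fun x => F x 0 j)).
Proof.
move=> oD; split=> [sF j|sF k].
  have H i k := Ck_lin oD (@coor_cont _ _ VR_coordinates i) (sF k).
  split=> k; [have := H (inl j) k|have := H (inr j) k]; apply: Ck_eq => // x _ /=;
    by rewrite /row_coor mxE.
apply: (@Ck_coords _ _ _ VR_coordinates) => // i.
have : Ck k D (fun x => match i with inl j => Re (F x 0 j) | inr j => Im (F x 0 j) end).
  by case: i => j; have [h1 h2] := sF j.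
apply: Ck_eq => // x _; case: i => j; by rewrite /= /row_coor mxE.
Qed.

Lemma vder_coord D F v x j : vsmooth D F -> D x ->
  vder v F x 0 j = cder v (fun y => F y 0 j) x.
Proof.
move=> sF Dx; rewrite vder.unlock mxE; apply: complexP => /=.
  have := derive_lin_comp v (@coor_cont _ _ VR_coordinates (inl j)) (smooth_diff sF Dx).
  rewrite [RHS]/= /row_coor => <-; congr ('D_v _ x); apply/funext => y /=.
  by rewrite /row_coor mxE.
have := derive_lin_comp v (@coor_cont _ _ VR_coordinates (inr j)) (smooth_diff sF Dx).
rewrite [RHS]/= /row_coor => <-; congr ('D_v _ x); apply/funext => y /=.
by rewrite /row_coor mxE.
Qed.

Lemma vsmooth_eq D F G : open D -> (forall x, D x -> F x = G x) ->
  vsmooth D F -> vsmooth D G.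
Proof. by move=> oD FG; apply: smooth_eq => // x Dx; rewrite FG. Qed.

Lemma vsmooth_cst D (z : V) : vsmooth D (fun=> z).
Proof. by move=> k; exact: Ck_cst. Qed.

Section Open.
Variables (D : set X) (oD : open D).

Lemma vsmoothZ c F : csmooth D c -> vsmooth D F -> vsmooth D (fun x => c x *: F x).
Proof.
move=> sc /(vsmoothP _ oD) sF; apply/(vsmoothP _ oD) => j.
by apply: csmooth_eq oD _ (csmoothM oD sc (sF j)) => x _; rewrite mxE.
Qed.

Lemma vsmoothD F G : vsmooth D F -> vsmooth D G -> vsmooth D (fun x => F x + G x).
Proof.
move=> /(vsmoothP _ oD) sF /(vsmoothP _ oD) sG; apply/(vsmoothP _ oD) => j.
by apply: csmooth_eq oD _ (csmoothD oD (sF j) (sG j)) => x _; rewrite mxE.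
Qed.

Lemma vsmoothJ F : vsmooth D F -> vsmooth D (fun x => conjv (F x)).
Proof.
move=> /(vsmoothP _ oD) sF; apply/(vsmoothP _ oD) => j.
by apply: csmooth_eq oD _ (csmoothJ oD (sF j)) => x _; rewrite mxE.
Qed.

Lemma csmooth_hform F G : vsmooth D F -> vsmooth D G ->
  csmooth D (fun x => hform (F x) (G x)).
Proof.
move=> /(vsmoothP _ oD) sF /(vsmoothP _ oD) sG; apply: csmooth_sum => // j.
apply: (csmoothM oD (csmoothM oD _ (sF j)) (csmoothJ oD (sG j))).
exact: csmooth_cst.
Qed.

Lemma vsmooth_mulmx F (B : 'M[R[i]]_n.+2) : vsmooth D F -> vsmooth D (fun x => F x *m B).
Proof.
move=> /(vsmoothP _ oD) sF; apply/(vsmoothP _ oD) => j.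
have H : csmooth D (fun x => \sum_i F x 0 i * B i j).
  by apply: csmooth_sum => // i; apply: csmoothM => //; exact: csmooth_cst.
by apply: csmooth_eq oD _ H => x _; rewrite mxE.
Qed.

Variables (x : X) (Dx : D x) (v : X).

Lemma vderZ c F : csmooth D c -> vsmooth D F ->
  vder v (fun x => c x *: F x) x = cder v c x *: F x + c x *: vder v F x.
Proof.
move=> sc sF; apply/rowP => j.
rewrite (vder_coord _ _ (vsmoothZ sc sF) Dx) rowD !rowZ.
have sFj := (vsmoothP _ oD).1 sF j.
rewrite (vder_coord _ _ sF Dx) -(cderM Dx)//.
by apply: (cder_eq _ oD Dx) => y _; rewrite ?rowD ?rowZ ?rowJ.
Qed.

Lemma vderJ F : vsmooth D F -> vder v (fun x => conjv (F x)) x = conjv (vder v F x).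
Proof.
move=> sF; apply/rowP => j.
rewrite (vder_coord _ _ (vsmoothJ sF) Dx) rowJ (vder_coord _ _ sF Dx).
rewrite -(cderJ Dx); [|exact: (vsmoothP _ oD).1..].
by apply: (cder_eq _ oD Dx) => y _; rewrite ?rowD ?rowZ ?rowJ.
Qed.

Lemma cder_hform F G : vsmooth D F -> vsmooth D G ->
  cder v (fun x => hform (F x) (G x)) x =
  hform (vder v F x) (G x) + hform (F x) (vder v G x).
Proof.
move=> sF sG; have [cF cG] := ((vsmoothP _ oD).1 sF, (vsmoothP _ oD).1 sG).
have cst (j : 'I_n.+2) : csmooth D (fun x => (eps j)%:C : R[i]) by exact: csmooth_cst.
have H j := csmoothM oD (csmoothM oD (cst j) (cF j)) (csmoothJ oD (cG j)).
rewrite /hform (cder_sum oD Dx _ _ H) -big_split /=.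
apply: eq_bigr => j _.
rewrite (cderM Dx _ (csmoothM oD (cst j) (cF j)) (csmoothJ oD (cG j))).
rewrite (cderM Dx _ (cst j) (cF j)) (cderJ Dx _ (cG j)) cder_cst.
rewrite (vder_coord _ _ sF Dx) (vder_coord _ _ sG Dx); ring.
Qed.

End Open.
End VectorCalculus.

(** * The indefinite forms on R^(n+2) and C^(n+2) *)

Section HermitianForm.
Context {R : realType} {n : nat}.
Local Notation V := 'rV[R[i]]_n.+2.
Implicit Types (z w u : V) (c : R[i]).
Local Notation Re := (@complex.Re R).
Local Notation Im := (@complex.Im R).

Lemma conjcM (x y : R[i]) : conjc (x * y) = conjc x * conjc y.
Proof. exact: rmorphM. Qed.
Lemma conjcD (x y : R[i]) : conjc (x + y) = conjc x + conjc y.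
Proof. exact: rmorphD. Qed.
Lemma conjcN (x : R[i]) : conjc (- x) = - conjc x.
Proof. exact: rmorphN. Qed.

Lemma hformDl z w u : hform (z + w) u = hform z u + hform w u.
Proof. by rewrite -big_split; apply: eq_bigr => j _; rewrite rowD mulrDr mulrDl. Qed.
Lemma hformZl c z u : hform (c *: z) u = c * hform z u.
Proof. by rewrite mulr_sumr; apply: eq_bigr => j _; rewrite rowZ !mulrA [c * _]mulrC. Qed.
Lemma hform_conj z w : conjc (hform z w) = hform w z.
Proof.
rewrite rmorph_sum; apply: eq_bigr => j _.
by rewrite [LHS]conjcM conjcM conjcK conjc_real mulrAC.
Qed.
Lemma hformDr z w u : hform u (z + w) = hform u z + hform u w.
Proof. by rewrite -!(hform_conj _ u) hformDl conjcD. Qed.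
Lemma hformZr c z u : hform u (c *: z) = conjc c * hform u z.
Proof. by rewrite -!(hform_conj _ u) hformZl conjcM. Qed.
Lemma hform0l u : hform 0 u = 0 :> R[i].
Proof. by rewrite -(scale0r 0) hformZl mul0r. Qed.
Lemma hform0r u : hform u 0 = 0 :> R[i].
Proof. by rewrite -hform_conj hform0l conjc0. Qed.
Lemma hformNl z u : hform (- z) u = - hform z u.
Proof. by rewrite -scaleN1r hformZl mulN1r. Qed.
Lemma hformNr z u : hform u (- z) = - hform u z.
Proof. by rewrite -!(hform_conj _ u) hformNl conjcN. Qed.
Definition hformE := (hformDl, hformDr, hformZl, hformZr, hformNl, hformNr).

Lemma conjvK : involutive (@conjv R n).
Proof. by move=> z; apply/rowP => j; rewrite !mxE conjcK. Qed.
Lemma conjvZ c z : conjv (c *: z) = conjc c *: conjv z.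
Proof. by apply/rowP => j; rewrite !mxE conjcM. Qed.
Lemma hformJJ z w : hform (conjv z) (conjv w) = conjc (hform z w).
Proof.
rewrite rmorph_sum; apply: eq_bigr => j _.
by rewrite [RHS]conjcM conjcM conjc_real !rowJ.
Qed.
(** [hform z (conjv w)] is complex bilinear: it is the polar form of [quad]. *)
Lemma hformJC z w : hform z (conjv w) = hform w (conjv z).
Proof. by rewrite -[in LHS](conjvK z) hformJJ hform_conj. Qed.
Lemma hform_quad z : hform z (conjv z) = quad z.
Proof. by apply: eq_bigr => j _; rewrite mxE conjcK; ring. Qed.

Lemma hform_real z : hform z z = (cform z z)%:C.
Proof.
apply: complexP => //=; have := congr1 Im (hform_conj z z); rewrite ImJ; lra.
Qed.
Lemma cformC z w : cform z w = cform w z.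
Proof. by rewrite /cform -hform_conj ReJ. Qed.

Lemma hform_delta z (j : 'I_n.+2) : hform z (delta_mx 0 j) = (eps j)%:C * z 0 j.
Proof.
rewrite /hform (bigD1 j) //= big1 ?addr0; last first.
  by move=> k kj; rewrite mxE eqxx (negPf kj) conjc0 mulr0.
by rewrite mxE !eqxx conjc1 mulr1.
Qed.

Lemma eps_neq0 (j : 'I_n.+2) : eps j != 0 :> R.
Proof. by rewrite /eps; case: ifP => _; rewrite ?oppr_eq0 oner_eq0. Qed.
Lemma hform_nondeg z : (forall w, hform z w = 0) -> z = 0.
Proof.
move=> h; apply/rowP => j; have /eqP := h (delta_mx 0 j).
rewrite hform_delta mulf_eq0 mxE => /orP[/eqP/(congr1 Re)/= /eqP|/eqP//].
by rewrite (negPf (eps_neq0 j)).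
Qed.

Lemma cformZi z w : cform (('i : R[i]) *: z) w = - Im (hform z w).
Proof. by rewrite /cform hformZl ReM /=; ring. Qed.
Lemma cformiZ z w : cform z (('i : R[i]) *: w) = Im (hform z w).
Proof. by rewrite /cform hformZr ReM /=; ring. Qed.

Lemma cform_nondeg z : (forall w, cform z w = 0) -> z = 0.
Proof.
move=> h; apply: hform_nondeg => w; apply: complexP; first exact: h.
by rewrite -cformiZ h.
Qed.

End HermitianForm.

Section RealVectors.
Context {R : realType} {n : nat}.
Local Notation W := 'rV[R]_n.+2.
Implicit Types (x y w a b : W) (c : R).
Local Notation Re := (@complex.Re R).
Local Notation Im := (@complex.Im R).

Lemma rformC x y : rform x y = rform y x.
Proof. by apply: eq_bigr => j _; ring. Qed.
Lemma rformDl x y w : rform (x + y) w = rform x w + rform y w.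
Proof. by rewrite -big_split; apply: eq_bigr => j _; rewrite /= mxE; ring. Qed.
Lemma rformZl c x w : rform (c *: x) w = c * rform x w.
Proof. by rewrite mulr_sumr; apply: eq_bigr => j _; rewrite /= mxE; ring. Qed.
Lemma rformNl x w : rform (- x) w = - rform x w.
Proof. by rewrite -scaleN1r rformZl mulN1r. Qed.
Lemma rformDr x y w : rform w (x + y) = rform w x + rform w y.
Proof. by rewrite rformC rformDl !(rformC w). Qed.
Lemma rformZr c x w : rform w (c *: x) = c * rform w x.
Proof. by rewrite rformC rformZl rformC. Qed.
Lemma rformNr x w : rform w (- x) = - rform w x.
Proof. by rewrite rformC rformNl rformC. Qed.
Lemma rform0l w : rform 0 w = 0 :> R.
Proof. by rewrite -(scale0r 0) rformZl mul0r. Qed.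
Definition rformE := (rformDl, rformDr, rformZl, rformZr, rformNl, rformNr).

Lemma hform_cplx x y a b :
  hform (cplx (x, y)) (cplx (a, b)) =
  (rform x a + rform y b) +i* (rform y a - rform x b).
Proof.
have E (F : 'I_n.+2 -> R[i]) : \sum_j F j =
    (\sum_j Re (F j)) +i* (\sum_j Im (F j)).
  elim/big_rec3: _ => [|j r1 r2 r3 _ ->] //; by case: (F j).
rewrite /hform E /rform -!sumrN -!big_split /=; congr (_ +i* _);
  apply: eq_bigr => j _; rewrite !mxE /= ; ring.
Qed.

Lemma conjv_cplx x y : conjv (cplx (x, y)) = cplx (x, - y).
Proof. by apply/rowP => j; rewrite !mxE. Qed.

(** A negative definite plane is maximal: otherwise some nonzero combination
    of three orthogonal vectors of nonpositive square would have both
    negative coordinates equal to zero, hence a nonnegative square. *)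
Lemma rform_pos a b w : rform a a = -1 -> rform b b = -1 -> rform a b = 0 ->
  rform w a = 0 -> rform w b = 0 -> w != 0 -> 0 < rform w w.
Proof.
move=> aa bb ab wa wb; apply: contra_neqT; rewrite -leNgt => ww.
pose j0 : 'I_n.+2 := ord0; pose j1 : 'I_n.+2 := lift ord0 ord0.
(* the minors of the 2 x 3 matrix of the negative coordinates *)
have key (r s t : R) : r * a 0 j0 + s * b 0 j0 + t * w 0 j0 = 0 ->
    r * a 0 j1 + s * b 0 j1 + t * w 0 j1 = 0 -> [/\ r = 0, s = 0 & t *: w = 0].
  move=> h0 h1; pose v := r *: a + s *: b + t *: w.
  have vv : rform v v = \sum_(j < n.+2) v 0 j ^+ 2.
    rewrite /rform; apply: eq_bigr => j _; rewrite /eps.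
    case: ifP => [j2|_]; last by rewrite mul1r expr2.
    suff -> : v 0 j = 0 by rewrite !mulr0 expr0n.
    have [->|->] : j = j0 \/ j = j1.
    - case: j j2 => [[|[|//]]] p _; [left|right]; exact: val_inj.
    - by rewrite /v !mxE.
    - by rewrite /v !mxE.
  have vE : rform v v = - r ^+ 2 - s ^+ 2 + t ^+ 2 * rform w w.
    rewrite /v !rformE aa bb ab (rformC b a) ab (rformC a w) (rformC b w) wa wb.
    ring.
  have v0 : 0 <= rform v v by rewrite vv sumr_ge0// => j _; exact: sqr_ge0.
  have tw : t ^+ 2 * rform w w <= 0 by rewrite mulr_ge0_le0// sqr_ge0.
  have rs : r ^+ 2 = 0 /\ s ^+ 2 = 0.
    have := sqr_ge0 r; have := sqr_ge0 s; split; lra.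
  have [/eqP] := rs; rewrite sqrf_eq0 => /eqP r0 /eqP; rewrite sqrf_eq0 => /eqP s0.
  split=> //; have vz : \sum_(j < n.+2) v 0 j ^+ 2 = 0.
    apply/eqP; rewrite -vv eq_le v0 andbT vE; case: rs => -> ->; lra.
  have -> : t *: w = v by rewrite /v r0 s0 !scale0r !add0r.
  apply/rowP => j; move/eqP: vz; rewrite psumr_eq0; last by move=> *; exact: sqr_ge0.
  move=> /allP/(_ j (mem_index_enum _)); rewrite /= sqrf_eq0 => /eqP ->.
  by rewrite mxE.
have [r0 s0 tw] := key (b 0 j0 * w 0 j1 - b 0 j1 * w 0 j0)
  (w 0 j0 * a 0 j1 - w 0 j1 * a 0 j0) (a 0 j0 * b 0 j1 - a 0 j1 * b 0 j0)
  ltac:(ring) ltac:(ring).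
have [t0|t0] := eqVneq (a 0 j0 * b 0 j1 - a 0 j1 * b 0 j0) 0; last first.
  by move/eqP: tw; rewrite scaler_eq0 (negPf t0) => /eqP.
have [b10 b00] : b 0 j1 = 0 /\ b 0 j0 = 0.
  by have [] := key (b 0 j1) (- a 0 j1) 0 ltac:(lra) ltac:(ring);
    have [] := key (b 0 j0) (- a 0 j0) 0 ltac:(ring) ltac:(lra).
by have [_ /eqP] := key 0 1 0 ltac:(rewrite b00; ring) ltac:(rewrite b10; ring);
  rewrite oner_eq0.
Qed.

End RealVectors.

(** * The Hopf fibration and the complex quadric *)

Section Hopf.
Context {R : realType} {n : nat}.
Local Notation V := 'rV[R[i]]_n.+2.
Local Notation MM := 'M[R[i]]_n.+2.
Implicit Types (z w u x : V) (c : R[i]) (L : {vspace V}) (X Y : MM).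
Local Notation Re := (@complex.Re R).
Local Notation Im := (@complex.Im R).

Lemma hform_Hsphere z : Hsphere z -> hform z z = -1.
Proof. by move=> zH; rewrite hform_real zH rmorphN rmorph1. Qed.

Lemma Hsphere_neq0 z : Hsphere z -> z != 0.
Proof.
move=> zH; apply/eqP => z0; have := hform_Hsphere zH; rewrite z0 hform0l => /eqP.
by rewrite eq_sym oppr_eq0 oner_eq0.
Qed.

Lemma cform_scale c z : cform (c *: z) (c *: z) = (Re c ^+ 2 + Im c ^+ 2) * cform z z.
Proof.
rewrite /cform hformZl hformZr hform_real; case: c => a b /=; ring.
Qed.

Lemma conjc_normE c : c * conjc c = (Re c ^+ 2 + Im c ^+ 2)%:C.
Proof. by apply: complexP; rewrite !ReImE /=; ring. Qed.

Lemma mulmx_col_hform x z : x *m (\col_i ((eps i)%:C * conjc (z 0 i))) = (hform x z)%:M.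
Proof.
apply/matrixP => i j; rewrite !ord1 !mxE eqxx mulr1n; apply: eq_bigr => k _.
by rewrite mxE mulrCA mulrA.
Qed.

Lemma mulmx_dhopf x z w : x *m dhopf z w = - hform x z *: (w + hform w z *: z).
Proof. by rewrite /dhopf mulmxN mulmxA mulmx_col_hform mul_scalar_mx scaleNr. Qed.

Lemma dhopf_lift z w : Hsphere z -> z *m dhopf z w = w + hform w z *: z.
Proof. by move=> zH; rewrite mulmx_dhopf hform_Hsphere// opprK scale1r. Qed.

Lemma dhopf_horizontal z w : hform w z = 0 -> Hsphere z -> z *m dhopf z w = w.
Proof. by move=> h zH; rewrite dhopf_lift// h scale0r addr0. Qed.

Lemma horizontal_hform z w : Hsphere z -> hform (w + hform w z *: z) z = 0.
Proof. by move=> zH; rewrite hformDl hformZl hform_Hsphere// mulrN1 subrr. Qed.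

(** Moving along the fibre changes the lift [w] by the phase and by a vertical
    vector; the phases cancel in the formula of [dhopf]. *)
Lemma dhopf_phase z w c d : Hsphere z -> c * conjc c = 1 ->
  dhopf (c *: z) (c *: w + d *: z) = dhopf z w.
Proof.
move=> zH cc; rewrite /dhopf; congr (- _).
have -> : \col_i ((eps i)%:C * conjc ((c *: z) 0 i)) =
    conjc c *: \col_i ((eps i)%:C * conjc (z 0 i)).
  by apply/colP => i; rewrite !mxE conjcM mulrCA.
rewrite hformDl !hformZl !hformZr hform_Hsphere//.
have -> : c *: w + d *: z + (c * (conjc c * hform w z) + d * (conjc c * -1)) *: (c *: z) =
    c *: (w + hform w z *: z).
  rewrite scalerDr !scalerA -addrA -scalerDl; congr (_ + _ *: _).
  transitivity (d + (c * conjc c) * (c * hform w z) - d * (c * conjc c)); first ring.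
  by rewrite cc; ring.
by rewrite -scalemxAl -scalemxAr scalerA [conjc c * c]mulrC cc scale1r.
Qed.

Lemma tangent_dhopf z w : Hsphere z -> tangentCH <[z]>%VS (dhopf z w).
Proof.
move=> zH; split=> [x y /vlineP[a ->] /vlineP[b ->]|v hv].
  by rewrite mulmx_dhopf hformZl [hform (_ + _) _]hformZr horizontal_hform// !mulr0.
by rewrite mulmx_dhopf hv ?memv_line// oppr0 scale0r.
Qed.

Lemma tangent_horizontal z X : tangentCH <[z]>%VS X -> hform (z *m X) z = 0.
Proof. by move=> [h _]; apply: h; exact: memv_line. Qed.

(** A tangent vector vanishes on the orthogonal of the line, hence is
    determined by its value at [z]. *)
Lemma tangent_inj z X Y : Hsphere z ->
  tangentCH <[z]>%VS X -> tangentCH <[z]>%VS Y -> z *m X = z *m Y -> X = Y.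
Proof.
move=> zH [_ hX] [_ hY] E; apply/row_matrixP => i; rewrite !rowE.
set v := delta_mx 0 i; pose v' := v + hform v z *: z.
have v'0 w : w \in <[z]>%VS -> hform v' w = 0.
  by move=> /vlineP[c ->]; rewrite hformZr horizontal_hform// mulr0.
have -> : v = v' - hform v z *: z by rewrite addrK.
by rewrite !mulmxBl hX// hY// -!scalemxAl E.
Qed.

Lemma tangentCHE z X : Hsphere z -> tangentCH <[z]>%VS X -> X = dhopf z (z *m X).
Proof.
move=> zH tX; apply: (tangent_inj zH tX (tangent_dhopf _ zH)).
by rewrite dhopf_lift// (tangent_horizontal tX) scale0r addr0.
Qed.

Lemma tangentCH0 L : tangentCH L 0.
Proof. by split=> *; rewrite mulmx0 ?hform0l. Qed.

Lemma tangentCHD L X Y : tangentCH L X -> tangentCH L Y -> tangentCH L (X + Y).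
Proof.
move=> [h1 h2] [k1 k2]; split=> [z w zL wL|v hv].
  by rewrite mulmxDr hformDl h1// k1// addr0.
by rewrite mulmxDr h2// k2// addr0.
Qed.

Lemma tangentCHZ L c X : tangentCH L X -> tangentCH L (c *: X).
Proof.
move=> [h1 h2]; split=> [z w zL wL|v hv]; rewrite -scalemxAr.
  by rewrite hformZl h1// mulr0.
by rewrite h2// scaler0.
Qed.

Lemma tangentCHB L X Y : tangentCH L X -> tangentCH L Y -> tangentCH L (X - Y).
Proof. by move=> h k; rewrite -scaleN1r; apply: tangentCHD h (tangentCHZ _ k). Qed.

Lemma vline_eq z w : z != 0 -> <[z]>%VS = <[w]>%VS -> exists2 c, c != 0 & w = c *: z.
Proof.
move=> z0 E; have : w \in <[z]>%VS by rewrite E memv_line.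
move=> /vlineP[c wE]; exists c => //; apply: contraNneq z0 => c0.
by move: (memv_line z); rewrite E wE c0 scale0r => /vlineP[d ->]; rewrite scaler0.
Qed.

Lemma vline_scale c z : c != 0 -> <[c *: z]>%VS = <[z]>%VS.
Proof.
move=> c0; apply/eqP; rewrite eqEsubv -!memvE; apply/andP; split.
  by rewrite memvZ// memv_line.
by rewrite -[z in z \in _](scalerK c0) memvZ// memv_line.
Qed.

Lemma Hsphere_phase z w : Hsphere z -> Hsphere w -> <[z]>%VS = <[w]>%VS ->
  exists2 c, c * conjc c = 1 & w = c *: z.
Proof.
move=> zH wH /(vline_eq (Hsphere_neq0 zH))[c c0 wE]; exists c => //.
have := hform_Hsphere wH; rewrite wE hformZl hformZr hform_Hsphere// mulrA mulrN1.
by move=> /oppr_inj.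
Qed.

Lemma negative_CH z : cform z z < 0 -> CH <[z]>%VS.
Proof.
move=> zz; split.
  rewrite dim_vline; case: eqVneq => // z0.
  by move: zz; rewrite z0 /cform hform0l ltxx.
move=> x /vlineP[c ->]; rewrite scaler_eq0 negb_or => /andP[c0 _].
rewrite cform_scale pmulr_rlt0// lt_def addr_ge0 ?sqr_ge0// andbT.
by rewrite -complex_eq0.
Qed.

Lemma Hsphere_CH z : Hsphere z -> CH <[z]>%VS.
Proof. by move=> zH; apply: negative_CH; rewrite zH ltrN10. Qed.

Lemma CH_negative z : CH <[z]>%VS -> cform z z < 0.
Proof.
move=> [d h]; apply: h; first exact: memv_line.
by move: d; rewrite dim_vline; case: eqP.
Qed.

Lemma CH_Hsphere L : CH L -> exists2 z, Hsphere z & <[z]>%VS = L.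
Proof.
move=> [d h].
have v0 : vpick L != 0 by rewrite vpick0 -dimv_eq0 d.
have LE : <[vpick L]>%VS = L.
  by apply/eqP; rewrite eqEdim d dim_vline v0 -memvE memv_pick.
have neg := h _ (memv_pick L) v0.
pose s := (Num.sqrt (- cform (vpick L) (vpick L)))^-1.
have s0 : s != 0 by rewrite invr_eq0 sqrtr_eq0 -ltNge oppr_gt0.
exists (s%:C *: vpick L).
  rewrite /Hsphere /= cform_scale /= expr0n addr0 /s exprVn sqr_sqrtr.
    by rewrite invrN mulNr mulVf// lt_eqF.
  by rewrite oppr_ge0 ltW.
by rewrite vline_scale ?LE//; apply: contra_neq s0 => /(congr1 Re) /= ->.
Qed.

Lemma fibreP L : CH L -> Hsphere (fibre L) /\ <[fibre L]>%VS = L.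
Proof.
move=> /CH_Hsphere[z zH zL]; have := @xgetPex _ 0 [set z | Hsphere z /\ <[z]>%VS = L].
by apply; exists z.
Qed.

Lemma gCHE z X Y : Hsphere z -> gCH <[z]>%VS X Y = cform (z *m X) (z *m Y).
Proof.
move=> zH; have [fH fE] := fibreP (Hsphere_CH zH).
have [c cc zE] := Hsphere_phase fH zH fE.
by rewrite [in RHS]zE /gCH /cform -!scalemxAl hformZl hformZr mulrA cc mul1r.
Qed.

Lemma gCHC L X Y : gCH L X Y = gCH L Y X.
Proof. by rewrite /gCH cformC. Qed.

(** The horizontal lift of [X] is orthogonal to the lifts of all tangent
    vectors and to [z], hence to the whole space. *)
Lemma gCH_nondeg z X : Hsphere z -> tangentCH <[z]>%VS X ->
  (forall Y, tangentCH <[z]>%VS Y -> gCH <[z]>%VS X Y = 0) -> X = 0.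
Proof.
move=> zH tX h; apply: (tangent_inj zH tX (tangentCH0 _)); rewrite mulmx0.
apply: cform_nondeg => w; have := h _ (tangent_dhopf w zH).
rewrite gCHE// dhopf_lift// /cform hformDr hformZr (tangent_horizontal tX).
by rewrite mulr0 addr0.
Qed.

Lemma Qstar_quad z : Hsphere z -> (Qstar <[z]>%VS <-> quad z = 0).
Proof.
move=> zH; split=> [[_]|q]; first by apply; exact: memv_line.
split=> [|x /vlineP[c ->]]; first exact: Hsphere_CH.
by rewrite -hform_quad conjvZ hformZl hformZr hform_quad q !mulr0.
Qed.

(** The two real conditions in the definition are the real and imaginary parts
    of a single complex one. *)
Lemma tangentQE z X : Hsphere z ->
  tangentQ <[z]>%VS X <-> tangentCH <[z]>%VS X /\ hform (z *m X) (conjv z) = 0.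
Proof.
move=> zH; split=> -[tX h]; split=> //.
  have [h1 h2] := h z (memv_line z); apply: complexP; first exact: h1.
  by rewrite -cformiZ h2.
move=> x /vlineP[c ->]; rewrite /cform conjvZ -scalemxAl !hformE h !mulr0.
by [].
Qed.

Lemma tangentQZ z c X : Hsphere z -> tangentQ <[z]>%VS X -> tangentQ <[z]>%VS (c *: X).
Proof.
move=> zH /(tangentQE _ zH)[tX h]; apply/(tangentQE _ zH); split.
  exact: tangentCHZ.
by rewrite -scalemxAr hformZl h mulr0.
Qed.

Lemma tangentQ_dhopf z w : Hsphere z -> hform w z = 0 -> hform w (conjv z) = 0 ->
  tangentQ <[z]>%VS (dhopf z w).
Proof.
move=> zH h k; apply/(tangentQE _ zH); split; first exact: tangent_dhopf.
by rewrite dhopf_horizontal.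
Qed.

(** Take away from the lift of [zeta] its component along [conjv z], the normal
    direction of the inverse image of the quadric. What remains is orthogonal
    to [z], to [conjv z] and to all tangent vectors, hence zero. *)
Lemma unit_normalE z zeta : Hsphere z -> quad z = 0 -> unit_normal <[z]>%VS zeta ->
  exists2 c, c * conjc c = 1 & z *m zeta = c *: conjv z.
Proof.
move=> zH qz [tz nz zz]; set u := z *m zeta.
have hz : hform (conjv z) z = 0.
  by rewrite -hform_conj hform_quad qz conjc0.
have hzz : hform (conjv z) (conjv z) = -1.
  by rewrite hformJJ hform_Hsphere// conjcN conjc1.
have uz : hform u z = 0 := tangent_horizontal tz.
pose u' := u + hform u (conjv z) *: conjv z.
have u'z : hform u' z = 0 by rewrite hformDl hformZl uz hz mulr0 addr0.
have u'c : hform u' (conjv z) = 0 by rewrite hformDl hformZl hzz mulrN1 subrr.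
have u'0 : u' = 0.
  apply: cform_nondeg => w.
  pose w1 := w + hform w z *: z + hform w (conjv z) *: conjv z.
  have w1z : hform w1 z = 0.
    by rewrite /w1 hformDl horizontal_hform// hformZl hz mulr0 addr0.
  have w1c : hform w1 (conjv z) = 0.
    by rewrite /w1 !hformDl !hformZl hzz hform_quad qz mulr0 addr0 mulrN1 subrr.
  have := nz _ (tangentQ_dhopf zH w1z w1c); rewrite gCHE// dhopf_horizontal//.
  rewrite -/u => uw1.
  have -> : cform u' w = cform u' w1.
    by rewrite /cform /w1 !hformDr !hformZr u'z u'c !mulr0 !addr0.
  rewrite /cform /u' hformDl hformZl -(hform_conj w1 (conjv z)) w1c conjc0 mulr0 addr0.
  exact: uw1.
pose c := - hform u (conjv z).
have uE : u = c *: conjv z.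
  by apply/eqP; rewrite scaleNr -addr_eq0; apply/eqP.
exists c => //.
move: zz; rewrite gCHE// -/u uE cform_scale /cform hzz /= => h; rewrite conjc_normE.
have e : forall a : R, a * -1 = -1 -> a = 1 by move=> a; lra.
by rewrite (e _ h).
Qed.

End Hopf.

(** * Maps on a manifold and their differentials *)

Section Charts.
Context {R : realType} {n : nat} {M : manifold R n}.
Implicit Types (phi psi : chart R n M) (U W : set M) (p q : M) (v : 'rV[R]_n).

Definition cimg phi U : set 'rV[R]_n := cmap phi @` (U `&` cdom phi).

Lemma cimg_mem phi U p : U p -> cdom phi p -> cimg phi U (cmap phi p).
Proof. by move=> Up pp; exists p. Qed.

Lemma open_cimg phi U : open U -> open (cimg phi U).
Proof.
move=> oU; rewrite openE => _ [p [Up pp] <-].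
have img : (cmap phi @` cdom phi) (cmap phi p) by exists p.
have N1 : nbhs (cmap phi p) (cmap phi @` cdom phi).
  exact: open_nbhs_nbhs (conj (@cimg_open _ _ _ phi) img).
have N2 : nbhs (cmap phi p) (cinv phi @^-1` U).
  apply: (cinv_cont img); rewrite cmapK//.
  exact: open_nbhs_nbhs (conj oU Up).
apply: filterS (filterI N1 N2) => x [[q qq <-]] /=.
by rewrite cmapK// => Uq; exists q.
Qed.

Lemma cimg_sub phi U W : U `<=` W -> cimg phi U `<=` cimg phi W.
Proof. by move=> UW x [p [/UW Wp pp] <-]; exists p. Qed.

Lemma cimg_near phi U p (P : M -> Prop) : open U -> U p -> cdom phi p ->
  (forall q, U q -> P q) -> \forall x \near cmap phi p, P (cinv phi x).
Proof.
move=> oU Up pp UP; apply: (open_near (open_cimg (phi := phi) oU) (cimg_mem Up pp)).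
by move=> _ [q [Uq qq] <-]; rewrite cmapK//; exact: UP.
Qed.

Lemma smooth_map_sub (W : normedModType R) U U' (F : M -> W) :
  U' `<=` U -> smooth_map U F -> smooth_map U' F.
Proof.
by move=> UU sF phi aphi; apply: smooth_sub (sF phi aphi); exact: cimg_sub.
Qed.

Lemma smooth_map_diff (W : normedModType R) U (F : M -> W) phi p :
  smooth_map U F -> atlas phi -> U p -> cdom phi p ->
  differentiable (F \o cinv phi) (cmap phi p).
Proof.
by move=> sF aphi Up pp; apply: (smooth_diff (sF phi aphi)); exact: cimg_mem.
Qed.

Lemma dmap_eq (W : normedModType R) U (F G : M -> W) phi p v :
  open U -> U p -> cdom phi p -> (forall q, U q -> F q = G q) ->
  dmap phi F p v = dmap phi G p v.
Proof.
move=> oU Up pp FG; apply: near_eq_derive.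
exact: (cimg_near (P := fun q => F q = G q) oU Up pp FG).
Qed.

Lemma dmap_linear (W : normedModType R) (F : M -> W) phi p (a : R) v w :
  differentiable (F \o cinv phi) (cmap phi p) ->
  dmap phi F p (a *: v + w) = a *: dmap phi F p v + dmap phi F p w.
Proof. by move=> dF; rewrite /dmap !deriveE// linearP. Qed.

Lemma transition_diff phi psi p : atlas phi -> atlas psi -> cdom phi p -> cdom psi p ->
  differentiable (cmap psi \o cinv phi) (cmap phi p).
Proof.
move=> aphi apsi pp qp.
by apply: (smooth_diff (atlas_smooth aphi apsi)); exists p.
Qed.

Lemma dmap_change (W : normedModType R) (F : M -> W) phi psi p v :
  atlas phi -> atlas psi -> cdom phi p -> cdom psi p ->
  differentiable (F \o cinv psi) (cmap psi p) ->
  dmap phi F p v = dmap psi F p (dmap phi (cmap psi) p v).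
Proof.
move=> aphi apsi pp qp dF.
have dT := transition_diff aphi apsi pp qp.
have dF' : differentiable (F \o cinv psi) ((cmap psi \o cinv phi) (cmap phi p)).
  by rewrite /= cmapK.
have -> : dmap phi F p v =
    'D_v ((F \o cinv psi) \o (cmap psi \o cinv phi)) (cmap phi p).
  apply: near_eq_derive.
  apply: (cimg_near (P := fun q => F q = F (cinv psi (cmap psi q)))
           (cdom_open psi) qp pp) => q qq.
  by rewrite cmapK.
rewrite deriveE; last exact: differentiable_comp.
have -> := diff_comp dT dF'.
by rewrite /= cmapK// /dmap !deriveE.
Qed.

Lemma dmap_cmap phi p v : cdom phi p -> dmap phi (cmap phi) p v = v.
Proof.
move=> pp; rewrite /dmap -[RHS](derive_id (cmap phi p) v).
apply: near_eq_derive.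
apply: (open_near (open_cimg (phi := phi) openT) (cimg_mem _ pp)) => // _ [q [_ qq] <-].
by rewrite /= cmapK.
Qed.

Lemma dmap_transition_inj phi psi p v :
  atlas phi -> atlas psi -> cdom phi p -> cdom psi p ->
  dmap phi (cmap psi) p v = 0 -> v = 0.
Proof.
move=> aphi apsi pp qp v0.
have := dmap_change (F := cmap phi) v aphi apsi pp qp (transition_diff apsi aphi qp pp).
rewrite dmap_cmap// v0 => ->.
by rewrite /dmap derive0.
Qed.

(** The transition maps are smooth, so that one chart is enough. *)
Lemma smooth_map_chart (W : normedModType R) (cW : coordinates W) phi U (F : M -> W) :
  atlas phi -> open U -> U `<=` cdom phi ->
  smooth_on (cimg phi U) (F \o cinv phi) -> smooth_map U F.
Proof.
move=> aphi oU Uphi sF psi apsi k.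
have oD := open_cimg (phi := psi) oU.
have oD' := open_cimg (phi := phi) oU.
apply: (Ck_coords (cW := cW) oD) => i.
have sFi : Ck k (cimg phi U) (coor i \o (F \o cinv phi)).
  exact: (Ck_lin oD' (@coor_cont _ _ cW i) (sF k)).
have sT : Ck k (cimg psi U) (cmap phi \o cinv psi).
  apply: Ck_sub (atlas_smooth apsi aphi k) => _ [p [Up qp] <-].
  by exists p => //; split => //; exact: Uphi.
have DT x : cimg psi U x -> cimg phi U ((cmap phi \o cinv psi) x).
  by move=> [p [Up qp] <-] /=; rewrite cmapK//; apply: cimg_mem => //; exact: Uphi.
have H := Ck_comp (row_coordinates n) oD DT sT sFi.
apply: Ck_eq oD _ H => _ [p [Up qp] <-] /=.
by rewrite (cmapK qp) cmapK//; exact: Uphi.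
Qed.

End Charts.

Section ComplexMaps.
Context {R : realType} {n : nat} {M : manifold R n}.
Local Notation V := 'rV[R[i]]_n.+2.
Implicit Types (phi psi : chart R n M) (U W : set M) (p q : M) (v : 'rV[R]_n).
Implicit Types (F G : M -> V) (c : M -> R[i]).

Definition csmooth_map U c : Prop :=
  forall phi, atlas phi -> csmooth (cimg phi U) (c \o cinv phi).

Definition dc phi c p v : R[i] := cder v (c \o cinv phi) (cmap phi p).

Lemma dcmapE phi F p v : dcmap phi F p v = vder v (F \o cinv phi) (cmap phi p).
Proof. by rewrite vder.unlock. Qed.

Lemma dcmap_eq U F G phi p v : open U -> U p -> cdom phi p ->
  (forall q, U q -> F q = G q) -> dcmap phi F p v = dcmap phi G p v.
Proof.
move=> oU Up pp FG; congr cplx; apply: (dmap_eq _ oU) => // q Uq.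
by rewrite /= FG.
Qed.

Lemma dcmap_linear F phi p (a : R) v w :
  differentiable ((@realify R n \o F) \o cinv phi) (cmap phi p) ->
  dcmap phi F p (a *: v + w) = a%:C *: dcmap phi F p v + dcmap phi F p w.
Proof. by move=> dF; rewrite /dcmap dmap_linear// cplxD cplxZ. Qed.

Section Open.
Variables (U : set M) (oU : open U).

Lemma csmooth_map_hform F G : smooth_cmap U F -> smooth_cmap U G ->
  csmooth_map U (fun q => hform (F q) (G q)).
Proof.
move=> sF sG phi aphi.
exact: (csmooth_hform (open_cimg (phi := phi) oU) (sF phi aphi) (sG phi aphi)).
Qed.

Lemma csmooth_mapM c d : csmooth_map U c -> csmooth_map U d ->
  csmooth_map U (fun q => c q * d q).
Proof.
move=> sc sd phi aphi.
exact: (csmoothM (open_cimg (phi := phi) oU) (sc phi aphi) (sd phi aphi)).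
Qed.

Lemma csmooth_mapN c : csmooth_map U c -> csmooth_map U (fun q => - c q).
Proof.
move=> sc phi aphi; exact: (csmoothN (open_cimg (phi := phi) oU) (sc phi aphi)).
Qed.

Lemma smooth_cmapZ c F : csmooth_map U c -> smooth_cmap U F ->
  smooth_cmap U (fun q => c q *: F q).
Proof.
move=> sc sF phi aphi.
exact: (vsmoothZ (open_cimg (phi := phi) oU) (sc phi aphi) (sF phi aphi)).
Qed.

Lemma smooth_cmapJ F : smooth_cmap U F -> smooth_cmap U (fun q => conjv (F q)).
Proof.
move=> sF phi aphi; exact: (vsmoothJ (open_cimg (phi := phi) oU) (sF phi aphi)).
Qed.

Variables (phi : chart R n M) (p : M) (aphi : atlas phi) (Up : U p) (pp : cdom phi p).
Variable v : 'rV[R]_n.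

Let oD := open_cimg (phi := phi) oU.
Let Dp := cimg_mem Up pp.

Lemma dcmapZ c F : csmooth_map U c -> smooth_cmap U F ->
  dcmap phi (fun q => c q *: F q) p v = dc phi c p v *: F p + c p *: dcmap phi F p v.
Proof.
move=> sc sF; rewrite !dcmapE.
have := vderZ oD Dp v (sc phi aphi) (sF phi aphi).
by rewrite /= cmapK.
Qed.

Lemma dcmapJ F : smooth_cmap U F ->
  dcmap phi (fun q => conjv (F q)) p v = conjv (dcmap phi F p v).
Proof. by move=> sF; rewrite !dcmapE; exact: (vderJ oD Dp v (sF phi aphi)). Qed.

Lemma dc_hform F G : smooth_cmap U F -> smooth_cmap U G ->
  dc phi (fun q => hform (F q) (G q)) p v =
  hform (dcmap phi F p v) (G p) + hform (F p) (dcmap phi G p v).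
Proof.
move=> sF sG; rewrite !dcmapE.
have := cder_hform oD Dp v (sF phi aphi) (sG phi aphi).
by rewrite /= cmapK.
Qed.

Lemma dc_eq c d : (forall q, U q -> c q = d q) -> dc phi c p v = dc phi d p v.
Proof.
move=> cd; apply: (cder_eq _ oD Dp) => _ [q [Uq qq] <-].
by rewrite /= cmapK// cd.
Qed.

Lemma dc_cst (a : R[i]) : dc phi (fun=> a) p v = 0.
Proof. exact: cder_cst. Qed.

End Open.

Lemma smooth_cmap_sub U U' F : U' `<=` U -> smooth_cmap U F -> smooth_cmap U' F.
Proof. exact: smooth_map_sub. Qed.

(** Two local lifts differ by a smooth phase, and the Hopf fibration kills the
    vertical part that its derivative contributes. *)
Lemma dhopf_lift_unique f p F F' phi v : atlas phi -> cdom phi p ->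
  local_lift f p F -> local_lift f p F' ->
  dhopf (F p) (dcmap phi F p v) = dhopf (F' p) (dcmap phi F' p v).
Proof.
move=> aphi pp [U [oU Up sF HF]] [U' [oU' Up' sF' HF']].
pose W := U `&` U'; have oW : open W by exact: openI.
have Wp : W p by [].
have sFW : smooth_cmap W F by apply: smooth_cmap_sub sF => q [].
have sFW' : smooth_cmap W F' by apply: smooth_cmap_sub sF' => q [].
pose c q := - hform (F' q) (F q).
have sc : csmooth_map W c by apply: csmooth_mapN => //; exact: csmooth_map_hform.
have cE q : W q -> F' q = c q *: F q /\ c q * conjc (c q) = 1.
  move=> [Uq Uq']; have [FH FE] := HF q Uq; have [FH' FE'] := HF' q Uq'.
  have [d dd dE] := Hsphere_phase FH FH' (etrans FE (esym FE')).
  have -> : c q = d by rewrite /c dE hformZl hform_Hsphere// mulrN1 opprK.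
  by [].
have [FpE cc] := cE p Wp.
have -> : dcmap phi F' p v = c p *: dcmap phi F p v + dc phi c p v *: F p.
  rewrite (dcmap_eq v oW Wp pp (fun q Wq => (cE q Wq).1)).
  by rewrite (dcmapZ oW aphi Wp pp)// addrC.
by rewrite FpE dhopf_phase//; exact: (HF p Up).1.
Qed.

Lemma dCHE f p F phi v : atlas phi -> cdom phi p -> local_lift f p F ->
  dCH phi f p v = dhopf (F p) (dcmap phi F p v).
Proof.
move=> aphi pp lF; have lF' : local_lift f p (xget (fun=> 0) [set F | local_lift f p F]).
  by apply: (@xgetPex _ (fun=> 0) [set F | local_lift f p F]); exists F.
exact: (dhopf_lift_unique _ aphi pp lF' lF).
Qed.

End ComplexMaps.

(** * Horizontal maps into the inverse image of the quadric *)

Section SecondDerivatives.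
Context {R : realType} {n : nat} {X : normedModType R}.
Local Notation V := 'rV[R[i]]_n.+2.
Local Notation Im := (@complex.Im R).

Lemma coor_inj (W : normedModType R) (cW : coordinates W) (x y : W) :
  (forall i, coor (c := cW) i x = coor i y) -> x = y.
Proof.
by move=> xy; rewrite (coorK cW x) (coorK cW y); apply: eq_bigr => i _; rewrite xy.
Qed.

Lemma derive_comm_coords (W : normedModType R) (cW : coordinates W) (D : set X)
    (F : X -> W) x v w : open D -> D x -> smooth_on D F ->
  'D_v ('D_w F) x = 'D_w ('D_v F) x.
Proof.
move=> oD Dx sF; apply: (coor_inj (cW := cW)) => i.
have E u u' : coor (c := cW) i ('D_u ('D_u' F) x) = 'D_u (fun y => 'D_u' (coor i \o F) y) x.
  rewrite -(derive_lin_comp u (@coor_cont _ _ cW i) (smooth_diff (smooth_derive u' sF) Dx)).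
  apply: near_eq_derive; apply: (open_near oD Dx) => y Dy.
  by rewrite (derive_lin_comp u' (@coor_cont _ _ cW i) (smooth_diff sF Dy)).
rewrite !E; apply: (@derive_comm R X D (coor i \o F) x w v oD Dx).
exact: (Ck_lin oD (@coor_cont _ _ cW i) (sF 2%N)).
Qed.

Lemma vsmooth_vder (D : set X) (F : X -> V) w : vsmooth D F -> vsmooth D (vder w F).
Proof.
move=> sF; have -> : vder w F = fun x => cplx ('D_w (fun y => realify (F y)) x).
  by apply/funext => x; rewrite vder.unlock.
rewrite /vsmooth; have -> : (fun x => realify (cplx ('D_w (fun y => realify (F y)) x))) =
    'D_w (fun y => realify (F y)) by apply/funext => x; rewrite cplxK.
exact: smooth_derive.
Qed.

Lemma vder_comm (D : set X) (F : X -> V) x v w : open D -> D x -> vsmooth D F ->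
  vder v (vder w F) x = vder w (vder v F) x.
Proof.
move=> oD Dx sF; have E u : (fun y => realify (vder u F y)) = 'D_u (fun y => realify (F y)).
  by apply/funext => y; rewrite vder.unlock cplxK.
have E2 u u' : vder u (vder u' F) x = cplx ('D_u ('D_u' (fun y => realify (F y))) x).
  by rewrite -E {1}vder.unlock.
have C := @derive_comm_coords _ VR_coordinates D (fun y => realify (F y)) x v w oD Dx sF.
exact: etrans (E2 v w) (etrans (congr1 (@cplx R n) C) (esym (E2 w v))).
Qed.

(** Differentiate the horizontality equation in two directions and subtract the
    results: the second derivatives cancel. *)
Lemma horizontal_isotropic (D : set X) (F : X -> V) x v w : open D -> D x ->
  vsmooth D F -> (forall y u, D y -> hform (vder u F y) (F y) = 0) ->
  Im (hform (vder v F x) (vder w F x)) = 0.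
Proof.
move=> oD Dx sF hF.
have E u u' : hform (vder u (vder u' F) x) (F x) + hform (vder u' F x) (vder u F x) = 0.
  rewrite -(cder_hform oD Dx _ (vsmooth_vder u' sF) sF).
  transitivity (cder u (fun=> 0) x : R[i]); last exact: cder_cst.
  by apply: (cder_eq _ oD Dx) => y Dy; exact: hF.
have e1 := E v w; have e2 := E w v; rewrite (vder_comm _ _ oD Dx sF) in e1.
have : hform (vder w F x) (vder v F x) = hform (vder v F x) (vder w F x).
  by apply: (addrI (hform (vder w (vder v F) x) (F x))); rewrite e1 e2.
rewrite -(hform_conj (vder v F x)) => /(congr1 Im); rewrite ImJ; lra.
Qed.

End SecondDerivatives.

Section HorizontalLifts.
Context {R : realType} {n : nat} {M : manifold R n}.
Local Notation V := 'rV[R[i]]_n.+2.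
Local Notation W := 'rV[R]_n.+2.
Implicit Types (phi psi : chart R n M) (U : set M) (p q : M) (v : 'rV[R]_n).
Implicit Types (G : M -> V) (a b : M -> W).
Local Notation Re := (@complex.Re R).
Local Notation Im := (@complex.Im R).

(** Every map to the quadric has local lifts to the inverse image of the
    quadric; they are defined up to phases, and horizontality is a condition on
    the choice of phases. *)
Definition horizontal_lift U G : Prop :=
  [/\ open U, smooth_cmap U G,
      forall q, U q -> Hsphere (G q) /\ quad (G q) = 0 &
      forall phi q v, atlas phi -> U q -> cdom phi q ->
        hform (dcmap phi G q v) (G q) = 0].

Lemma horizontal_lift_sub U U' G : open U' -> U' `<=` U ->
  horizontal_lift U G -> horizontal_lift U' G.
Proof.
move=> oU' UU [oU sG HG hG]; split=> //; first exact: smooth_cmap_sub sG.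
- by move=> q /UU/HG.
- by move=> phi q v aphi /UU Uq qq; exact: hG.
Qed.

Lemma dcmapZc U G c phi p v : open U -> smooth_cmap U G -> atlas phi -> U p ->
  cdom phi p -> dcmap phi (fun q => c *: G q) p v = c *: dcmap phi G p v.
Proof.
move=> oU sG aphi Up pp.
have sc : csmooth_map U (fun=> c) by move=> psi _; exact: csmooth_cst.
by rewrite (dcmapZ oU aphi Up pp _ sc sG) dc_cst scale0r add0r.
Qed.

Lemma horizontal_lift_phase U G c : c * conjc c = 1 -> horizontal_lift U G ->
  horizontal_lift U (fun q => c *: G q).
Proof.
move=> cc [oU sG HG hG]; split=> //.
- by apply: smooth_cmapZ => // psi _; exact: csmooth_cst.
- move=> q Uq; have [H1 H2] := HG q Uq; split.
    by rewrite /Hsphere /= /cform hformZl hformZr mulrA cc mul1r; exact: H1.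
  by rewrite -hform_quad conjvZ hformZl hformZr hform_quad H2 !mulr0.
move=> phi q v aphi Uq qq.
by rewrite (dcmapZc _ _ oU sG)// hformZl hformZr hG// !mulr0.
Qed.

Section Pointwise.
Variables (U : set M) (G : M -> V) (hl : horizontal_lift U G).
Variables (phi : chart R n M) (p : M) (aphi : atlas phi) (Up : U p) (pp : cdom phi p).

Let oU : open U. Proof. by case: hl. Qed.
Let sG : smooth_cmap U G. Proof. by case: hl. Qed.

Lemma hlift_local f : (forall q, U q -> <[G q]>%VS = f q) -> local_lift f p G.
Proof.
move=> Gf; exists U; split=> // q Uq; split; last exact: Gf.
by case: hl => _ _ /(_ q Uq)[].
Qed.

Lemma hlift_horizontal v : hform (dcmap phi G p v) (G p) = 0.
Proof. by case: hl => _ _ _; apply. Qed.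

Lemma hlift_conj v : hform (dcmap phi G p v) (conjv (G p)) = 0.
Proof.
have E := dc_hform oU aphi Up pp v sG (smooth_cmapJ oU sG).
have : dc phi (fun q => hform (G q) (conjv (G q))) p v = 0.
  rewrite (dc_eq oU Up pp _ (d := fun=> 0)) ?dc_cst//.
  by move=> q Uq; rewrite hform_quad; case: hl => _ _ /(_ q Uq)[].
rewrite E (dcmapJ oU aphi Up pp _ sG) (hformJC (G p)) -mulr2n => /eqP.
by rewrite mulrn_eq0 => /eqP.
Qed.

Lemma hlift_isotropic v w : Im (hform (dcmap phi G p v) (dcmap phi G p w)) = 0.
Proof.
rewrite !dcmapE.
apply: (horizontal_isotropic v w (open_cimg (phi := phi) oU) (cimg_mem Up pp) (sG aphi)).
move=> _ u [q [Uq qq] <-]; rewrite -dcmapE /= cmapK//.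
by case: hl => _ _ _; apply.
Qed.

Lemma hlift_dhopf v : G p *m dhopf (G p) (dcmap phi G p v) = dcmap phi G p v.
Proof.
apply: dhopf_horizontal; first exact: hlift_horizontal.
by case: hl => _ _ /(_ p Up)[].
Qed.

Lemma hlift_diff : differentiable ((@realify R n \o G) \o cinv phi) (cmap phi p).
Proof. exact: (smooth_map_diff sG). Qed.

Lemma hlift_linear (s : R) v w :
  dcmap phi G p (s *: v + w) = s%:C *: dcmap phi G p v + dcmap phi G p w.
Proof. by apply: dcmap_linear; exact: hlift_diff. Qed.

End Pointwise.

(** The two Hermitian products have as real and imaginary parts the sums and
    differences of the four real products. *)
Lemma orthogonal_parts (w z : V) : hform w z = 0 -> hform w (conjv z) = 0 ->
  [/\ rform (realify w).1 (realify z).1 = 0, rform (realify w).1 (realify z).2 = 0,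
      rform (realify w).2 (realify z).1 = 0 & rform (realify w).2 (realify z).2 = 0].
Proof.
rewrite -{1 2}(realifyK w) -{1 2}(realifyK z).
case: (realify w) (realify z) => [x y] [g h] /=.
rewrite conjv_cplx !hform_cplx !rformNr => /eqP; rewrite eq_complex /=.
move=> /andP[/eqP h1 /eqP h2] /eqP; rewrite eq_complex /= => /andP[/eqP h3 /eqP h4].
split; lra.
Qed.

Lemma Hsphere_parts (z : V) : Hsphere z -> quad z = 0 ->
  [/\ rform (realify z).1 (realify z).1 = - 2^-1,
      rform (realify z).2 (realify z).2 = - 2^-1 & rform (realify z).1 (realify z).2 = 0].
Proof.
move=> /hform_Hsphere + qz; rewrite -hform_quad in qz; move: qz.
rewrite -{1 2}(realifyK z) -{3 4}(realifyK z).
case: (realify z) => [x y] /=.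
rewrite conjv_cplx !hform_cplx !rformNr => /eqP; rewrite eq_complex /=.
move=> /andP[/eqP h1 /eqP h2] /(congr1 Re) /=; rewrite (rformC y x) in h2 * => h3.
have l2 : 2 * (2^-1 : R) = 1 by rewrite mulfV.
split; lra.
Qed.

(** The real and imaginary parts of [z] span a negative definite plane, to
    which the real part of [w] is orthogonal. *)
Lemma rform_pos_parts (w z : V) : Hsphere z -> quad z = 0 ->
  hform w z = 0 -> hform w (conjv z) = 0 ->
  (realify w).1 != 0 -> 0 < rform (realify w).1 (realify w).1.
Proof.
move=> zH qz wz wzc w0; have [h1 h2 h3] := Hsphere_parts zH qz.
have [k1 k2 _ _] := orthogonal_parts wz wzc.
have s2 : Num.sqrt 2 * Num.sqrt 2 = 2 :> R by rewrite -expr2 sqr_sqrtr.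
have l2 : 2 * (2^-1 : R) = 1 by rewrite mulfV.
apply: (@rform_pos _ _ (Num.sqrt 2 *: (realify z).1) (Num.sqrt 2 *: (realify z).2)) => //;
  rewrite ?rformZl ?rformZr ?h1 ?h2 ?h3 ?k1 ?k2 ?mulr0// mulrA s2; lra.
Qed.

Lemma dmap_fst U (F : M -> W * W) phi p v : smooth_map U F -> atlas phi -> U p ->
  cdom phi p -> dmap phi (fun q => (F q).1) p v = (dmap phi F p v).1.
Proof.
move=> sF aphi Up pp; have dF := smooth_map_diff sF aphi Up pp.
have cL : continuous (fst : {linear (W * W)%type -> W}) by move=> x; exact: cvg_fst.
exact: (@derive_lin_comp R 'rV[R]_n _ _ _ _ _ v cL dF).
Qed.

Lemma dmap_snd U (F : M -> W * W) phi p v : smooth_map U F -> atlas phi -> U p ->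
  cdom phi p -> dmap phi (fun q => (F q).2) p v = (dmap phi F p v).2.
Proof.
move=> sF aphi Up pp; have dF := smooth_map_diff sF aphi Up pp.
have cL : continuous (snd : {linear (W * W)%type -> W}) by move=> x; exact: cvg_snd.
exact: (@derive_lin_comp R 'rV[R]_n _ _ _ _ _ v cL dF).
Qed.

End HorizontalLifts.

(** * Hypersurfaces and horizontal lifts *)

Section Hypersurfaces.
Context {R : realType} {n : nat} {M : manifold R n}.
Local Notation V := 'rV[R[i]]_n.+2.
Local Notation W := 'rV[R]_n.+2.
Implicit Types (phi psi : chart R n M) (U : set M) (p q : M) (v : 'rV[R]_n).
Implicit Types (G : M -> V) (a b : M -> W).
Local Notation Re := (@complex.Re R).
Local Notation s2 := (Num.sqrt (2 : R)).

Lemma s2M : s2 * s2 = 2. Proof. by rewrite -expr2 sqr_sqrtr. Qed.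
Lemma s2_neq0 : s2 != 0. Proof. by rewrite sqrtr_eq0 -ltNge. Qed.
Lemma s2VM : s2^-1 * s2^-1 = 2^-1. Proof. by rewrite -invfM s2M. Qed.
Lemma s2VC_neq0 : (s2^-1)%:C != 0 :> R[i].
Proof. by apply: contra_neq (s2_neq0) => /(congr1 Re)/= /eqP; rewrite invr_eq0 => /eqP. Qed.

Lemma realify_gauss a b q : realify (gauss_lift a b q) = s2^-1 *: (a q, b q).
Proof. by rewrite /gauss_lift realifyZ cplxK. Qed.

Lemma gauss_lift_line a b q : <[gauss_lift a b q]>%VS = gauss_map a b q.
Proof. by rewrite vline_scale// s2VC_neq0. Qed.

Lemma smooth_gauss_lift U a b : open U -> smooth_map U a -> smooth_map U b ->
  smooth_cmap U (gauss_lift a b).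
Proof.
move=> oU sa sb phi aphi; have oD := open_cimg (phi := phi) oU.
apply/(vsmoothP (fun x => gauss_lift a b (cinv phi x)) oD) => j.
have sab : csmooth (cimg phi U) (fun x => a (cinv phi x) 0 j +i* b (cinv phi x) 0 j).
  split=> k /=.
    exact: (Ck_lin oD (@coor_cont _ _ (row_coordinates n.+2) j) (sa phi aphi k)).
  exact: (Ck_lin oD (@coor_cont _ _ (row_coordinates n.+2) j) (sb phi aphi k)).
apply: csmooth_eq oD _ (csmoothM oD (csmooth_cst _ (s2^-1)%:C) sab) => x _.
by rewrite !mxE.
Qed.

Lemma dmapZ U (s : R) a phi p v : open U -> smooth_map U a -> atlas phi -> U p ->
  cdom phi p -> dmap phi (fun q => s *: a q) p v = s *: dmap phi a p v.
Proof.
move=> oU sa aphi Up pp; apply: deriveZ.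
by apply: diff_derivable; exact: (smooth_map_diff sa).
Qed.

Lemma dcmap_gauss_lift U a b phi p v : open U -> smooth_map U a -> smooth_map U b ->
  atlas phi -> U p -> cdom phi p ->
  dcmap phi (gauss_lift a b) p v = (s2^-1)%:C *: cplx (dmap phi a p v, dmap phi b p v).
Proof.
move=> oU sa sb aphi Up pp; have sG := smooth_gauss_lift oU sa sb.
rewrite /dcmap [dmap _ _ _ _]surjective_pairing -(dmap_fst _ sG)// -(dmap_snd _ sG)//.
have -> : (fun q => ((@realify R n \o gauss_lift a b) q).1) = (fun q => s2^-1 *: a q).
  by apply/funext => q; rewrite /= -[map_mx _ _]/((realify _).1) realify_gauss.
have -> : (fun q => ((@realify R n \o gauss_lift a b) q).2) = (fun q => s2^-1 *: b q).
  by apply/funext => q; rewrite /= -[map_mx _ _]/((realify _).2) realify_gauss.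
by rewrite !(dmapZ _ _ oU)// -cplxZ.
Qed.

(** The Hermitian product of the differential of [a + i b] with [a + i b] is
    a combination of real products. Those of [a] with [da] and of [b] with
    [db] vanish because [a] and [b] have constant square, that of [b] with
    [da] by the definition of the normal, and that of [a] with [db] by
    differentiating [rform b a = 0]. *)
Lemma hypersurface_lift U a b : open U -> spacelike_hypersurface U a b ->
  horizontal_lift U (gauss_lift a b).
Proof.
move=> oU [[sa aa a0] [sb bb b0]].
have sG := smooth_gauss_lift oU sa sb.
have HH q : U q -> Hsphere (gauss_lift a b q) /\ quad (gauss_lift a b q) = 0.
  move=> Uq; have [bq baq] := bb q Uq; have aq := aa q Uq.
  split.
    rewrite /Hsphere /= cform_scale /cform hform_cplx /= aq bq expr0n addr0 expr2 s2VM.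
    by rewrite -opprD mulrN mulVf.
  rewrite -hform_quad conjvZ hformZl hformZr conjv_cplx hform_cplx.
  rewrite !rformNr aq bq baq (rformC (a q)) baq opprK oppr0 subrr addNr.
  by rewrite -[_ +i* _]/(0 : R[i]) !mulr0.
split=> // phi p v aphi Up pp.
have E1 := dc_hform oU aphi Up pp v sG sG.
have E2 := dc_hform oU aphi Up pp v sG (smooth_cmapJ oU sG).
rewrite (dc_eq oU Up pp _ (d := fun=> -1)) ?dc_cst// in E1; last first.
  by move=> q /HH[/hform_Hsphere].
rewrite (dc_eq oU Up pp _ (d := fun=> 0)) ?dc_cst// in E2; last first.
  by move=> q Uq; rewrite hform_quad; have [] := HH q Uq.
move: E1 E2; rewrite (dcmapJ oU aphi Up pp _ sG) (hformJC (gauss_lift a b p)).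
rewrite (dcmap_gauss_lift _ oU)// -[gauss_lift a b p]/((s2^-1)%:C *: cplx (a p, b p)).
rewrite conjvZ conjv_cplx !hformZl !hformZr !hform_cplx.
move: (b0 phi p v aphi Up pp); rewrite rformC.
move: (dmap phi a p v) (dmap phi b p v) => x y h0.
rewrite !rformNr !(rformC (a p)) !(rformC (b p)) h0.
have k0 : (s2^-1)%:C * (s2^-1)%:C != 0 :> R[i] by rewrite mulf_neq0 ?s2VC_neq0.
rewrite conjcK !conjc_real !mulrA -!mulrDr => /esym/eqP; rewrite mulf_eq0 (negPf k0) /= => E1.
move=> /esym/eqP; rewrite mulf_eq0 (negPf k0) /= => E2.
move: E1 E2; rewrite !eq_complex /= => /andP[/eqP e1 /eqP e2] /andP[/eqP e3 /eqP e4].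
rewrite (_ : _ +i* _ = 0) ?mulr0//; apply/eqP; rewrite eq_complex /=.
by apply/andP; split; apply/eqP; lra.
Qed.

(** The map [gauss_lift] read backwards. *)
Definition lift_base G q : W := s2 *: (realify (G q)).1.
Definition lift_normal G q : W := s2 *: (realify (G q)).2.

Lemma gauss_liftE G : gauss_lift (lift_base G) (lift_normal G) = G.
Proof.
apply/funext => q; apply: (can_inj (@realifyK R n)); rewrite realify_gauss.
rewrite /lift_base /lift_normal; case: (realify (G q)) => x y /=.
by congr pair; rewrite scalerA mulVf ?scale1r// s2_neq0.
Qed.

Lemma gauss_map_lift G q : gauss_map (lift_base G) (lift_normal G) q = <[G q]>%VS.
Proof. by rewrite -gauss_lift_line gauss_liftE. Qed.

Lemma smooth_lift_parts U G : open U -> smooth_cmap U G ->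
  smooth_map U (lift_base G) /\ smooth_map U (lift_normal G).
Proof.
move=> oU sG; split=> phi aphi k; have oD := open_cimg (phi := phi) oU;
  apply: (Ck_coords (cW := row_coordinates n.+2) oD) => j.
  have H := CkM oD (Ck_cst k (cimg phi U) s2)
    (Ck_lin oD (@coor_cont _ _ (@VR_coordinates R n) (inl j)) (sG phi aphi k)).
  by apply: Ck_eq oD _ H => x _; rewrite /= /row_coor /lift_base !mxE.
have H := CkM oD (Ck_cst k (cimg phi U) s2)
  (Ck_lin oD (@coor_cont _ _ (@VR_coordinates R n) (inr j)) (sG phi aphi k)).
by apply: Ck_eq oD _ H => x _; rewrite /= /row_coor /lift_normal !mxE.
Qed.

Lemma dmap_lift_base U G phi p v : open U -> smooth_cmap U G -> atlas phi -> U p ->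
  cdom phi p -> dmap phi (lift_base G) p v = s2 *: (realify (dcmap phi G p v)).1.
Proof.
move=> oU sG aphi Up pp; have [sa sb] := smooth_lift_parts oU sG.
have := dcmap_gauss_lift v oU sa sb aphi Up pp.
rewrite gauss_liftE => ->; rewrite realifyZ cplxK /=.
by rewrite scalerA mulfV ?s2_neq0// scale1r.
Qed.

Lemma dmap_lift_normal U G phi p v : open U -> smooth_cmap U G -> atlas phi -> U p ->
  cdom phi p -> dmap phi (lift_normal G) p v = s2 *: (realify (dcmap phi G p v)).2.
Proof.
move=> oU sG aphi Up pp; have [sa sb] := smooth_lift_parts oU sG.
have := dcmap_gauss_lift v oU sa sb aphi Up pp.
rewrite gauss_liftE => ->; rewrite realifyZ cplxK /=.
by rewrite scalerA mulfV ?s2_neq0// scale1r.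
Qed.

(** The differential of the real part takes its values in the orthogonal of the
    negative definite plane spanned by the real and imaginary parts of [G]; the
    induced metric is therefore positive definite as soon as this differential
    is injective. *)
Lemma lift_hypersurface U G : horizontal_lift U G ->
  (forall phi p v, atlas phi -> U p -> cdom phi p ->
     (realify (dcmap phi G p v)).1 = 0 -> v = 0) ->
  spacelike_hypersurface U (lift_base G) (lift_normal G).
Proof.
move=> hl inj; have [oU sG HG hG] := hl.
have [sa sb] := smooth_lift_parts oU sG.
have l2 : 2 * (2^-1 : R) = 1 by rewrite mulfV.
have parts q : U q -> _ := fun Uq => Hsphere_parts (HG q Uq).1 (HG q Uq).2.
split; split=> //.
- move=> p /parts[h1 _ _]; rewrite /lift_base rformZl rformZr mulrA s2M h1; lra.
- move=> phi p v aphi Up pp v0; rewrite (dmap_lift_base _ oU)//.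
  rewrite rformZl rformZr mulrA s2M pmulr_rgt0//.
  apply: (rform_pos_parts (HG p Up).1 (HG p Up).2).
  + exact: hG.
  + exact: (hlift_conj hl).
  + by apply: contra_neq v0; apply: inj.
- move=> p /parts[h1 h2 h3]; rewrite /lift_base /lift_normal !rformZl !rformZr.
  rewrite (rformC _ (realify _).1) h3 !mulr0; split=> //.
  rewrite mulrA s2M h2; lra.
- move=> phi p v aphi Up pp; rewrite (dmap_lift_base _ oU)// /lift_normal.
  have [_ h _ _] := orthogonal_parts (hG phi p v aphi Up pp) (hlift_conj hl aphi Up pp v).
  by rewrite rformC !rformZl !rformZr h !mulr0.
Qed.

End Hypersurfaces.

(** * The shape operator of a spacelike hypersurface *)

Section RealEigenvalue.
Context {R : realType}.

(** The imaginary part [be] of a complex eigenvalue, with eigenvector [x + i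
    y], satisfies [be * (g x x + g y y) = 0], so that it is zero. *)
Lemma selfadjoint_eigenvalue n (S : 'M[R]_n) (g : 'rV[R]_n -> 'rV[R]_n -> R) :
  (0 < n)%N ->
  (forall (c d : R) x y z, g (c *: x + d *: y) z = c * g x z + d * g y z) ->
  (forall x y, g x y = g y x) ->
  (forall x, x != 0 -> 0 < g x x) ->
  (forall x y, g (x *m S) y = g x (y *m S)) ->
  exists lambda, eigenvalue S lambda.
Proof.
case: n S g => // n S g _ glin gC gpos gS.
pose toC := real_complex R.
have [mu] : exists mu, root (char_poly (map_mx toC S)) mu.
  by apply: closed_rootP; rewrite size_char_poly.
rewrite -eigenvalue_root_char => /eigenvalueP[z zS z0].
pose x := map_mx (@complex.Re R) z; pose y := map_mx (@complex.Im R) z.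
case: mu zS => al be zS.
have E j : (z *m map_mx toC S) 0 j = (al +i* be) * z 0 j by rewrite zS mxE.
have sumE (F : 'I_n.+1 -> R[i]) : \sum_j F j =
    (\sum_j complex.Re (F j)) +i* (\sum_j complex.Im (F j)).
  elim/big_rec3: _ => [|j r1 r2 r3 _ ->] //; by case: (F j).
have xS : x *m S = al *: x + (- be) *: y.
  apply/rowP => j; move: (E j); rewrite !mxE sumE => /(congr1 (@complex.Re R)).
  rewrite ReM /= mulNr => <-; apply: eq_bigr => k _.
  by rewrite !mxE ReM /= mulr0 subr0.
have yS : y *m S = be *: x + al *: y.
  apply/rowP => j; move: (E j); rewrite !mxE sumE => /(congr1 (@complex.Im R)).
  rewrite ImM /= [RHS]addrC => <-; apply: eq_bigr => k _.
  by rewrite !mxE ImM /= mulr0 add0r.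
have g0 w : 0 <= g w w.
  have [->|/gpos/ltW//] := eqVneq w 0.
  by have := glin 0 0 0 0 0; rewrite scale0r addr0 !mul0r addr0 => ->.
have gx0 w : g w w = 0 -> w = 0.
  by move=> gw; apply/eqP; apply: contraTT isT => /gpos; rewrite gw ltxx.
have be0 : be = 0.
  have := gS x y; rewrite xS yS glin [RHS]gC glin (gC y x) => h.
  have h' : be * (g x x + g y y) = 0 by lra.
  move/eqP: h'; rewrite mulf_eq0 => /orP[/eqP//|].
  rewrite paddr_eq0// => /andP[/eqP/gx0 x0 /eqP/gx0 y0].
  case/eqP: z0; apply/rowP => j; apply: complexP.
    by move/rowP: x0 => /(_ j); rewrite !mxE.
  by move/rowP: y0 => /(_ j); rewrite !mxE.
exists al; apply/eigenvalueP.
have [x0|x0] := eqVneq x 0; last first.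
  by exists x => //; rewrite xS be0 oppr0 scale0r addr0.
exists y; first by rewrite yS be0 scale0r add0r.
apply: contra_neq z0 => y0; apply/rowP => j; apply: complexP.
  by move/rowP: x0 => /(_ j); rewrite !mxE.
by move/rowP: y0 => /(_ j); rewrite !mxE.
Qed.

End RealEigenvalue.

Section ShapeOperator.
Context {R : realType} {n : nat} {M : manifold R n}.
Local Notation W := 'rV[R]_n.+2.
Local Notation s2 := (Num.sqrt (2 : R)).

Variables (U : set M) (a b : M -> W) (oU : open U).
Hypothesis ab : spacelike_hypersurface U a b.
Variables (phi : chart R n M) (p : M) (aphi : atlas phi) (Up : U p) (pp : cdom phi p).

Local Notation da := (dmap phi a p).
Local Notation db := (dmap phi b p).
Local Notation G := (gauss_lift a b).
Local Notation S := (hypersurface_shape phi a b p).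

Let hl : horizontal_lift U G. Proof. exact: hypersurface_lift. Qed.
Let sa : smooth_map U a. Proof. by case: ab => -[]. Qed.
Let sb : smooth_map U b. Proof. by case: ab => _ []. Qed.

Lemma da_linear (c : R) v w : da (c *: v + w) = c *: da v + da w.
Proof. by apply: dmap_linear; exact: (smooth_map_diff sa). Qed.
Lemma db_linear (c : R) v w : db (c *: v + w) = c *: db v + db w.
Proof. by apply: dmap_linear; exact: (smooth_map_diff sb). Qed.

Lemma da0 : da 0 = 0.
Proof. by rewrite /dmap derive0. Qed.
Lemma daZ (c : R) v : da (c *: v) = c *: da v.
Proof. by rewrite -[c *: v]addr0 da_linear da0 addr0. Qed.
Lemma daD v w : da (v + w) = da v + da w.
Proof. by rewrite -[v]scale1r da_linear !scale1r. Qed.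
Lemma daN v : da (- v) = - da v.
Proof. by rewrite -scaleN1r daZ scaleN1r. Qed.
Lemma da_pos v : v != 0 -> 0 < rform (da v) (da v).
Proof. by case: ab => -[_ _ h] _; apply: h. Qed.

Lemma da_inj v : da v = 0 -> v = 0.
Proof.
by move=> v0; apply/eqP; apply: contraTT isT => /da_pos; rewrite v0 rform0l ltxx.
Qed.

Lemma dcmap_gauss v : dcmap phi G p v = (s2^-1)%:C *: cplx (da v, db v).
Proof. exact: (dcmap_gauss_lift v oU). Qed.

Lemma differentials_tangent v : [/\ rform (da v) (a p) = 0, rform (da v) (b p) = 0,
  rform (db v) (a p) = 0 & rform (db v) (b p) = 0].
Proof.
have := orthogonal_parts (hlift_horizontal hl aphi Up pp v) (hlift_conj hl aphi Up pp v).
have k0 : s2^-1 != 0 by rewrite invr_eq0 s2_neq0.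
rewrite dcmap_gauss; move: (da v) (db v) => x y; rewrite realifyZ cplxK realify_gauss /= !rformZl !rformZr.
move=> [/eqP h1 /eqP h2 /eqP h3 /eqP h4].
by move: h1 h2 h3 h4; rewrite !mulf_eq0 (negPf k0) /= => /eqP-> /eqP-> /eqP-> /eqP->.
Qed.

Lemma rform_ab : [/\ rform (a p) (a p) = -1, rform (b p) (b p) = -1 &
  rform (b p) (a p) = 0].
Proof. by case: ab => -[_ /(_ p Up) ? _] [_ /(_ p Up)[? ?] _]. Qed.

Definition dmatrix : 'M[R]_(n, n.+2) := \matrix_(i < n) da (delta_mx 0 i).

Lemma dmatrixE v : da v = v *m dmatrix.
Proof.
have -> : v *m dmatrix = \sum_i v 0 i *: da (delta_mx 0 i).
  apply/rowP => j; rewrite mxE summxE; apply: eq_bigr => i _.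
  by rewrite !mxE.
rewrite [in LHS](row_sum_delta v).
elim: (index_enum _) => [|i s IH]; first by rewrite !big_nil da0.
by rewrite !big_cons da_linear IH.
Qed.

(** By dimension: [a p], [b p] and the values of [da] on a basis are linearly
    independent. *)
Lemma tangent_span w : rform w (a p) = 0 -> rform w (b p) = 0 -> exists u, w = da u.
Proof.
move=> wa wb; have [aa bb ba] := rform_ab.
pose K := col_mx (col_mx (a p) (b p)) dmatrix.
have combo (x : 'rV_(1 + 1 + n)) : x *m K =
    (lsubmx (lsubmx x) 0 0) *: a p + (rsubmx (lsubmx x) 0 0) *: b p + da (rsubmx x).
  rewrite -{1}[x]hsubmxK /K mul_row_col -{1}[lsubmx x]hsubmxK mul_row_col dmatrixE.
  by rewrite -!mul_scalar_mx -!mx11_scalar.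
have pair (x : 'rV_(1 + 1 + n)) (t := x *m K) :
    rform t (a p) = - lsubmx (lsubmx x) 0 0 /\ rform t (b p) = - rsubmx (lsubmx x) 0 0.
  have [h1 h2 _ _] := differentials_tangent (rsubmx x).
  by rewrite /t combo !rformDl !rformZl aa bb ba (rformC (a p)) ba h1 h2; split; lra.
have Kfree : row_free K.
  apply: inj_row_free => x xK; have [] := pair x.
  rewrite xK !rform0l => /eqP; rewrite eq_sym oppr_eq0 => /eqP e1.
  move=> /eqP; rewrite eq_sym oppr_eq0 => /eqP e2.
  have := combo x; rewrite xK e1 e2 !scale0r !add0r => /esym/da_inj e3.
  rewrite -[x]hsubmxK e3 -[lsubmx x]hsubmxK.
  rewrite [lsubmx (lsubmx x)]mx11_scalar [rsubmx (lsubmx x)]mx11_scalar e1 e2.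
  by rewrite !raddf0 !row_mx0.
have Kfull : row_full K by rewrite /row_full (eqP Kfree).
have /submxP[x wx] : (w <= K)%MS by exact: submx_full.
exists (rsubmx x); have [e1 e2] := pair x; rewrite wx combo.
rewrite -wx wa in e1; rewrite -wx wb in e2.
have -> : lsubmx (lsubmx x) 0 0 = 0 by lra.
have -> : rsubmx (lsubmx x) 0 0 = 0 by lra.
by rewrite !scale0r !add0r.
Qed.

Lemma shapeE v : db v = - da (v *m S).
Proof.
have ex (i : 'I_n) : exists u, db (delta_mx 0 i) = da u.
  by have [_ _ h1 h2] := differentials_tangent (delta_mx 0 i); exact: tangent_span.
have [f fE] := choice ex.
have := @xgetPex _ 0 [set S | forall v, db v = - da (v *m S)]; apply.
exists (- \matrix_(i < n) f i) => w.
have -> : w *m (- \matrix_(i < n) f i) = - \sum_i w 0 i *: f i.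
  rewrite mulmxN; congr (- _); apply/rowP => j; rewrite mxE summxE.
  by apply: eq_bigr => i _; rewrite !mxE.
rewrite daN opprK [in LHS](row_sum_delta w).
elim: (index_enum _) => [|i s IH]; first by rewrite !big_nil da0 /dmap derive0.
by rewrite !big_cons db_linear da_linear IH fE.
Qed.

(** This is the isotropy of the horizontal lift: the imaginary part of the
    Hermitian product of two values of its differential is the difference of
    the two sides, up to a factor. *)
Lemma shape_selfadjoint v w : rform (da (v *m S)) (da w) = rform (da v) (da (w *m S)).
Proof.
have := hlift_isotropic hl aphi Up pp v w.
rewrite !dcmap_gauss hformZl hformZr hform_cplx !shapeE conjc_real mulrA -rmorphM /= s2VM.
rewrite !(rformNl, rformNr) mul0r addr0 => /eqP.
rewrite mulf_eq0 invr_eq0 pnatr_eq0 /= => /eqP h; lra.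
Qed.

Lemma dcmap_gauss_shape v : dcmap phi G p v = (s2^-1)%:C *: cplx (da v, - da (v *m S)).
Proof. by rewrite dcmap_gauss shapeE. Qed.

Lemma shape_eigenvalue : (0 < n)%N -> exists lambda, eigenvalue S lambda.
Proof.
move=> n0; apply: (selfadjoint_eigenvalue (g := fun v w => rform (da v) (da w))) => //.
- by move=> c d x y z; rewrite da_linear daZ rformDl !rformZl.
- by move=> x y; rewrite rformC.
- exact: da_pos.
- exact: shape_selfadjoint.
Qed.

(** The eigenvalue condition in terms of differentials, whose behaviour under
    changes of charts and rotations of the lift is immediate. *)
Lemma eigenvalue_shapeP lambda :
  eigenvalue S lambda <-> exists2 v, v != 0 & db v = - (lambda *: da v).
Proof.
split=> [/eigenvalueP[v vS v0]|[v v0 dbv]].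
  by exists v => //; rewrite shapeE vS daZ.
apply/eigenvalueP; exists v => //; apply/eqP; rewrite -subr_eq0; apply/eqP.
apply: da_inj; rewrite daD daN daZ.
by move: dbv; rewrite shapeE => /oppr_inj->; rewrite subrr.
Qed.

End ShapeOperator.

(** * The differential of a Gauss map *)

Section Angles.
Context {R : realType}.

Lemma cos2 (t : R) : cos (2 * t) = 2 * cos t ^+ 2 - 1.
Proof. by rewrite mulr_natl cos_mulr2n mulr_natl. Qed.
Lemma sin2 (t : R) : sin (2 * t) = 2 * (cos t * sin t).
Proof. by rewrite mulr_natl sin_mulr2n mulr_natl. Qed.

Definition expi (t : R) : R[i] := cos t +i* sin t.

Lemma expiD s t : expi (s + t) = expi s * expi t.
Proof. by rewrite /expi cosD sinD; apply: complexP; rewrite !ReImE /=; ring. Qed.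
Lemma expiN t : expi (- t) = conjc (expi t).
Proof. by rewrite /expi cosN sinN. Qed.
Lemma expi0 : expi 0 = 1.
Proof. by rewrite /expi cos0 sin0. Qed.
Lemma expi_norm t : expi t * conjc (expi t) = 1.
Proof. by rewrite -expiN -expiD subrr expi0. Qed.

Lemma angle_factor (m : nat) (t : R) (X : 'M[R[i]]_m) :
  (cos (2 * t))%:C *: X - (sin (2 * t))%:C *: ('i *: X) = expi (- (2 * t)) *: X.
Proof.
rewrite scalerA -scalerBl expiN /expi; congr (_ *: _).
by apply: complexP; rewrite !ReImE /=; ring.
Qed.

(** The two equations are [2 cos t] and [2 sin t] times the equation [cos t x =
    sin t y], in which [sin t = 0] would force [x = 0]. *)
Lemma half_angle m (x y : 'rV[R]_m) (t : R) : x != 0 ->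
  (- x = cos (2 * t) *: x - sin (2 * t) *: y /\
   - y = - cos (2 * t) *: y - sin (2 * t) *: x) <->
  (sin t != 0 /\ y = cot t *: x).
Proof.
move=> x0; rewrite cos2 sin2; have tr := cos2Dsin2 t; split=> [[h1 h2]|[s0 ->]].
  have k1 j : sin t * (cos t * y 0 j) = cos t ^+ 2 * x 0 j.
    by move/rowP: h1 => /(_ j); rewrite !mxE; lra.
  have k2 j : sin t * (sin t * y 0 j) = sin t * (cos t * x 0 j).
    have e : cos t ^+ 2 = 1 - sin t ^+ 2 by lra.
    by move/rowP: h2 => /(_ j); rewrite !mxE e; lra.
  have s0 : sin t != 0.
    apply: contra_neq x0 => s0; apply/rowP => j; rewrite mxE.
    have := k1 j; rewrite s0 mul0r => /esym/eqP; rewrite mulf_eq0 => /orP[|/eqP//].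
    have -> : cos t ^+ 2 = 1 by move: tr; rewrite s0; lra.
    by rewrite oner_eq0.
  split=> //; apply/rowP => j; rewrite mxE /cot.
  by apply: (mulfI s0); rewrite mulrA mulrCA mulfV// mulr1; apply: (mulfI s0); rewrite k2.
have ck : cot t * sin t = cos t by rewrite /cot divfK.
have e : 1 = cos t ^+ 2 + sin t ^+ 2 by rewrite tr.
split; apply/rowP => j; rewrite !mxE -ck; rewrite -ck in e; move: (cot t) (sin t) (x 0 j) e => k s X e.
  ring.
have -> : - (2 * (k * s) ^+ 2 - 1) * (k * X) - 2 * (k * s * s) * X =
  k * X * (1 - 2 * ((k * s) ^+ 2 + s ^+ 2)) by ring.
by rewrite -e; ring.
Qed.

Lemma cot_surj (l : R) : exists t, sin t != 0 /\ l = cot t.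
Proof.
exists (pi / 2 - atan l); rewrite /cot sinB cosB cos_pihalf sin_pihalf !mul0r !mul1r subr0 add0r.
have c0 : cos (atan l) != 0 by rewrite gt_eqF// cos_gt0_pihalf// atan_gtNpi2 atan_ltpi2.
by split=> //; rewrite -[LHS]atanK.
Qed.

End Angles.

Lemma cplx_eq0 (R : realType) (n : nat) (x y : 'rV[R]_n.+2) :
  cplx (x, y) = 0 -> x = 0 /\ y = 0.
Proof.
move=> /(congr1 (@realify R n)); rewrite cplxK => -[-> ->].
by split; apply/rowP => j; rewrite !mxE.
Qed.

Lemma lift_eq0 (R : realType) (m : nat) (z w : 'rV[R[i]]_m) (k : R[i]) (X : 'M[R[i]]_m) :
  k != 0 -> z *m X = k *: w -> X = 0 -> w = 0.
Proof.
move=> k0 + X0; rewrite X0 mulmx0 => /esym/eqP.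
by rewrite scaler_eq0 (negPf k0) => /eqP.
Qed.

Section GaussMapPointwise.
Context {R : realType} {n : nat} {M : manifold R n}.
Local Notation V := 'rV[R[i]]_n.+2.
Local Notation W := 'rV[R]_n.+2.
Local Notation s2 := (Num.sqrt (2 : R)).

Variables (U : set M) (a b : M -> W) (f : M -> {vspace V}) (oU : open U).
Hypothesis ab : spacelike_hypersurface U a b.
Hypothesis fE : forall q, U q -> gauss_map a b q = f q.
Variables (phi : chart R n M) (p : M) (aphi : atlas phi) (Up : U p) (pp : cdom phi p).

Local Notation da := (dmap phi a p).
Local Notation G := (gauss_lift a b).
Local Notation S := (hypersurface_shape phi a b p).

Let hl : horizontal_lift U G. Proof. exact: hypersurface_lift. Qed.

Lemma gauss_local_lift q : U q -> local_lift f q G.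
Proof. by move=> Uq; apply: (hlift_local hl Uq) => r Ur; rewrite gauss_lift_line fE. Qed.

Lemma gauss_Hsphere : Hsphere (G p) /\ quad (G p) = 0.
Proof. by case: hl => _ _ /(_ p Up). Qed.

Lemma gauss_line : <[G p]>%VS = f p.
Proof. by rewrite gauss_lift_line fE. Qed.

Lemma dCH_gauss v : dCH phi f p v = dhopf (G p) (dcmap phi G p v).
Proof. exact: (dCHE _ aphi pp (gauss_local_lift Up)). Qed.

(** The canonical lift is horizontal, so that its differential is the
    horizontal lift of the differential of the Gauss map. *)
Lemma dCH_dcmap v : G p *m dCH phi f p v = dcmap phi G p v.
Proof. by rewrite dCH_gauss; exact: (hlift_dhopf hl aphi Up pp). Qed.

Lemma dCH_lift v : G p *m dCH phi f p v = (s2^-1)%:C *: cplx (da v, - da (v *m S)).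
Proof. exact: etrans (dCH_dcmap v) (dcmap_gauss_shape oU ab aphi Up pp v). Qed.

Lemma gCH_dcmap (Y : 'M[R[i]]_n.+2) v :
  gCH (f p) Y (dCH phi f p v) = cform (G p *m Y) (dcmap phi G p v).
Proof.
have [GH _] := gauss_Hsphere; rewrite -gauss_line.
exact: etrans (gCHE _ _ GH) (congr1 (cform (G p *m Y)) (dCH_dcmap v)).
Qed.

Lemma dCH_tangent v : tangentCH (f p) (dCH phi f p v).
Proof. by rewrite dCH_gauss -gauss_line; apply: tangent_dhopf; case: gauss_Hsphere. Qed.

Lemma dCH_tangentQ v : tangentQ (f p) (dCH phi f p v).
Proof.
have [GH _] := gauss_Hsphere; rewrite dCH_gauss -gauss_line; apply: tangentQ_dhopf => //.
  exact: (hlift_horizontal hl).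
exact: (hlift_conj hl).
Qed.

Lemma dCH_linear (c : R) v w :
  dCH phi f p (c *: v + w) = c%:C *: dCH phi f p v + dCH phi f p w.
Proof.
have [GH _] := gauss_Hsphere.
apply: (tangent_inj GH); rewrite ?gauss_line.
- exact: dCH_tangent.
- by apply: tangentCHD; [apply: tangentCHZ|]; exact: dCH_tangent.
have := hlift_linear hl aphi Up pp c v w; rewrite -3!dCH_dcmap.
move: (dCH phi f p _) (dCH phi f p v) (dCH phi f p w) => X Y Z ->.
by rewrite mulmxDr -scalemxAr.
Qed.

Lemma dCH_inj v : dCH phi f p v = 0 -> v = 0.
Proof.
move=> v0; have /cplx_eq0[h _] := lift_eq0 (@s2VC_neq0 R) (dCH_lift v) v0.
exact: (da_inj ab aphi Up pp h).
Qed.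

(** Tangent vectors are determined by their horizontal lifts. *)
Lemma angle_lift (B : 'M[R[i]]_n.+2) v (t : R) : tangentCH (f p) B ->
  B = (cos (2 * t))%:C *: dCH phi f p v - (sin (2 * t))%:C *: ('i *: dCH phi f p v) <->
  G p *m B = expi (- (2 * t)) *: (G p *m dCH phi f p v).
Proof.
move=> tB; rewrite angle_factor scalemxAr; split=> [->//|].
have [GH _] := gauss_Hsphere; apply: (tangent_inj GH); rewrite ?gauss_line//.
by apply: tangentCHZ; exact: dCH_tangent.
Qed.

(** Isotropy of the lift makes [i] times the differential normal. Conversely
    the lift of a normal vector has parts [da x] and [da y]; orthogonality
    to the differential means [x = y S], and then its multiple by [i] is the
    image of [- sqrt 2 y]. *)
Lemma gauss_lagrangian_at :
  (forall v, normalM phi f p ('i *: dCH phi f p v)) /\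
  (forall Y, normalM phi f p Y -> exists v, 'i *: Y = dCH phi f p v).
Proof.
have [GH qG] := gauss_Hsphere; split=> [v|Y [tY nY]].
  split; first by rewrite -gauss_line; apply: tangentQZ => //; rewrite gauss_line; exact: dCH_tangentQ.
  move=> w; rewrite gCH_dcmap -scalemxAr cformZi dCH_dcmap.
  by rewrite (hlift_isotropic hl aphi Up pp) oppr0.
have [tY' hY] : tangentCH (f p) Y /\ hform (G p *m Y) (conjv (G p)) = 0.
  by rewrite -gauss_line; apply/(tangentQE Y GH); rewrite gauss_line.
have hYG : hform (G p *m Y) (G p) = 0.
  by apply: tangent_horizontal; rewrite gauss_line.
have [h1 h2 h3 h4] := orthogonal_parts hYG hY.
have k0 : s2^-1 != 0 by rewrite invr_eq0 s2_neq0.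
have KK (r : R) : s2^-1 * r = 0 -> r = 0.
  by move=> /eqP; rewrite mulf_eq0 (negPf k0) => /eqP.
move: h1 h2 h3 h4; rewrite realify_gauss /= !rformZr => /KK h1 /KK h2 /KK h3 /KK h4.
have [x xE] := tangent_span oU ab aphi Up pp h1 h2.
have [y yE] := tangent_span oU ab aphi Up pp h3 h4.
have wE : G p *m Y = cplx (da x, da y) by rewrite -xE -yE -[LHS]realifyK.
have key : x = y *m S.
  apply/eqP; rewrite -subr_eq0; apply/contraT => u0.
  have := nY (x - y *m S); rewrite gCH_dcmap wE (dcmap_gauss_shape oU ab aphi Up pp).
  rewrite /cform hformZr hform_cplx conjc_real rformNr -(shape_selfadjoint oU ab aphi Up pp).
  have := da_pos ab aphi Up pp u0.
  set u := x - y *m S; have -> : da x = da u + da (y *m S).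
    by rewrite -(daD ab aphi Up pp) subrK.
  rewrite rformDl addrK /= mul0r subr0 => pos /eqP.
  by rewrite mulf_eq0 (negPf k0) /= gt_eqF.
exists ((- s2) *: y).
apply: (tangent_inj GH); rewrite ?gauss_line; [exact: tangentCHZ|exact: dCH_tangent|].
rewrite -scalemxAr wE dCH_dcmap (dcmap_gauss_shape oU ab aphi Up pp) -scalemxAl !(daZ ab aphi Up pp) -key.
move: (da x) (da y) => x' y'.
apply/rowP => j; rewrite !mxE; apply: complexP; rewrite !ReImE /=.
  by rewrite !mulrN mul0r mul1r; rewrite mulNr mulrN mulrA mulVf ?s2_neq0//; ring.
by rewrite mulNr opprK mulrA mulVf ?s2_neq0//; ring.
Qed.

End GaussMapPointwise.

(** * Angle functions and principal curvatures *)

Lemma frame_neq0 (R : realType) (n : nat) (e : 'I_n -> 'rV[R]_n) j :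
  frame e -> e j != 0.
Proof.
move=> fe; apply/eqP => e0.
have E : (delta_mx 0 j : 'rV_n) *m (\matrix_(j < n) e j) = 0 *m (\matrix_(j < n) e j).
  by rewrite -rowE mul0mx rowK.
have := row_free_inj fe E => /(congr1 (fun M : 'rV_n => M 0 j)).
by rewrite !mxE !eqxx => /eqP; rewrite oner_eq0.
Qed.

Section GaussMapImmersion.
Context {R : realType} {n : nat} {M : manifold R n}.
Local Notation V := 'rV[R[i]]_n.+2.
Local Notation W := 'rV[R]_n.+2.
Local Notation s2 := (Num.sqrt (2 : R)).

Lemma gauss_lagrangian_immersion (a b : M -> W) :
  spacelike_hypersurface setT a b -> lagrangian_immersion (gauss_map a b).
Proof.
move=> ab; have fE q : setT q -> gauss_map a b q = gauss_map a b q by [].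
split; last first.
  by move=> phi p aphi pp; apply: (gauss_lagrangian_at openT ab fE aphi).
split.
- by move=> p; exists (gauss_lift a b); apply: (gauss_local_lift openT ab fE).
- move=> p; have [GH qG] := gauss_Hsphere openT ab (p := p) I.
  by rewrite -gauss_lift_line; apply/Qstar_quad.
- by move=> phi p v aphi pp; apply: (dCH_inj openT ab fE aphi).
Qed.

Section PrincipalAngles.
Variables (U : set M) (a b : M -> W) (oU : open U).
Hypothesis ab : spacelike_hypersurface U a b.
Local Notation f := (gauss_map a b).
Variables (phi : chart R n M) (p : M) (aphi : atlas phi) (Up : U p) (pp : cdom phi p).
Variable A : {vspace V} -> 'M[R[i]]_n.+2 -> 'M[R[i]]_n.+2.
Hypothesis AE : forall v, A (f p) (dCH phi f p v) =
  - dhopf (gauss_lift a b p) (dcmap phi (@conjv R n \o gauss_lift a b) p v).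

Local Notation da := (dmap phi a p).
Local Notation G := (gauss_lift a b).
Local Notation S := (hypersurface_shape phi a b p).

Let fE q : U q -> gauss_map a b q = f q. Proof. by []. Qed.
Let hl : horizontal_lift U G. Proof. exact: hypersurface_lift. Qed.

Lemma product_structure_lift v :
  tangentCH (f p) (A (f p) (dCH phi f p v)) /\
  G p *m A (f p) (dCH phi f p v) = - (s2^-1)%:C *: cplx (da v, da (v *m S)).
Proof.
have [GH qG] := gauss_Hsphere oU ab Up.
have [_ sG _ _] := hl.
have cE : dcmap phi (@conjv R n \o G) p v = conjv (dcmap phi G p v).
  exact: (dcmapJ oU aphi Up pp v sG).
have hz : hform (conjv (dcmap phi G p v)) (G p) = 0.
  by rewrite -(conjvK (G p)) hformJJ (hlift_conj hl aphi Up pp) conjc0.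
rewrite AE cE; split.
  by rewrite -gauss_lift_line -scaleN1r; apply: tangentCHZ; apply: tangent_dhopf.
rewrite mulmxN dhopf_horizontal// (dcmap_gauss_shape oU ab aphi Up pp) conjvZ conjv_cplx.
by rewrite opprK conjc_real scaleNr.
Qed.

(** The horizontal lift of the image of [e] is [da e - i da (e S)] up to a
    real factor, and [A] turns it into minus its conjugate: the angle
    relation becomes a relation between the real vectors [da e] and [da (e
    S)]. *)
Lemma angle_principal e t : e != 0 ->
  A (f p) (dCH phi f p e) =
    (cos (2 * t))%:C *: dCH phi f p e - (sin (2 * t))%:C *: ('i *: dCH phi f p e) <->
  (sin t != 0 /\ e *m S = cot t *: e).
Proof.
move=> e0; have [tA AL] := product_structure_lift e.
rewrite (angle_lift oU ab fE aphi Up pp e t tA) AL (dCH_lift oU ab fE aphi Up pp).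
have x0 : da e != 0 by apply: contra_neq e0 => /(da_inj ab aphi Up pp).
have -> : (e *m S = cot t *: e) <-> (da (e *m S) = cot t *: da e).
  rewrite -(daZ ab aphi Up pp); split=> [->//|h].
  apply/eqP; rewrite -subr_eq0; apply/eqP; apply: (da_inj ab aphi Up pp).
  by rewrite (daD ab aphi Up pp) (daN ab aphi Up pp) h subrr.
rewrite -(half_angle (da (e *m S)) t x0); move: (da e) (da (e *m S)) => x y.
have k0 := @s2VC_neq0 R.
rewrite scaleNr -scalerN scalerA [_ * (s2^-1)%:C]mulrC -scalerA.
have -> : (s2^-1)%:C *: - cplx (x, y) = (s2^-1)%:C *: (expi (- (2 * t)) *: cplx (x, - y)) <->
   - cplx (x, y) = expi (- (2 * t)) *: cplx (x, - y).
  by split=> [|->//]; apply: scalerI.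
rewrite expiN /expi /=; split=> [h|[h1 h2]].
  have E j : (- cplx (x, y)) 0 j = ((cos (2 * t) -i* sin (2 * t)) *: cplx (x, - y)) 0 j.
    by rewrite h.
  split; apply/rowP => j; move: (E j); rewrite !mxE /= => -[h1 h2].
    by rewrite h1; ring.
  by rewrite h2; ring.
apply/rowP => j; rewrite !mxE /=; apply: complexP; rewrite !ReImE /=.
  by move/rowP: h1 => /(_ j); rewrite !mxE => e1; rewrite [LHS]e1; ring.
by move/rowP: h2 => /(_ j); rewrite !mxE => e2; rewrite [LHS]e2; ring.
Qed.

(** A linear relation between the vectors [e j] holds for their images under
    the differential, whose products with each [e k] give the coefficients. *)
Lemma orthonormal_frame e : orthonormal_family phi f p e -> frame e.
Proof.
move=> oe; apply: inj_row_free => x xe.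
have xE : \sum_j x 0 j *: e j = 0.
  apply: etrans _ xe; apply/rowP => k; rewrite summxE [RHS]mxE; apply: eq_bigr => j _.
  by rewrite !mxE.
have lin (s : seq 'I_n) : dCH phi f p (\sum_(j <- s) x 0 j *: e j) =
    \sum_(j <- s) (x 0 j)%:C *: dCH phi f p (e j).
  elim: s => [|j s IH]; last by rewrite !big_cons (dCH_linear oU ab fE aphi Up pp) IH.
  rewrite !big_nil (dCH_gauss oU ab fE aphi Up pp).
  have -> : dcmap phi G p 0 = 0 by rewrite (dcmap_gauss oU ab aphi Up pp) /dmap !derive0 -[(0, 0)]/(0 : W * W)%type -(scale0r 0) cplxZ scale0r scaler0.
  by rewrite /dhopf hform0l scale0r addr0 mulmx0 oppr0.
apply/rowP => k; rewrite mxE.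
have gsum (s : seq 'I_n) : gCH (f p) (\sum_(j <- s) (x 0 j)%:C *: dCH phi f p (e j)) (dCH phi f p (e k)) =
    \sum_(j <- s) x 0 j * (j == k)%:R.
  elim: s => [|j s IH]; first by rewrite !big_nil /gCH mulmx0 /cform hform0l.
  rewrite !big_cons -IH -oe /gCH mulmxDr /cform hformDl ReD; congr (_ + _).
  by rewrite -scalemxAr hformZl ReM /= mul0r subr0.
have := gsum (index_enum _); rewrite -lin xE.
have -> : dCH phi f p 0 = 0.
  by have := lin [::]; rewrite !big_nil.
rewrite /gCH mulmx0 /cform hform0l (bigD1 k)//= eqxx mulr1 big1 ?addr0 => [<-//|j jk].
by rewrite (negPf jk) mulr0.
Qed.

Lemma principal_of_angles e theta : orthonormal_family phi f p e ->
  angle_relation A phi f p e theta ->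
  exists2 lambda, principal_frame phi a b p e lambda &
    forall j, sin (theta j) != 0 /\ lambda j = cot (theta j).
Proof.
move=> /orthonormal_frame fe Ae; exists (fun j => cot (theta j)).
  by split=> // j; have [_] := (angle_principal (theta j) (frame_neq0 j fe)).1 (Ae j).
by move=> j; have [] := (angle_principal (theta j) (frame_neq0 j fe)).1 (Ae j).
Qed.

Lemma angles_of_principal e lambda : principal_frame phi a b p e lambda ->
  (exists theta, angle_relation A phi f p e theta) /\
  (forall theta, angle_relation A phi f p e theta ->
     forall j, sin (theta j) != 0 /\ lambda j = cot (theta j)).
Proof.
move=> [fe eS]; split.
  have [th thE] := choice (fun j => cot_surj (lambda j)).
  exists th => j; apply/(angle_principal _ (frame_neq0 j fe)).
  by have [s0 lE] := thE j; rewrite eS lE.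
move=> theta Ae j.
have [s0 eS'] := (angle_principal (theta j) (frame_neq0 j fe)).1 (Ae j).
split=> //; move: eS'; rewrite eS => /eqP.
rewrite -subr_eq0 -scalerBl scaler_eq0 (negPf (frame_neq0 j fe)) orbF subr_eq0.
by move/eqP.
Qed.

End PrincipalAngles.
End GaussMapImmersion.

(** * Uniqueness of the Levi-Civita connection *)

Section LeviCivita.
Context {R : realType} {n : nat}.
Local Notation V := 'rV[R[i]]_n.+2.
Local Notation VR := ('rV[R]_n.+2 * 'rV[R]_n.+2)%type.
Local Notation MM := 'M[R[i]]_n.+2.
Local Notation Re := (@complex.Re R).
Local Notation Im := (@complex.Im R).
Implicit Types (O : set {vspace V}) (L : {vspace V}) (X Y Z : {vspace V} -> MM).
Implicit Types (k : {vspace V} -> R) (z u : V) (w : VR).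

Definition cone O : set VR := [set w | O <[cplx w]>%VS].

(** The horizontal lift of a vector field, extended homogeneously to the cone.
    *)
Definition flift X (w : VR) : V := cplx w *m X <[cplx w]>%VS.

Lemma cone_open O : openCH O -> open (cone O). Proof. by case. Qed.

Lemma cone_negative O w : openCH O -> cone O w -> cform (cplx w) (cplx w) < 0.
Proof. by move=> [OCH _] /OCH/CH_negative. Qed.

Lemma cone_hform_neq0 O w : openCH O -> cone O w -> hform (cplx w) (cplx w) != 0.
Proof.
move=> oO /(cone_negative oO) h; rewrite hform_real.
by apply/eqP => /(congr1 Re)/= e; rewrite e ltxx in h.
Qed.

Lemma cone_fibre O L : openCH O -> O L ->
  [/\ Hsphere (fibre L), <[fibre L]>%VS = L & cone O (realify (fibre L))].
Proof.
move=> [OCH _] OL; have [fH fL] := fibreP (OCH L OL).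
by split=> //; rewrite /cone /= realifyK fL.
Qed.

Lemma vsmooth_cplx (D : set VR) : open D -> vsmooth D (@cplx R n).
Proof.
move=> oD k; have H := Ck_id_lin k (L := idfun) oD (fun x => cvg_id).
by apply: Ck_eq oD _ H => w _; rewrite cplxK.
Qed.

Lemma vder_cplx (v w : VR) : vder v (@cplx R n) w = cplx v.
Proof.
rewrite vder.unlock; congr cplx; rewrite -[RHS](derive_id w v).
by congr ('D_v _ w); apply/funext => y; rewrite cplxK.
Qed.

Lemma gCH_cone z (A B : MM) : cform z z < 0 ->
  gCH <[z]>%VS A B = cform (z *m A) (z *m B) / - cform z z.
Proof.
move=> zz; have [fH fE] := fibreP (negative_CH zz).
have [c c0 zE] := vline_eq (Hsphere_neq0 fH) fE.
have e1 : cform z z = - (Re c ^+ 2 + Im c ^+ 2) by rewrite zE cform_scale fH mulrN1.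
have n0 : Re c ^+ 2 + Im c ^+ 2 != 0 by rewrite -complex_eq0.
rewrite e1 opprK [in RHS]zE /gCH /cform -!scalemxAl hformZl hformZr mulrA.
by rewrite conjc_normE ReM /= mul0r subr0 [X in _ = X / _]mulrC mulfK.
Qed.

(** The horizontal part of the derivative, in the flat space [C^(n+2)], of the
    homogeneous lift of [Y]. *)
Definition Dconn X Y L : MM :=
  dhopf (fibre L) (vder (realify (fibre L *m X L)) (flift Y) (realify (fibre L))).

Lemma Dconn_tangent O X Y L : openCH O -> O L -> tangentCH L (Dconn X Y L).
Proof.
by move=> oO OL; have [fH fL _] := cone_fibre oO OL; rewrite -{1}fL; exact: tangent_dhopf.
Qed.

Lemma flift_fibre O X L : openCH O -> O L ->
  flift X (realify (fibre L)) = fibre L *m X L.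
Proof. by move=> oO OL; have [_ fL _] := cone_fibre oO OL; rewrite /flift realifyK fL. Qed.

Lemma flift_horizontal O X L : openCH O -> O L -> smooth_field O X ->
  hform (fibre L *m X L) (fibre L) = 0.
Proof.
move=> oO OL [tX _]; have [fH fL _] := cone_fibre oO OL.
by apply: tangent_horizontal; rewrite fL; exact: tX.
Qed.

(** The norm of the point is stationary in horizontal directions. *)
Lemma cder_cone_quotient O (c q : VR -> R[i]) z (v : VR) : openCH O -> Hsphere z ->
  cone O (realify z) -> hform (cplx v) z = 0 ->
  csmooth (cone O) c ->
  (forall w, cone O w -> q w = c w * (hform (cplx w) (cplx w))^-1) ->
  csmooth (cone O) q /\ cder v q (realify z) = - cder v c (realify z).
Proof.
move=> oO zH Oz vz sc qE; have oD := cone_open oO.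
have sh : csmooth (cone O) (fun w : VR => hform (cplx w) (cplx w)).
  by apply: csmooth_hform => //; exact: vsmooth_cplx.
have h0 w : cone O w -> hform (cplx w) (cplx w) != 0 by exact: cone_hform_neq0.
have sq : csmooth (cone O) q.
  apply: csmooth_eq oD _ (csmoothM oD sc (csmoothV oD h0 sh)) => w Ow.
  by rewrite qE.
split=> //.
have E : cder v (fun w => q w * hform (cplx w) (cplx w)) (realify z) = cder v c (realify z).
  by apply: (cder_eq _ oD Oz) => w Ow; rewrite qE// divfK// h0.
rewrite -E (cderM Oz v sq sh) (cder_hform oD Oz v (vsmooth_cplx oD) (vsmooth_cplx oD)).
rewrite vder_cplx realifyK vz -(hform_conj (cplx v) z) vz conjc0 addr0 mulr0 addr0.
by rewrite (hform_Hsphere zH) mulrN1 opprK.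
Qed.

(** The vertical parts of the derivatives of the lifts are orthogonal to the
    lifts, which are horizontal. *)
Lemma metric_Dconn O X Y Z L : openCH O -> O L ->
  smooth_field O X -> smooth_field O Y -> smooth_field O Z ->
  vderiv X (fun L' => gCH L' (Y L') (Z L')) L =
  gCH L (Dconn X Y L) (Z L) + gCH L (Y L) (Dconn X Z L).
Proof.
move=> oO OL sX sY sZ; have oD := cone_open oO.
have [fH fL Of] := cone_fibre oO OL; set z := fibre L in fH fL Of *.
set v := realify (z *m X L).
have vz : hform (cplx v) z = 0 by rewrite realifyK; exact: (flift_horizontal oO OL sX).
have sYZ : csmooth (cone O) (fun w => - hform (flift Y w) (flift Z w)).
  by apply: csmoothN => //; apply: csmooth_hform => //; [case: sY|case: sZ].
have [sq dq] := cder_cone_quotient (q := fun w => - hform (flift Y w) (flift Z w) *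
  (hform (cplx w) (cplx w))^-1) oO fH Of vz sYZ (fun w _ => erefl).
have -> : vderiv X (fun L' => gCH L' (Y L') (Z L')) L =
    Re (cder v (fun w => - hform (flift Y w) (flift Z w) *
      (hform (cplx w) (cplx w))^-1) (realify z)).
  apply: near_eq_derive; apply: (open_near oD Of) => w Ow.
  rewrite gCH_cone; last exact: cone_negative oO Ow.
  have -> : hform (cplx w) (cplx w) = (cform (cplx w) (cplx w))%:C := hform_real _.
  rewrite mulNr ReN ReM /= -/(flift Y w) -/(flift Z w).
  set t := cform (cplx w) (cplx w).
  rewrite /cform -/(flift Y w) -/(flift Z w) mul0r oppr0 mulr0 subr0 expr0n addr0.
  have t0 : t != 0 by rewrite lt_eqF//; exact: cone_negative oO Ow.
  rewrite invrN mulrN; congr (- (_ * _)).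
  by rewrite expr2 invfM mulrA mulfV// mul1r.
have sH : csmooth (cone O) (fun w => hform (flift Y w) (flift Z w)).
  by apply: csmooth_hform => //; [case: sY|case: sZ].
have dN : cder v (fun w => - hform (flift Y w) (flift Z w)) (realify z) =
    - cder v (fun w => hform (flift Y w) (flift Z w)) (realify z).
  have m1 := csmooth_cst (cone O) (-1 : R[i]).
  have := cderM Of v m1 sH; rewrite cder_cst mul0r add0r mulN1r => <-.
  by apply: (cder_eq _ oD Of) => w _; rewrite mulN1r.
have vY : vsmooth (cone O) (flift Y) := proj2 sY.
have vZ : vsmooth (cone O) (flift Z) := proj2 sZ.
rewrite dq dN opprK (cder_hform oD Of v vY vZ) ReD.
have eY := flift_fibre Y oO OL; have eZ := flift_fibre Z oO OL.
rewrite -/z in eY eZ; rewrite eY eZ.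
have Yz := flift_horizontal oO OL sY; have Zz := flift_horizontal oO OL sZ.
rewrite /gCH -/z /Dconn -/z (dhopf_lift _ fH) (dhopf_lift _ fH) /cform.
rewrite hformDl hformDr hformZl hformZr.
by rewrite Yz -(hform_conj _ z) Zz conjc0 !mulr0 !addr0.
Qed.

(** Multiplication by [c] preserves every line. *)
Lemma homogeneous_derive k z u (c : R[i]) : c != 0 ->
  'D_(realify (c *: u)) (fun w => k <[cplx w]>%VS) (realify (c *: z)) =
  'D_(realify u) (fun w => k <[cplx w]>%VS) (realify z).
Proof.
move=> c0; pose K := fun w : VR => k <[cplx w]>%VS.
have E : (fun h : R => h^-1 *: ((K \o shift (realify (c *: z))) (h *: realify (c *: u)) -
      K (realify (c *: z)))) =
    (fun h : R => h^-1 *: ((K \o shift (realify z)) (h *: realify u) - K (realify z))).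
  apply/funext => h; rewrite /K /= -!realifyZ -!realifyD !realifyK.
  by rewrite scalerA [_ * c]mulrC -scalerA -scalerDr !vline_scale.
by rewrite /derive E.
Qed.

Lemma vderiv_cone O Y k w : openCH O -> cone O w ->
  vderiv Y k <[cplx w]>%VS = 'D_(realify (flift Y w)) (fun w => k <[cplx w]>%VS) w.
Proof.
move=> oO Ow; have [fH fL Of] := cone_fibre oO Ow.
set z := fibre _ in fH fL Of *.
have [c c0 wE] := vline_eq (Hsphere_neq0 fH) fL.
have e : flift Y w = c *: (z *m Y <[cplx w]>%VS) by rewrite /flift {1}wE scalemxAl.
rewrite e /vderiv -/z -(homogeneous_derive k z (z *m Y <[cplx w]>%VS) c0).
by rewrite -[c *: z]wE cplxK.
Qed.

Lemma vderiv2 O X Y k L : openCH O -> O L -> smooth_fun O k -> smooth_field O Y ->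
  vderiv X (vderiv Y k) L =
  'D_(realify (vder (realify (fibre L *m X L)) (flift Y) (realify (fibre L))))
    (fun w : VR => k <[cplx w]>%VS) (realify (fibre L)) +
  'D_(realify (fibre L *m X L))
    (fun w => 'D_(realify (fibre L *m Y L)) (fun w : VR => k <[cplx w]>%VS) w)
    (realify (fibre L)).
Proof.
move=> oO OL sk sY; have oD := cone_open oO; have [fH fL Of] := cone_fibre oO OL.
rewrite {1}/vderiv.
have E : \forall w \near realify (fibre L), vderiv Y k <[cplx w]>%VS =
    'D_(realify (flift Y w)) (fun w => k <[cplx w]>%VS) w.
  by apply: (open_near oD Of) => w Ow; exact: vderiv_cone oO Ow.
rewrite (near_eq_derive _ E).
have dY : differentiable (fun w => realify (flift Y w)) (realify (fibre L)).
  exact: (smooth_diff (proj2 sY) Of).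
have F := derive_along (VR_coordinates (n := n)) (realify (fibre L *m X L)) oD Of (sk 2%N) dY.
have eq1 : 'D_(realify (fibre L *m X L)) (fun w => realify (flift Y w)) (realify (fibre L)) =
    realify (vder (realify (fibre L *m X L)) (flift Y) (realify (fibre L))).
  by rewrite vder.unlock cplxK.
by rewrite eq1 (flift_fibre Y oO OL) in F.
Qed.

Lemma smooth_fun_diff O k L : openCH O -> O L -> smooth_fun O k ->
  differentiable (fun w : VR => k <[cplx w]>%VS) (realify (fibre L)).
Proof.
by move=> oO OL sk; have [_ _ Of] := cone_fibre oO OL; exact: (smooth_diff sk Of).
Qed.

(** The function is constant along each line. *)
Lemma vertical_derive k z (m : R[i]) :
  'D_(realify (m *: z)) (fun w => k <[cplx w]>%VS) (realify z) = 0.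
Proof.
have N : \forall h \near (0 : R), 1 + h%:C * m != 0.
  have r0 : 0 < `|Re m| + 1 by rewrite ltr_wpDl.
  have : \forall h \near (0 : R), `|h| < (`|Re m| + 1)^-1.
    by apply: nbhs0_lt; rewrite invr_gt0.
  apply: filterS => h hm; apply/eqP => /(congr1 Re); rewrite ReD ReM /= mul0r subr0.
  move=> /eqP; rewrite addrC addr_eq0 => /eqP e.
  move: hm; rewrite -(ltr_pM2r r0) mulVf ?gt_eqF// mulrDr -normrM e normrN normr1 mulr1.
  by rewrite gtrDl ltNge normr_ge0.
have K0 : \forall h \near (0 : R)^', h^-1 *: (k <[cplx (h *: realify (m *: z) + realify z)%R]>%VS -
    k <[cplx (realify z)]>%VS) = 0.
  have N' : \forall h \near (0 : R)^', 1 + h%:C * m != 0 by apply: nbhs_dnbhs.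
  apply: filterS N' => h hm.
  have e : h%:C *: (m *: z) + z = (1 + h%:C * m) *: z.
    by rewrite scalerDl scale1r scalerA addrC.
  by rewrite -realifyZ -realifyD !realifyK e vline_scale// subrr scaler0.
apply: cvg_lim => //; apply: cvg_near_cst.
by apply: filterS K0 => h /= ->.
Qed.

(** The mixed second derivatives of [k] cancel by Schwarz's theorem, and the
    vertical parts of the derivatives of the lifts do not act on functions of
    the line. *)
Lemma torsion_Dconn O X Y k L : openCH O -> O L -> smooth_fun O k ->
  smooth_field O X -> smooth_field O Y ->
  vderiv X (vderiv Y k) L - vderiv Y (vderiv X k) L =
  'D_(realify (fibre L *m (Dconn X Y L - Dconn Y X L))) (fun w : VR => k <[cplx w]>%VS)
    (realify (fibre L)).
Proof.
move=> oO OL sk sX sY; have oD := cone_open oO; have [fH fL Of] := cone_fibre oO OL.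
have dK := smooth_fun_diff oO OL sk.
set z := fibre L in fH fL Of dK *.
pose dk (u : V) : R := 'D_(realify u) (fun w : VR => k <[cplx w]>%VS) (realify z).
have dkD s t : dk (s + t) = dk s + dk t by rewrite /dk realifyD !deriveE// linearD.
have dkN s : dk (- s) = - dk s.
  have -> : - s = (-1 : R)%:C *: s by rewrite rmorphN rmorph1 scaleN1r.
  by rewrite /dk realifyZ !deriveE// linearZ /= scaleN1r.
have cancel_mixed (p q r r' c d : R) : c = p + r -> d = q + r' -> r = r' -> c - d = p - q.
  by move=> -> -> ->; rewrite opprD addrACA subrr addr0.
have C := esym (derive_comm (realify (z *m X L)) (realify (z *m Y L)) oD Of (sk 2%N)).
apply: etrans (cancel_mixed _ _ _ _ _ _ (vderiv2 X oO OL sk sY) (vderiv2 Y oO OL sk sX) C) _.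
set d1 := vder (realify (z *m X L)) (flift Y) (realify z).
set d2 := vder (realify (z *m Y L)) (flift X) (realify z).
have e : z *m (Dconn X Y L - Dconn Y X L) = d1 + hform d1 z *: z - (d2 + hform d2 z *: z) :=
  etrans (mulmxBr _ _ _) (congr2 (fun s t => s - t) (dhopf_lift d1 fH) (dhopf_lift d2 fH)).
apply: etrans _ (esym (congr1 dk e)); rewrite -[LHS]/(dk d1 - dk d2).
move: d1 d2 {e} => d1 d2.
have dkv m : dk (m *: z) = 0 by exact: vertical_derive.
clearbody dk.
by rewrite opprD addrACA -scaleNr -scalerDl dkD dkv addr0 dkD dkN.
Qed.

(** Real parts of entries of the orthogonal projector on the line: smooth
    functions whose derivatives separate tangent vectors. *)
Definition test_fun z u L : R :=
  Re (hform (fibre L) z * hform u (fibre L) * (hform (fibre L) (fibre L))^-1).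

Lemma test_fun_cone O z u w : openCH O -> cone O w -> test_fun z u <[cplx w]>%VS =
  Re (hform (cplx w) z * hform u (cplx w) * (hform (cplx w) (cplx w))^-1).
Proof.
move=> oO Ow; have [fH fL Of] := cone_fibre oO Ow.
rewrite /test_fun; set x := fibre _ in fH fL Of *.
have [c c0 wE] := vline_eq (Hsphere_neq0 fH) fL.
rewrite wE !hformZl !hformZr; congr Re.
have cc0 : conjc c != 0 by rewrite conjc_eq0.
have h0 : hform x x != 0 by rewrite hform_Hsphere// oppr_eq0 oner_eq0.
by field; rewrite h0 cc0 c0.
Qed.

Lemma smooth_test_fun O z u : openCH O -> smooth_fun O (test_fun z u) /\
  forall L, O L -> z = fibre L -> forall e, hform e z = 0 ->
    'D_(realify e) (fun w : VR => test_fun z u <[cplx w]>%VS) (realify z) = Re (hform u e).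
Proof.
move=> oO; have oD := cone_open oO.
pose c := fun w : VR => hform (cplx w) z * hform u (cplx w).
have sI := vsmooth_cplx oD; have sz := vsmooth_cst (cone O) z.
have su := vsmooth_cst (cone O) u.
have s1 := csmooth_hform oD sI sz; have s2 := csmooth_hform oD su sI.
have sc : csmooth (cone O) c by exact: (csmoothM oD s1 s2).
have sh := csmooth_hform oD sI sI.
have sq := csmoothM oD sc (csmoothV oD (fun w => @cone_hform_neq0 O w oO) sh).
split=> [m|L OL zL e ez].
  by apply: Ck_eq oD _ (sq.1 m) => w Ow; rewrite (test_fun_cone _ _ oO Ow).
have [fH fL Of] := cone_fibre oO OL; rewrite -zL in fH fL Of.
have ez' : hform (cplx (realify e)) z = 0 by rewrite realifyK.
have [_ dq] := cder_cone_quotient oO fH Of ez' sc (fun w _ => erefl).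
have -> : 'D_(realify e) (fun w : VR => test_fun z u <[cplx w]>%VS) (realify z) =
   Re (cder (realify e) (fun w => c w * (hform (cplx w) (cplx w))^-1) (realify z)).
  apply: near_eq_derive; apply: (open_near oD Of) => w Ow.
  exact: (test_fun_cone _ _ oO Ow).
rewrite dq (cderM Of _ s1 s2) (cder_hform oD Of _ sI sz) (cder_hform oD Of _ su sI).
have vc (x : V) : vder (realify e) (fun=> x) (realify z) = 0.
  by rewrite vder.unlock derive_cst; apply/rowP => j; rewrite !mxE.
rewrite !vc vder_cplx !realifyK ez hform0r hform0l (hform_Hsphere fH).
by rewrite addr0 mul0r !add0r mulN1r opprK.
Qed.

(** The projections to the lines of the linear fields [z *m B]: smooth vector
    fields with arbitrary value at a given line. *)
Definition projected_field (B : MM) L : MM := dhopf (fibre L) (fibre L *m B).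

Lemma projected_field_cone O B w : openCH O -> cone O w ->
  flift (projected_field B) w =
  cplx w *m B - (hform (cplx w *m B) (cplx w) * (hform (cplx w) (cplx w))^-1) *: cplx w.
Proof.
move=> oO Ow; have [fH fL Of] := cone_fibre oO Ow.
rewrite /flift /projected_field; set x := fibre _ in fH fL Of *.
have [c c0 wE] := vline_eq (Hsphere_neq0 fH) fL.
have cc0 : conjc c != 0 by rewrite conjc_eq0.
rewrite [X in X *m _ = _]wE wE -!scalemxAl dhopf_lift// !hformZl !hformZr hform_Hsphere//.
rewrite scalerDr; congr (_ + _); rewrite -scaleNr !scalerA; congr (_ *: _).
by field; rewrite cc0 c0.
Qed.

Lemma smooth_projected_field O B : openCH O -> smooth_field O (projected_field B).
Proof.
move=> oO; have oD := cone_open oO; split=> [L OL|].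
  have [fH fL _] := cone_fibre oO OL.
  by rewrite -{1}fL; exact: tangent_dhopf.
have sI := vsmooth_cplx oD.
have sB := vsmooth_mulmx oD B sI.
have sc := csmoothM oD (csmooth_hform oD sB sI)
  (csmoothV oD (fun w => @cone_hform_neq0 O w oO) (csmooth_hform oD sI sI)).
have H := vsmoothD oD sB (vsmoothZ oD (csmoothN oD sc) sI).
apply: vsmooth_eq oD _ H => w Ow.
apply: etrans _ (esym (projected_field_cone B oO Ow)).
by rewrite scaleNr.
Qed.

Lemma projected_fieldE O L B : openCH O -> O L -> tangentCH L B ->
  projected_field B L = B.
Proof.
move=> oO OL tB; have [fH fL _] := cone_fibre oO OL.
by rewrite /projected_field -tangentCHE// fL.
Qed.

Lemma smooth_fun_cst O (r : R) : smooth_fun O (fun=> r).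
Proof. by move=> m; exact: Ck_cst. Qed.

Lemma derive_realify_eq (K : VR -> R) (z e s t : V) :
  differentiable K (realify z) -> e = s - t ->
  'D_(realify s) K (realify z) = 'D_(realify t) K (realify z) ->
  'D_(realify e) K (realify z) = 0.
Proof.
move=> dK -> st; have -> : realify (s - t) = realify s - realify t.
  have -> : - t = (-1 : R)%:C *: t by rewrite rmorphN rmorph1 scaleN1r.
  by rewrite realifyD realifyZ scaleN1r.
by move: st; rewrite !deriveE// linearB => ->; rewrite subrr.
Qed.

Lemma gCH_skew L (N D Y N' D' Z : MM) :
  gCH L D Z + gCH L Y D' = gCH L N Z + gCH L Y N' ->
  gCH L (N - D) Z = - gCH L (N' - D') Y.
Proof.
have gB (A B C : MM) : gCH L (A - B) C = gCH L A C - gCH L B C.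
  by rewrite /gCH mulmxBr /cform hformDl hformNl ReD ReN.
by rewrite !gB !(gCHC _ Y); lra.
Qed.

Lemma subr_exchange (U : zmodType) (a b c d : U) : a - b - (c - d) = 0 -> a - c = b - d.
Proof.
move=> h; apply/eqP; rewrite -subr_eq0 -[X in _ == X]h !opprB.
by rewrite addrACA [- c + _]addrC -addrACA.
Qed.

(** The difference of [nabla] and [Dconn] is symmetric in its first two
    arguments because both are torsion free, and contracted with the metric it
    is antisymmetric in the last two because both are metric. Such a trilinear
    expression vanishes. *)
Lemma levi_civitaE nabla O X Y L : levi_civita nabla -> openCH O -> O L ->
  smooth_field O X -> smooth_field O Y -> nabla X Y L = Dconn X Y L.
Proof.
move=> lc oO OL; have [fH fL Of] := cone_fibre oO OL.
have zc := @smooth_fun_cst O 0.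
have tn X1 Y1 : smooth_field O X1 -> smooth_field O Y1 -> tangentCH L (nabla X1 Y1 L).
  by move=> s1 s2; have [[t _] _] := lc O X1 Y1 Y1 _ oO s1 s2 s2 zc; exact: t.
have td X1 Y1 : tangentCH L (Dconn X1 Y1 L) by exact: Dconn_tangent oO OL.
have sym X1 Y1 : smooth_field O X1 -> smooth_field O Y1 ->
    nabla X1 Y1 L - Dconn X1 Y1 L = nabla Y1 X1 L - Dconn Y1 X1 L.
  move=> s1 s2; set E := nabla X1 Y1 L - nabla Y1 X1 L - (Dconn X1 Y1 L - Dconn Y1 X1 L).
  have tE : tangentCH L E by apply: tangentCHB; apply: tangentCHB; auto.
  have E0 : E = 0.
    apply: (tangent_inj fH); rewrite ?fL//; first exact: tangentCH0.
    rewrite mulmx0; apply: cform_nondeg => u; rewrite cformC.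
    have [sk dk] := smooth_test_fun (fibre L) u oO.
    have [_ /(_ L OL)[_ _ _ _ tor]] := lc O X1 Y1 Y1 _ oO s1 s2 s2 sk.
    have hE : hform (fibre L *m E) (fibre L) = 0.
      by apply: tangent_horizontal; rewrite fL.
    rewrite -[LHS](dk L OL erefl _ hE).
    have tor' := etrans tor (torsion_Dconn oO OL sk s1 s2).
    have dK := smooth_fun_diff oO OL sk.
    exact: (derive_realify_eq dK (mulmxBr _ _ _) tor').
  exact: subr_exchange E0.
have anti X1 Y1 Z1 : smooth_field O X1 -> smooth_field O Y1 -> smooth_field O Z1 ->
    gCH L (nabla X1 Y1 L - Dconn X1 Y1 L) (Z1 L) =
    - gCH L (nabla X1 Z1 L - Dconn X1 Z1 L) (Y1 L).
  move=> s1 s2 s3.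
  have [_ /(_ L OL)[_ _ _ met _]] := lc O X1 Y1 Z1 _ oO s1 s2 s3 zc.
  exact: gCH_skew (etrans (esym (metric_Dconn oO OL s1 s2 s3)) met).
move=> sX sY; apply/eqP; rewrite -subr_eq0; apply/eqP.
apply: (gCH_nondeg fH); rewrite fL; first by apply: tangentCHB; auto.
move=> T tT; pose Z := projected_field T.
have sZ : smooth_field O Z by exact: smooth_projected_field.
have ZL : Z L = T by exact: (projected_fieldE oO OL tT).
rewrite -ZL.
have e1 := anti X Y Z sX sY sZ.
have e2 := anti Z X Y sZ sX sY.
have e3 := anti Y Z X sY sZ sX.
(* the difference equals its opposite after three exchanges of arguments *)
rewrite (sym X Z)// in e1; rewrite (sym Z Y)// in e2; rewrite (sym Y X)// in e3.
lra.
Qed.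

End LeviCivita.

(** * The Poincare lemma for one-forms *)

Section Poincare.
Context {R : realType} {V : normedModType R}.
Variable cV : coordinates V.
Local Notation I := (cidx cV).
Local Notation co i := (coor (c := cV) i).
Local Notation mu := (@lebesgue_measure R).

Variables (om : I -> V -> R) (x0 : V) (r M : R).
Hypothesis om_diff : forall i x, ball x0 r x -> differentiable (om i) x.
Hypothesis dom_cont : forall (i j : I) x, ball x0 r x -> {for x, continuous ('D_(cvec (c := cV) j) (om i))}.
Hypothesis om_ub : forall i x, ball x0 r x -> `|om i x| <= M.
Hypothesis dom_ub : forall (i j : I) x, ball x0 r x -> `|'D_(cvec (c := cV) j) (om i) x| <= M.
Hypothesis closed_form : forall (i j : I) x, ball x0 r x ->
  'D_(cvec (c := cV) j) (om i) x = 'D_(cvec (c := cV) i) (om j) x.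

Let form (v x : V) : R := \sum_i co i v * om i x.

Definition primitive (x : V) : R :=
  \int[mu]_(t in `[0, 1]) form (x - x0) (x0 + t *: (x - x0)).

Lemma segment_ball (y : V) (t : R) : ball x0 r (x0 + y) -> 0 <= t <= 1 ->
  ball x0 r (x0 + t *: y).
Proof.
rewrite -!ball_normE /ball_ /= !opprD !addNKr !normrN normrZ => yr /andP[t0 t1].
by apply: le_lt_trans yr; rewrite ger0_norm// ler_piMl.
Qed.

Lemma is_derive_sumf (J : Type) (s : seq J) (f : J -> R -> R) (df : J -> R) (x : R) :
  (forall j, is_derive x (1 : R) (f j) (df j)) ->
  is_derive x (1 : R) (fun t => \sum_(j <- s) f j t) (\sum_(j <- s) df j).
Proof.
move=> dfj; elim: s => [|j s IH].
  rewrite big_nil; have -> : (fun t => \sum_(j <- [::]) f j t) = cst 0.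
    by apply/funext => t; rewrite big_nil.
  exact: is_derive_cst.
rewrite big_cons; have -> : (fun t => \sum_(j <- j :: s) f j t) =
    f j + (fun t => \sum_(j <- s) f j t).
  by apply/funext => t; rewrite big_cons.
exact: is_deriveD.
Qed.

Lemma cont_sumf (J : Type) (s : seq J) (f : J -> R -> R) (x : R) :
  (forall j, {for x, continuous (f j)}) ->
  {for x, continuous (fun t => \sum_(j <- s) f j t)}.
Proof.
move=> cf; elim: s => [|j s IH].
  have -> : (fun t => \sum_(j <- [::]) f j t) = cst 0.
    by apply/funext => t; rewrite big_nil.
  exact: cst_continuous.
have -> : (fun t => \sum_(j <- j :: s) f j t) = f j \+ (fun t => \sum_(j <- s) f j t).
  by apply/funext => t; rewrite big_cons.
exact: continuousD.
Qed.

Lemma is_derive_mulf (f g : R -> R) (x df dg : R) :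
  is_derive x (1 : R) f df -> is_derive x (1 : R) g dg ->
  is_derive x (1 : R) (fun t => f t * g t) (f x * dg + g x * df).
Proof. by move=> ? ?; exact: is_deriveM. Qed.

Lemma is_derive_affine (a b x : R) : is_derive x (1 : R) (fun t => a + t * b) b.
Proof.
have h : derivable (id : R -> R) (a + x *: b) b by exact: derivable_id.
have := is_derive_line h.
by rewrite derive_id.
Qed.

Lemma dir_form i x (v : V) : ball x0 r x ->
  'D_v (om i) x = \sum_j co j v * 'D_(cvec (c := cV) j) (om i) x.
Proof. by move=> xr; rewrite (derive_coords cV v)//; exact: om_diff. Qed.

Section Direction.
Variables (x v : V) (e : R).
Let y := x - x0.
Hypothesis e0 : 0 < e.
Hypothesis xv : forall s : R, s \in `]-e, e[ -> ball x0 r (x0 + (y + s *: v)).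

Let f (s t : R) : R := form (y + s *: v) (x0 + t *: (y + s *: v)).
Let df (s t : R) : R := \sum_i (co i (y + s *: v) * 'D_(t *: v) (om i) (x0 + t *: (y + s *: v))
    + om i (x0 + t *: (y + s *: v)) * co i v).

Lemma f_point (s t : R) : s \in `]-e, e[ -> t \in `[0, 1] -> ball x0 r (x0 + t *: (y + s *: v)).
Proof.
move=> se; rewrite in_itv /= => t01; apply: segment_ball t01; exact: xv.
Qed.

Lemma is_derive_f (s t : R) : s \in `]-e, e[ -> t \in `[0, 1] ->
  is_derive s (1 : R) (f ^~ t) (df s t).
Proof.
move=> se t01; have pt := f_point se t01; apply: is_derive_sumf => i.
apply: is_derive_mulf.
  have -> : (fun s => co i (y + s *: v)) = (fun s => co i y + s * co i v).
    by apply/funext => u; rewrite linearD linearZ.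
  exact: is_derive_affine.
have E u : x0 + t *: (y + u *: v) = (x0 + t *: y) + u *: (t *: v).
  by rewrite scalerDr addrA !scalerA mulrC.
have -> : (fun s => om i (x0 + t *: (y + s *: v))) = (fun s => om i ((x0 + t *: y) + s *: (t *: v))).
  by apply/funext => u; rewrite E.
rewrite E; apply: is_derive_line; apply: diff_derivable; rewrite -E.
exact: om_diff.
Qed.

Lemma f_continuous (s : R) : s \in `]-e, e[ -> {within `[0, 1], continuous (f s)}.
Proof.
move=> se; apply: derivable_within_continuous => t t01.
have pt := f_point se t01.
have H : is_derive t (1 : R) (f s) (\sum_i (co i (y + s *: v) *
    'D_(y + s *: v) (om i) (x0 + t *: (y + s *: v)) +
    om i (x0 + t *: (y + s *: v)) * 0)).
  apply: is_derive_sumf => i; apply: is_derive_mulf.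
  by apply: is_derive_line; apply: diff_derivable; exact: om_diff.
by case: H.
Qed.

(** The domination that allows differentiating the primitive under the integral
    sign. *)
Lemma df_bound : exists2 C : R, 0 <= C & forall s t : R, s \in `]-e, e[ -> t \in `[0, 1] ->
  `|df s t| <= C.
Proof.
have M0 (i : I) : 0 <= M.
  have z : (0 : R) \in `]-e, e[ by rewrite in_itv /= oppr_lt0 e0.
  have z' : (0 : R) \in `[0, 1] by rewrite in_itv /= lexx ler01.
  exact: (le_trans (normr_ge0 _) (om_ub i (f_point z z'))).
have b0 (i : I) : exists k : R, 0 <= k /\ forall s : R, s \in `]-e, e[ -> `|co i (y + s *: v)| <= k.
  exists (`|co i y| + e * `|co i v|); split; first by rewrite addr_ge0// mulr_ge0// ltW.
  move=> s; rewrite in_itv /= => /andP[s1 s2]; rewrite linearD linearZ /=.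
  apply: le_trans (ler_normD _ _) _; rewrite lerD2l normrM ler_wpM2r//.
  by rewrite ler_norml (ltW s1) (ltW s2).
have [k kk] := choice b0; have k0 i := (kk i).1; have kb i := (kk i).2.
exists (\sum_i (k i * (\sum_j `|co j v| * M) + M * `|co i v|)).
  apply: sumr_ge0 => i _; rewrite addr_ge0// mulr_ge0// ?(M0 i)// sumr_ge0// => j _.
  by rewrite mulr_ge0// (M0 i).
move=> s t se t01; have pt := f_point se t01.
apply: le_trans (ler_norm_sum _ _ _) _; apply: ler_sum => i _.
apply: le_trans (ler_normD _ _) _; rewrite !normrM; apply: lerD; last first.
  by rewrite ler_wpM2r// om_ub.
apply: ler_pM => //; first exact: kb.
rewrite dir_form//; apply: le_trans (ler_norm_sum _ _ _) _; apply: ler_sum => j _.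
rewrite normrM linearZ /= normrM; apply: ler_pM => //; last exact: dom_ub.
rewrite in_itv /= in t01; case/andP: t01 => t0 t1.
by rewrite ler_piMl// ger0_norm.
Qed.

(** Closedness turns the derivative of the integrand in direction [v] into a
    total derivative along the segment. *)
Lemma is_derive_target (t : R) : t \in `[0, 1] ->
  is_derive t (1 : R) (fun t => t * form v (x0 + t *: y)) (df 0 t).
Proof.
move=> t01; have z : (0 : R) \in `]-e, e[ by rewrite in_itv /= oppr_lt0 e0.
have := f_point z t01; rewrite scale0r addr0 => pt.
have H : is_derive t (1 : R) (fun t => form v (x0 + t *: y))
    (\sum_i (co i v * 'D_y (om i) (x0 + t *: y) + om i (x0 + t *: y) * 0)).
  apply: is_derive_sumf => i; apply: is_derive_mulf.
  by apply: is_derive_line; apply: diff_derivable; exact: om_diff.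
have hid : is_derive t (1 : R) (fun t : R => t) 1 by exact: is_derive_id.
have H2 := is_derive_mulf hid H.
apply: (is_derive_eq H2).
rewrite /df scale0r addr0 [RHS]big_split /=.
have -> : \sum_i (co i v * 'D_y (om i) (x0 + t *: y) + om i (x0 + t *: y) * 0) =
    \sum_i co i y * 'D_v (om i) (x0 + t *: y).
  transitivity (\sum_i \sum_j co i v * (co j y * 'D_(cvec (c := cV) j) (om i) (x0 + t *: y))).
    by apply: eq_bigr => i _; rewrite mulr0 addr0 dir_form// mulr_sumr.
  rewrite exchange_big /=; apply: eq_bigr => j _; rewrite dir_form// mulr_sumr.
  by apply: eq_bigr => i _; rewrite closed_form// mulrCA.
have -> : \sum_i co i y * 'D_(t *: v) (om i) (x0 + t *: y) =
    t * \sum_i co i y * 'D_v (om i) (x0 + t *: y).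
  rewrite mulr_sumr; apply: eq_bigr => i _.
  rewrite deriveE; last exact: om_diff.
  rewrite linearZ /= -deriveE; last exact: om_diff.
  exact: mulrCA.
congr (_ + _); rewrite mulr1 /form; apply: eq_bigr => i _; exact: mulrC.
Qed.

Lemma df_continuous : {within `[0, 1], continuous (df 0)}.
Proof.
apply: continuous_in_subspaceT => t /[!inE] t01.
have z : (0 : R) \in `]-e, e[ by rewrite in_itv /= oppr_lt0 e0.
have := f_point z t01; rewrite scale0r addr0 => pt.
have cp : {for t, continuous (fun t : R => x0 + t *: y)}.
  by apply: continuousD; [exact: cst_continuous|exact: scalel_continuous].
have N1 : \forall u \near t, ball x0 r (x0 + u *: y).
  by apply: cp; apply: open_nbhs_nbhs; split => //; exact: ball_open.
pose g (u : R) := \sum_i (co i y * (u * \sum_j co j v * 'D_(cvec (c := cV) j) (om i) (x0 + u *: y))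
    + om i (x0 + u *: y) * co i v).
have E : \forall u \near t, g u = df 0 u.
  apply: filterS N1 => u ur; rewrite /g /df scale0r addr0; apply: eq_bigr => i _.
  rewrite -dir_form// deriveE; last exact: om_diff.
  by rewrite [X in _ = _ * X + _]deriveE ?linearZ//; exact: om_diff.
have cg : {for t, continuous g}.
  apply: cont_sumf => i; apply: continuousD; apply: continuousM; try exact: cst_continuous.
    apply: continuousM; first exact: cvg_id.
    apply: cont_sumf => j; apply: continuousM; first exact: cst_continuous.
    exact: (@continuous_comp _ _ _ (fun u : R => x0 + u *: y) ('D_(cvec (c := cV) j) (om i)) t cp (dom_cont pt)).
  have c1 : {for x0 + t *: y, continuous (om i)}.
    by apply: differentiable_continuous; exact: om_diff.
  exact: (continuous_comp cp c1).
rewrite /continuous_at -(nbhs_singleton E); apply: cvg_trans cg.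
by apply: near_eq_cvg; exact: E.
Qed.

(** Differentiation under the integral sign gives the integral of a total
    derivative, computed by the fundamental theorem of calculus. *)
Lemma is_derive_primitive : is_derive x v primitive (form v x).
Proof.
have z : (0 : R) \in `]-e, e[ by rewrite in_itv /= oppr_lt0 e0.
have [C C0 Cb] := df_bound.
have dfE s t : s \in `]-e, e[ -> t \in `[0, 1] -> partial1of2 f s t = df s t.
  by move=> se t01; have := is_derive_f se t01 => -[_ <-]; rewrite partial1of2E.
have cint (g : R -> R) : {within `[0, 1], continuous g} -> mu.-integrable `[0, 1] (EFin \o g).
  by move=> cg; apply: continuous_compact_integrable => //; exact: segment_compact.
have in01 (t : R) : `[0, 1]%classic t -> t \in `[0, 1] by move=> t01; rewrite in_itv.
have ine (s : R) : `]- e, e[%classic s -> s \in `]-e, e[ by move=> se; rewrite in_itv.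
have L : h^-1 *: (\int[mu]_(t in `[0, 1]) f (h + 0) t - \int[mu]_(t in `[0, 1]) f 0 t) @[h --> 0^']
    --> \int[mu]_(t in `[0, 1]) partial1of2 f 0 t.
  apply: (@cvg_differentiation_under_integral R _ _ mu f `[0, 1] _ 0 (- e) e _ _ _ (fun=> C)).
  - exact: measurable_itv.
  - by move: z; rewrite in_itv.
  - by move=> s /ine se; apply: cint; exact: f_continuous.
  - by move=> s t /ine se /in01 t01; have [] := is_derive_f se t01.
  - by [].
  - by apply: cint; apply: continuous_subspaceT => u; exact: cst_continuous.
  - by move=> s t /ine se /in01 t01; rewrite dfE//; exact: Cb.
have FTC : \int[mu]_(t in `[0, 1]) partial1of2 f 0 t = form v x.
  pose F (t : R) := t * form v (x0 + t *: y).
  have dF (t : R) : t \in `[0, 1] -> is_derive t (1 : R) F (df 0 t) by exact: is_derive_target.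
  have cF (t : R) : t \in `[0, 1] -> {for t, continuous F}.
    move=> t01; apply: differentiable_continuous; apply/derivable1_diffP.
    by case: (dF t t01).
  have oc (t : R) : t \in `]0, 1[ -> t \in `[0, 1] by exact: subset_itv_oo_cc.
  have F01 : derivable_oo_LRcontinuous F 0 1.
    split.
    - by move=> t /oc t01; case: (dF t t01).
    - by apply: cvg_at_right_filter; apply: cF; rewrite in_itv /= lexx ler01.
    - by apply: cvg_at_left_filter; apply: cF; rewrite in_itv /= lexx ler01.
  have dFE : {in `]0, 1[, derive1 F =1 df 0}.
    by move=> t /oc t01; rewrite derive1E; case: (dF t t01).
  have E := continuous_FTC2 ltr01 df_continuous F01 dFE.
  transitivity (\int[mu]_(t in `[0, 1]) df 0 t).
    by apply: eq_Rintegral => t; rewrite inE => /in01 t01; exact: dfE.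
  rewrite /Rintegral E /= /F mul0r subr0 mul1r scale1r.
  by rewrite /y addrC subrK.
rewrite FTC in L.
have Pe (h : R) : primitive (h *: v + x) = \int[mu]_(t in `[0, 1]) f (h + 0) t.
  rewrite /primitive /f addr0; have -> : h *: v + x - x0 = y + h *: v by rewrite /y [RHS]addrC addrA.
  by [].
have P0 : primitive x = \int[mu]_(t in `[0, 1]) f 0 t.
  by have := Pe 0; rewrite scale0r add0r addr0.
have L' : h^-1 *: ((primitive \o shift x) (h *: v) - primitive x) @[h --> 0^'] --> form v x.
  have -> : (fun h => h^-1 *: ((primitive \o shift x) (h *: v) - primitive x)) =
    (fun h => h^-1 *: (\int[mu]_(t in `[0, 1]) f (h + 0) t - \int[mu]_(t in `[0, 1]) f 0 t)).
    by apply/funext => h; rewrite /= Pe P0.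
  exact: L.
by apply: DeriveDef; [apply/cvg_ex; exists (form v x); exact: L'|exact: cvg_lim L'].
Qed.

End Direction.

Lemma primitiveP (x v : V) : ball x0 r x -> is_derive x v primitive (form v x).
Proof.
move=> xr; have [d d0 xd] : exists2 d, 0 < d & ball x d `<=` ball x0 r.
  have /nbhs_ballP[d d0 xd] : nbhs x (ball x0 r).
    by apply: open_nbhs_nbhs; split => //; exact: ball_open.
  by exists d.
have v0 : 0 < `|v| + 1 by rewrite ltr_wpDl.
apply: (@is_derive_primitive x v (d / (`|v| + 1))); first by rewrite divr_gt0.
move=> s; rewrite in_itv /= -ltr_norml => sd; apply: xd.
rewrite -ball_normE /ball_ /= addrA (addrC x0) subrK opprD addNKr normrN normrZ.
apply: (@le_lt_trans _ _ (`|s| * (`|v| + 1))); first by rewrite ler_wpM2l// lerDl.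
by rewrite -ltr_pdivlMr.
Qed.

End Poincare.

(** A primitive is the integral along segments from the center of a small ball.
    Continuity of the coefficients and of their derivatives at the center
    provides the bounds needed to differentiate it. *)
Lemma poincare (R : realType) (V : normedModType R) (cV : coordinates V) (D : set V)
    (om : cidx cV -> V -> R) (x0 : V) : open D -> D x0 ->
  (forall i, smooth_on D (om i)) ->
  (forall (i j : cidx cV) x, D x -> 'D_(cvec j) (om i) x = 'D_(cvec i) (om j) x) ->
  exists (B : set V) (tau : V -> R), [/\ open B, B x0, B `<=` D, smooth_on B tau &
    forall x v, B x -> 'D_v tau x = \sum_i coor i v * om i x].
Proof.
move=> oD Dx0 som cl.
have near_ub (g : V -> R) : {for x0, continuous g} ->
    \forall x \near x0, `|g x| <= `|g x0| + 1.
  move=> /cvgrPdist_le/(_ 1 ltr01); apply: filterS => x gx.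
  rewrite -[g x](subrK (g x0)); apply: le_trans (ler_normD _ _) _.
  by rewrite addrC lerD2l distrC.
have term_le (J : finType) (g : J -> R) : (forall j, 0 <= g j) -> forall j, g j <= \sum_j g j.
  by move=> g0 j; rewrite (bigD1 j)//= lerDl sumr_ge0.
pose M0 (i : cidx cV) := `|om i x0| + 1.
pose M1 (i j : cidx cV) := `|'D_(cvec j) (om i) x0| + 1.
have M0p i : 0 <= M0 i by rewrite addr_ge0.
have M1p i j : 0 <= M1 i j by rewrite addr_ge0.
pose M := \sum_i M0 i + \sum_i \sum_j M1 i j.
have leM0 i : M0 i <= M.
  apply: le_trans (term_le _ _ M0p i) _; rewrite lerDl sumr_ge0// => k _.
  by rewrite sumr_ge0.
have leM1 i j : M1 i j <= M.
  apply: le_trans (term_le _ _ (M1p i) j) _.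
  apply: le_trans (term_le _ (fun i => \sum_j M1 i j) _ i) _.
    by move=> k; rewrite sumr_ge0.
  by rewrite lerDr sumr_ge0.
have N1 : \forall x \near x0, forall i, `|om i x| <= M.
  apply: filter_forall => i; have := near_ub _ (som i 0%N x0 Dx0).
  by apply: filterS => x /le_trans; apply; exact: leM0.
have N2 : \forall x \near x0, forall i j, `|'D_(cvec (c := cV) j) (om i) x| <= M.
  apply: filter_forall => i; apply: filter_forall => j.
  have := near_ub _ ((som i 1%N).2 (cvec j) x0 Dx0).
  by apply: filterS => x /le_trans; apply; exact: leM1.
have [r /= r0 Hr] := (nbhs_ballP _ _).1 (filterI (open_nbhs_nbhs (conj oD Dx0)) (filterI N1 N2)).
have BD : ball x0 r `<=` D by move=> x /Hr[].
pose tau := primitive om x0.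
have dtau x v : ball x0 r x -> is_derive x v tau (\sum_i coor i v * om i x).
  apply: (@primitiveP R V cV om x0 r M) => //.
  - by move=> i x' /BD; exact: (som i 1%N).1.
  - by move=> i j x' /BD; exact: (som i 1%N).2.
  - by move=> i x' /Hr[_ []].
  - by move=> i j x' /Hr[_ []].
  - by move=> i j x' /BD; exact: cl.
have oB : open (ball x0 r) by exact: ball_open.
have diff x : ball x0 r x -> differentiable tau x.
  move=> xr; apply: (differentiable_form oB xr dtau) => i.
  exact: (som i 0%N x (BD x xr)).
have dE x v : ball x0 r x -> 'D_v tau x = \sum_i coor i v * om i x.
  by move=> xr; case: (dtau x v xr).
exists (ball x0 r), tau; split=> //; first exact: ballxx.
case=> [|k].
  by move=> x xr; exact: differentiable_continuous (diff x xr).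
split=> // v.
have H : Ck k (ball x0 r) (fun x => \sum_i coor i v * om i x).
  apply: Ck_sum => // i; apply: CkM => //; first exact: Ck_cst.
  exact: Ck_sub BD (som i k).
by apply: Ck_eq oB _ H => x xr; rewrite dE.
Qed.

(** * Horizontal lifts of Lagrangian immersions *)

Section LagrangianLift.
Context {R : realType} {n : nat} {M : manifold R n}.
Local Notation V := 'rV[R[i]]_n.+2.
Local Notation Re := (@complex.Re R).
Local Notation Im := (@complex.Im R).

Lemma scalar_coorK (w : R) : w = \sum_(i : unit) (idfun : {linear R -> R}) w *: (1 : R).
Proof.
rewrite (bigD1 tt)//= big1; last by case.
by rewrite addr0; exact: esym (mulr1 w).
Qed.

Definition scalar_coordinates : coordinates R :=
  @Coordinates R R unit (fun=> 1) (fun=> idfun) (fun _ x => cvg_id) scalar_coorK.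

Lemma csmooth_map_chart (phi : chart R n M) (U : set M) (c : M -> R[i]) :
  atlas phi -> open U -> U `<=` cdom phi ->
  csmooth (cimg phi U) (c \o cinv phi) -> csmooth_map U c.
Proof.
move=> aphi oU Uphi [s1 s2] psi apsi.
have h1 := smooth_map_chart scalar_coordinates aphi oU Uphi (F := fun q => Re (c q)) s1.
have h2 := smooth_map_chart scalar_coordinates aphi oU Uphi (F := fun q => Im (c q)) s2.
by split; [exact: h1|exact: h2].
Qed.

Lemma cder_expi (X : normedModType R) (tau : X -> R) (x v : X) : differentiable tau x ->
  cder v (fun y => expi (tau y)) x = ('D_v tau x)%:C * 'i * expi (tau x).
Proof.
move=> dt; have [_ e1] := derive_comp1 v (is_derive_cos (tau x)) dt.
have [_ e2] := derive_comp1 v (is_derive_sin (tau x)) dt.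
apply: complexP; rewrite !ReImE /=.
  by rewrite [LHS]e1; ring.
by rewrite [LHS]e2; ring.
Qed.

Lemma csmooth_expi (X : normedModType R) (D : set X) (tau : X -> R) : open D ->
  smooth_on D tau -> csmooth D (fun y => expi (tau y)).
Proof. by move=> oD st; split=> k; have [] := Ck_cos_sin oD (st k). Qed.

Lemma vder_dir (D : set 'rV[R]_n) (F : 'rV[R]_n -> V) x (v : 'rV[R]_n) :
  D x -> vsmooth D F ->
  vder v F x = \sum_i (v 0 i)%:C *: vder (delta_mx 0 i) F x.
Proof.
move=> Dx sF; have dF := smooth_diff sF Dx.
rewrite vder.unlock {1}(row_sum_delta v) derive_sum_dir//.
elim: (index_enum _) => [|i s IH]; first by rewrite !big_nil; apply/rowP => j; rewrite !mxE.
by rewrite !big_cons cplxD cplxZ IH.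
Qed.

(** The vertical parts are imaginary multiples of the point. *)
Lemma horizontal_parts_Im (z w1 w2 : V) : Hsphere z ->
  Re (hform w1 z) = 0 -> Re (hform w2 z) = 0 ->
  Im (hform (w1 + hform w1 z *: z) (w2 + hform w2 z *: z)) = Im (hform w1 w2).
Proof.
move=> zH r1 r2; rewrite hformDl !hformDr !hformZl !hformZr -(hform_conj w2 z).
rewrite hform_Hsphere//; move: r1 r2 (hform w1 w2).
by case: (hform w1 z) (hform w2 z) => [a b] [c d] /= -> -> [e g] /=; ring.
Qed.

Lemma lift_real_part (f : M -> {vspace V}) (phi : chart R n M) (U : set M) (F : M -> V) q v :
  open U -> smooth_cmap U F -> (forall q, U q -> Hsphere (F q)) ->
  atlas phi -> U q -> cdom phi q -> Re (hform (dcmap phi F q v) (F q)) = 0.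
Proof.
move=> oU sF HF aphi Uq qq.
have E := dc_hform oU aphi Uq qq v sF sF.
rewrite (dc_eq oU Uq qq v (d := fun=> -1)) ?dc_cst in E; last first.
  by move=> r Ur; rewrite (hform_Hsphere (HF r Ur)).
move/(congr1 Re): E; rewrite ReD -(hform_conj (dcmap phi F q v)) ReJ /=; lra.
Qed.

(** Multiplication by [i] maps tangent vectors to normal ones. *)
Lemma lagrangian_isotropic (f : M -> {vspace V}) (phi : chart R n M) (U : set M) (F : M -> V) q v w :
  lagrangian_immersion f -> open U -> smooth_cmap U F ->
  (forall q, U q -> Hsphere (F q) /\ <[F q]>%VS = f q) ->
  atlas phi -> U q -> cdom phi q ->
  Im (hform (dcmap phi F q v) (dcmap phi F q w)) = 0.
Proof.
move=> [_ lag] oU sF HF aphi Uq qq; have [FH FE] := HF q Uq.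
have lF : local_lift f q F by exists U.
have HF' r : U r -> Hsphere (F r) by move=> /HF[].
have [h _] := lag phi q aphi qq; have [_ /(_ w)] := h v.
have e u : F q *m dCH phi f q u = dcmap phi F q u + hform (dcmap phi F q u) (F q) *: F q :=
  etrans (congr1 (mulmx (F q)) (dCHE u aphi qq lF)) (dhopf_lift _ FH).
rewrite -FE (gCHE _ _ FH) -scalemxAr cformZi => /eqP; rewrite oppr_eq0 => /eqP g0.
have r u := lift_real_part f u oU sF HF' aphi Uq qq.
rewrite -(horizontal_parts_Im FH (r v) (r w)).
exact: etrans (esym (congr2 (fun s t => Im (hform s t)) (e v) (e w))) g0.
Qed.

(** The vertical part of the differential of a lift [F] is [i F] times a real
    one-form, up to sign. This one-form is closed because the immersion is
    Lagrangian, and multiplying [F] by the exponential of [i] times a primitive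
    makes it horizontal. *)
Lemma exists_horizontal_lift (f : M -> {vspace V}) (p : M) : lagrangian_immersion f ->
  exists (U : set M) (G : M -> V), [/\ horizontal_lift U G, U p &
    forall q, U q -> <[G q]>%VS = f q].
Proof.
move=> lag; have [[smf Qf _] _] := lag.
have [F [U0 [oU0 U0p sF HF]]] := smf p.
have [phi aphi pp] := @atlas_cover R n M p.
have HF' r : U0 r -> Hsphere (F r) by move=> /HF[].
pose D := cimg phi U0; have oD : open D by exact: open_cimg.
pose F0 := F \o cinv phi; have sF0 : vsmooth D F0 by exact: sF.
have Dp : D (cmap phi p) by exact: cimg_mem.
pose om (i : 'I_n) x := Im (hform (vder (delta_mx 0 i) F0 x) (F0 x)).
have somc i : csmooth D (fun x => hform (vder (delta_mx 0 i) F0 x) (F0 x)).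
  exact: (csmooth_hform oD (vsmooth_vder _ sF0) sF0).
have som i : smooth_on D (om i) by case: (somc i).
have iso (x v w : 'rV[R]_n) : D x -> Im (hform (vder v F0 x) (vder w F0 x)) = 0.
  move=> [q [Uq qq] <-]; rewrite -!dcmapE.
  exact: (lagrangian_isotropic _ _ lag oU0 sF HF).
have cl (i j : 'I_n) x : D x -> 'D_(delta_mx 0 j) (om i) x = 'D_(delta_mx 0 i) (om j) x.
  move=> Dx; have E i' j' : 'D_(delta_mx 0 j') (om i') x =
      Im (hform (vder (delta_mx 0 j') (vder (delta_mx 0 i') F0) x) (F0 x)).
    transitivity (Im (cder (delta_mx 0 j') (fun x => hform (vder (delta_mx 0 i') F0 x) (F0 x)) x)) => //.
    rewrite (cder_hform oD Dx _ (vsmooth_vder _ sF0) sF0) ImD.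
    by rewrite (iso x _ _ Dx) addr0.
  by rewrite !E (vder_comm _ _ oD Dx sF0).
have [B [tau [oB Bp BD stau dtau]]] :=
  poincare (cV := row_coordinates n) (om := om) oD Dp som cl.
pose U := U0 `&` cdom phi `&` (cmap phi @^-1` B).
have oU : open U.
  rewrite openE => q [[Uq qq] Bq].
  apply: filterI; first apply: filterI.
  - exact: open_nbhs_nbhs (conj oU0 Uq).
  - exact: open_nbhs_nbhs (conj (cdom_open phi) qq).
  - by apply: (cmap_cont qq); exact: open_nbhs_nbhs (conj oB Bq).
have UU0 : U `<=` U0 by move=> q [[]].
have Uphi : U `<=` cdom phi by move=> q [[]].
have UB : cimg phi U `<=` B by move=> _ [q [[_ Bq] _] <-].
pose c q := expi (tau (cmap phi q)).
have cE x : cimg phi U x -> (c \o cinv phi) x = expi (tau x).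
  by move=> [q [Uq qq] <-]; rewrite /c /= cmapK.
have oUimg : open (cimg phi U) by exact: open_cimg.
have sc : csmooth_map U c.
  apply: (csmooth_map_chart aphi oU Uphi).
  apply: csmooth_eq oUimg _ (csmooth_expi oUimg (smooth_sub UB stau)) => x Ux.
  by rewrite cE.
have sFU : smooth_cmap U F by exact: smooth_cmap_sub UU0 sF.
have cc q : c q * conjc (c q) = 1 by exact: expi_norm.
pose G q := c q *: F q.
have sG : smooth_cmap U G by exact: smooth_cmapZ.
have HG q : U q -> Hsphere (G q) /\ <[G q]>%VS = f q.
  move=> /UU0/HF[FH FE]; split.
    by rewrite /Hsphere /= /cform hformZl hformZr mulrA cc mul1r.
  rewrite vline_scale//; apply/eqP => c0.
  by have /eqP := cc q; rewrite c0 mul0r eq_sym oner_eq0.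
exists U, G; split=> //; last by move=> q /HG[].
split=> //.
  by move=> q /HG[GH GE]; split=> //; apply/(Qstar_quad GH); rewrite GE.
have horiz q v : U q -> hform (dcmap phi G q v) (G q) = 0.
  move=> Uq; have qq := Uphi q Uq; have FH := HF' q (UU0 q Uq).
  rewrite (dcmapZ oU aphi Uq qq v sc sFU).
  have Bq : B (cmap phi q) by case: Uq.
  have dq := smooth_diff stau Bq.
  have -> : dc phi c q v = ('D_v tau (cmap phi q))%:C * 'i * c q.
    rewrite -(cder_expi v dq); apply: (cder_eq _ oUimg (cimg_mem Uq qq)) => x Ux.
    by rewrite cE.
  have -> : 'D_v tau (cmap phi q) = Im (hform (dcmap phi F q v) (F q)).
    rewrite dtau// dcmapE (vder_dir v (BD _ Bq) sF0).
    have -> : F q = F0 (cmap phi q) by rewrite /F0 /= cmapK.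
    rewrite /om; elim: (index_enum _) => [|i s IH]; first by rewrite !big_nil hform0l.
    by rewrite !big_cons IH hformDl hformZl ImD ImM /= mul0r addr0.
  have re0 := lift_real_part f v oU0 sF HF' aphi (UU0 q Uq) qq.
  rewrite /G hformDl !hformZl !hformZr (hform_Hsphere FH).
  have hE : hform (dcmap phi F q v) (F q) = 0 +i* Im (hform (dcmap phi F q v) (F q)).
    by apply: complexP.
  rewrite {2}hE; move: (Im _) (c q) (cc q) => b d dd.
  transitivity ((d * conjc d) * ((0 +i* b) - b%:C * 'i)); first ring.
  by rewrite dd mul1r; apply: complexP; rewrite !ReImE /=; ring.
move=> psi q v apsi Uq qq'; have qq := Uphi q Uq.
have -> : dcmap psi G q v = dcmap phi G q (dmap psi (cmap phi) q v).
  rewrite /dcmap (dmap_change v apsi aphi qq' qq)//.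
  exact: (smooth_map_diff sG).
exact: horiz.
Qed.

End LagrangianLift.

(** * Rotating a horizontal lift into an immersion *)

Section FiniteSpectrum.
Context {R : realType}.

Lemma poly_roots_seq (p : {poly R}) : p != 0 -> exists rs : seq R, forall x, root p x -> x \in rs.
Proof.
have [m] := ubnP (size p); elim: m p => // m IH p sp p0.
have [[a ra]|nr] := pselect (exists a, root p a); last first.
  by exists [::] => x rx; case: nr; exists x.
have /factor_theorem[q pE] := ra.
have q0 : q != 0 by apply: contraNneq p0 => q0; rewrite pE q0 mul0r.
have [|rs rsP] := IH q _ q0.
  by move: sp; rewrite pE size_Mmonic ?monicXsubC// size_XsubC addn2.
exists (a :: rs) => x; rewrite pE rootM root_XsubC inE orbC => /orP[->//|/rsP->].
by rewrite orbT.
Qed.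

Lemma seq_max (s : seq R) : s != [::] -> exists2 m, m \in s & forall x, x \in s -> x <= m.
Proof.
elim: s => // a [|b s] IH _.
  by exists a; rewrite ?inE// => x; rewrite inE => /eqP->.
have [//|m ms mP] := IH.
have [am|ma] := leP a m.
  exists m; first by rewrite in_cons ms orbT.
  by move=> x; rewrite in_cons => /orP[/eqP->//|/mP].
exists a; first by rewrite in_cons eqxx.
move=> x; rewrite in_cons => /orP[/eqP->//|/mP xm].
exact: le_trans xm (ltW ma).
Qed.

Lemma spectrum_bound n (S : 'M[R]_n) :
  exists2 C : R, 0 < C & forall l, eigenvalue S l -> `|l| < C.
Proof.
have [rs rsP] := poly_roots_seq (monic_neq0 (char_poly_monic S)).
exists (1 + \sum_(x <- rs) `|x|); first by rewrite ltr_wpDr// sumr_ge0.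
move=> l; rewrite eigenvalue_root_char => /rsP lrs.
rewrite (big_rem l)//= addrCA ltrDl ltr_wpDr// sumr_ge0//.
Qed.

Lemma max_eigenvalue n (S : 'M[R]_n) l0 : eigenvalue S l0 ->
  exists2 l, eigenvalue S l & forall m, eigenvalue S m -> m <= l.
Proof.
move=> e0; have [rs rsP] := poly_roots_seq (monic_neq0 (char_poly_monic S)).
have inrs l : eigenvalue S l -> l \in [seq x <- rs | eigenvalue S x].
  by move=> el; rewrite mem_filter el rsP// -eigenvalue_root_char.
have [|l] := @seq_max [seq x <- rs | eigenvalue S x].
  by apply/eqP => e; have := inrs _ e0; rewrite e.
by rewrite mem_filter => /andP[el _] lmax; exists l => // m /inrs/lmax.
Qed.

End FiniteSpectrum.

Section Rotations.
Context {R : realType} {n : nat} {M : manifold R n}.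
Local Notation V := 'rV[R[i]]_n.+2.
Local Notation W := 'rV[R]_n.+2.
Local Notation Re := (@complex.Re R).
Local Notation Im := (@complex.Im R).

Definition real_part (z : V) : W := (realify z).1.
Definition imag_part (z : V) : W := (realify z).2.

Lemma real_part_lin (s : R) z w : real_part (s%:C *: z + w) = s *: real_part z + real_part w.
Proof. by rewrite /real_part realifyD realifyZ. Qed.
Lemma imag_part_lin (s : R) z w : imag_part (s%:C *: z + w) = s *: imag_part z + imag_part w.
Proof. by rewrite /imag_part realifyD realifyZ. Qed.

Lemma real_partZ (c : R[i]) z : real_part (c *: z) = Re c *: real_part z - Im c *: imag_part z.
Proof. by apply/rowP => j; rewrite !mxE ReM. Qed.
Lemma imag_partZ (c : R[i]) z : imag_part (c *: z) = Re c *: imag_part z + Im c *: real_part z.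
Proof. by apply/rowP => j; rewrite !mxE ImM. Qed.

Lemma parts_eq0 z : real_part z = 0 -> imag_part z = 0 -> z = 0.
Proof.
move=> h1 h2; rewrite -[z]realifyK.
have -> : realify z = (real_part z, imag_part z) by [].
by rewrite h1 h2; apply/rowP => j; rewrite !mxE.
Qed.

Lemma hform_Im_parts z w : Im (hform z w) =
  rform (imag_part z) (real_part w) - rform (real_part z) (imag_part w).
Proof.
rewrite -{1}[z]realifyK -{1}[w]realifyK /imag_part /real_part.
by case: (realify z) (realify w) => [a b] [c d]; rewrite hform_cplx.
Qed.

(** The symmetry of the mixed products becomes [(j - k) <yj, yk> = 0]. *)
Lemma orthogonal_kernel (j k : nat) (xj yj xk yk : W) : j != k ->
  xj = - (j%:R *: yj) -> xk = - (k%:R *: yk) -> rform yj xk = rform xj yk ->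
  rform yj yk = 0.
Proof.
move=> jk -> ->; rewrite rformNl rformNr rformZl rformZr.
move=> /oppr_inj/eqP; rewrite -subr_eq0 -mulrBl mulf_eq0 subr_eq0 eqr_nat eq_sym (negPf jk).
by move/eqP.
Qed.

Lemma orthogonal_coef m (Y : 'I_m -> W) (c : 'I_m -> R) :
  \sum_k c k *: Y k = 0 -> (forall j k, j != k -> rform (Y j) (Y k) = 0) ->
  (forall k, rform (Y k) (Y k) != 0) -> forall j, c j = 0.
Proof.
move=> Y0 orth nY j.
have rs (s : seq 'I_m) : rform (\sum_(k <- s) c k *: Y k) (Y j) =
    \sum_(k <- s) c k * rform (Y k) (Y j).
  elim: s => [|k s IH]; first by rewrite !big_nil rform0l.
  by rewrite !big_cons rformDl rformZl IH.
have := rs (index_enum _); rewrite Y0 rform0l (bigD1 j)//= big1 ?addr0; last first.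
  by move=> k kj; rewrite orth ?mulr0.
by move=> /esym/eqP; rewrite mulf_eq0 (negPf (nY j)) orbF => /eqP.
Qed.

Section AtPoint.
Variables (U : set M) (G : M -> V) (hl : horizontal_lift U G).
Variables (phi : chart R n M) (p : M) (aphi : atlas phi) (Up : U p) (pp : cdom phi p).
Local Notation x v := (real_part (dcmap phi G p v)).
Local Notation y v := (imag_part (dcmap phi G p v)).
Hypothesis dG_inj : forall v, dcmap phi G p v = 0 -> v = 0.

(** Vectors in the kernels of [x + s y] for different [s] have orthogonal
    images under [y], by isotropy, so that at most [n] values of [s] give a
    kernel. *)
Lemma exists_injective_combination : exists s : R, forall v, x v + s *: y v = 0 -> v = 0.
Proof.
apply: contrapT => no.
have ker (k : nat) : exists v, v != 0 /\ x v = - (k%:R *: y v).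
  apply: contrapT => nk; apply: no; exists k%:R => v e; apply/eqP; apply: contrapT => v0.
  by apply: nk; exists v; split; [exact/negP|apply/eqP; rewrite -addr_eq0 e].
have [u uP] := choice ker.
have iso j k : rform (y (u j)) (x (u k)) = rform (x (u j)) (y (u k)).
  have := hlift_isotropic hl aphi Up pp (u j) (u k).
  by rewrite hform_Im_parts => /eqP; rewrite subr_eq0 => /eqP.
have orth j k : j != k -> rform (y (u j)) (y (u k)) = 0.
  by move=> jk; exact: (orthogonal_kernel jk (uP j).2 (uP k).2 (iso j k)).
have y0 k : y (u k) != 0.
  apply/eqP => yk; have [u0 xk] := uP k; case/eqP: u0; apply: dG_inj.
  by apply: parts_eq0 => //; rewrite xk yk scaler0 oppr0.
have ypos k : rform (y (u k)) (y (u k)) != 0.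
  have [_ _ HG _] := hl; have [GH qG] := HG p Up.
  have hz := hlift_horizontal hl aphi Up pp (u k).
  have hc := hlift_conj hl aphi Up pp (u k).
  pose w := - 'i *: dcmap phi G p (u k).
  have yE : (realify w).1 = y (u k).
    by rewrite -[LHS]/(real_part w) real_partZ /= oppr0 scale0r sub0r scaleNr opprK scale1r.
  rewrite -yE gt_eqF//; apply: (rform_pos_parts GH qG).
  - by rewrite hformZl hz mulr0.
  - by rewrite hformZl hc mulr0.
  - by rewrite yE.
(* the values [s = 0, ..., n] would give [n + 1] independent kernel vectors *)
pose K := \matrix_(k < n.+1) u k.
have : row_free K.
  apply: inj_row_free => c cK; apply/rowP => j; rewrite mxE.
  have cE : \sum_k c 0 k *: u k = 0.
    apply: etrans _ cK; apply/rowP => i; rewrite summxE [RHS]mxE.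
    by apply: eq_bigr => k _; rewrite !mxE.
  have y00 : y 0 = 0 by rewrite /dcmap /dmap derive0 /imag_part cplxK.
  have lin (s : seq 'I_n.+1) : y (\sum_(k <- s) c 0 k *: u k) = \sum_(k <- s) c 0 k *: y (u k).
    elim: s => [|k s IH]; first by rewrite !big_nil.
    have E := hlift_linear hl aphi Up pp (c 0 k) (u k) (\sum_(j <- s) c 0 j *: u j).
    rewrite !big_cons.
    exact: etrans (congr1 imag_part E) (etrans (imag_part_lin _ _ _) (congr1 (+%R _) IH)).
  have sy0 := etrans (esym (lin (index_enum _)))
    (etrans (congr1 (fun v => imag_part (dcmap phi G p v)) cE) y00).
  exact: (orthogonal_coef (c := fun k => c 0 k) (Y := fun k => y (u k)) sy0
    (fun i k ik => orth i k ik) ypos).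
by rewrite /row_free => /eqP rk; have := rank_leq_col K; rewrite rk ltnn.
Qed.

End AtPoint.

Lemma Ck_prod (X : normedModType R) k (D : set X) (I : Type) (s : seq I) (F : I -> X -> R) :
  open D -> (forall i, Ck k D (F i)) -> Ck k D (fun x => \prod_(i <- s) F i x).
Proof.
move=> oD CF; elim: s => [|i s IH].
  have H := Ck_cst k D (1 : R).
  by apply: Ck_eq oD _ H => x _; rewrite big_nil.
have H := CkM oD (CF i) IH.
by apply: Ck_eq oD _ H => x _; rewrite big_cons.
Qed.

(** Injectivity of the real part of the differential is an open condition: a
    right inverse of its matrix at [p] still has an invertible product with the
    matrix at nearby points. *)
Lemma horizontal_lift_near (U : set M) (G : M -> V) (phi : chart R n M) (p : M) :
  horizontal_lift U G -> atlas phi -> U p -> cdom phi p ->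
  (forall v, real_part (dcmap phi G p v) = 0 -> v = 0) ->
  exists U' : set M, [/\ open U', U' p, U' `<=` U &
    spacelike_hypersurface U' (lift_base G) (lift_normal G)].
Proof.
move=> hl aphi Up pp inj; have [oU sG HG hG] := hl.
pose D := cimg phi U; have oD : open D by exact: open_cimg.
pose A (x : 'rV[R]_n) : 'M[R]_(n, n.+2) :=
  \matrix_(i < n) real_part (vder (delta_mx 0 i) (G \o cinv phi) x).
have AE q v : U q -> cdom phi q -> real_part (dcmap phi G q v) = v *m A (cmap phi q).
  move=> Uq qq; rewrite dcmapE (vder_dir v (cimg_mem Uq qq) (sG phi aphi)).
  have -> : v *m A (cmap phi q) = \sum_i v 0 i *: row i (A (cmap phi q)).
    exact: mulmx_sum_row.
  elim: (index_enum _) => [|i s IH].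
    by rewrite !big_nil; apply/rowP => j; rewrite !mxE.
  by rewrite !big_cons real_part_lin IH rowK.
have Afree : row_free (A (cmap phi p)).
  by apply: inj_row_free => v vA; apply: inj; rewrite AE.
have /row_freeP[B AB] := Afree.
pose d x := \det (A x *m B).
have cd : {for cmap phi p, continuous d}.
  have entry i j : Ck 0 D (fun x => (A x *m B) i j).
    have H : Ck 0 D (fun x => \sum_k A x i k * B k j).
      apply: Ck_sum => // k; apply: CkM => //; last exact: Ck_cst.
      have sv := vsmooth_vder (delta_mx 0 i) (sG phi aphi).
      have [h _] := (vsmoothP _ oD).1 sv k.
      have h0 := h 0%N.
      by apply: Ck_eq oD _ h0 => x _; rewrite /A !mxE.
    by apply: Ck_eq oD _ H => x _; rewrite mxE.
  have H : Ck 0 D d.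
    apply: Ck_sum => // s; apply: CkM => //; first exact: Ck_cst.
    by apply: Ck_prod.
  exact: (H _ (cimg_mem Up pp)).
have d1 : d (cmap phi p) = 1 by rewrite /d AB det1.
have N : \forall x \near cmap phi p, d x != 0.
  move/cvgrPdist_lt: cd => /(_ 1 ltr01); rewrite d1; apply: filterS => x dx.
  by apply/eqP => d0; move: dx; rewrite d0 subr0 normr1 ltxx.
pose B' := interior [set x | d x != 0].
have B'p : B' (cmap phi p) by exact: N.
have oB' : open B' by exact: open_interior.
pose U' := U `&` cdom phi `&` (cmap phi @^-1` B').
have oU' : open U'.
  rewrite openE => q [[Uq qq] Bq].
  apply: filterI; first apply: filterI.
  - exact: open_nbhs_nbhs (conj oU Uq).
  - exact: open_nbhs_nbhs (conj (cdom_open phi) qq).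
  - by apply: (cmap_cont qq); exact: open_nbhs_nbhs (conj oB' Bq).
have U'U : U' `<=` U by move=> q [[]].
exists U'; split=> //.
apply: lift_hypersurface; first exact: horizontal_lift_sub hl.
move=> psi q v apsi [[Uq qq] Bq] qq'.
have -> : dcmap psi G q v = dcmap phi G q (dmap psi (cmap phi) q v).
  rewrite /dcmap (dmap_change v apsi aphi qq' qq)//.
  exact: (smooth_map_diff sG).
rewrite -/(real_part _) AE// => vA.
apply: (dmap_transition_inj apsi aphi qq' qq).
have dn0 : d (cmap phi q) != 0 by exact: (interior_subset Bq).
have AB' : A (cmap phi q) *m B \in unitmx by rewrite unitmxE unitfE.
by rewrite -[LHS](mulmxK AB') mulmxA vA !mul0mx.
Qed.

Lemma phase_norm (g d : R) : g ^+ 2 + d ^+ 2 = 1 -> (g +i* d) * conjc (g +i* d) = 1.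
Proof. by move=> h; rewrite conjc_normE /= h. Qed.

Lemma phase_neq0 (g d : R) : g ^+ 2 + d ^+ 2 = 1 -> (g +i* d) != 0.
Proof.
move=> /phase_norm cc; apply/eqP => c0; have := cc; rewrite c0 mul0r => /eqP.
by rewrite eq_sym oner_eq0.
Qed.

Lemma circle_slope (s : R) : exists g d : R, [/\ 0 < g, d = s * g & g ^+ 2 + d ^+ 2 = 1].
Proof.
have h : 0 < 1 + s ^+ 2 by rewrite ltr_wpDr// sqr_ge0.
exists (Num.sqrt (1 + s ^+ 2))^-1, (s * (Num.sqrt (1 + s ^+ 2))^-1); split=> //.
  by rewrite invr_gt0 sqrtr_gt0.
rewrite exprMn exprVn sqr_sqrtr ?(ltW h)//.
by rewrite -[X in X + _]mul1r -mulrDl mulfV// gt_eqF.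
Qed.

(** Constant phases keep a lift horizontal, and all but finitely many of them
    make its real part an immersion at [p]. *)
Lemma lagrangian_local_gauss (f : M -> {vspace V}) (p : M) : lagrangian_immersion f ->
  exists U : set M, [/\ open U, U p & exists a b,
    spacelike_hypersurface U a b /\ forall q, U q -> gauss_map a b q = f q].
Proof.
move=> lag; have [U [G [hl Up Gf]]] := exists_horizontal_lift p lag.
have [phi aphi pp] := @atlas_cover R n M p.
have [[_ _ imm] _] := lag.
have dGi v : dcmap phi G p v = 0 -> v = 0.
  move=> v0; apply: (imm phi p v aphi pp).
  rewrite (dCHE _ aphi pp (hlift_local hl Up Gf)) v0 /dhopf hform0l scale0r addr0.
  by rewrite mulmx0 oppr0.
have [s sP] := exists_injective_combination hl aphi Up pp dGi.
have [g [d [g0 dE gd]]] := circle_slope (- s).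
pose c := g +i* d; have cc := phase_norm gd.
have hl' := horizontal_lift_phase cc hl.
have [oU sG _ _] := hl.
have [U' [oU' U'p U'U sh]] : exists U' : set M, [/\ open U', U' p, U' `<=` U &
    spacelike_hypersurface U' (lift_base (fun q => c *: G q)) (lift_normal (fun q => c *: G q))].
  apply: (horizontal_lift_near hl' aphi Up pp) => v.
  rewrite (dcmapZc c v oU sG aphi Up pp) real_partZ /= dE => h; apply: sP.
  have := congr1 ( *:%R g^-1) h; rewrite scaler0 scalerBr !scalerA mulVf ?gt_eqF// scale1r.
  by rewrite mulrCA mulVf ?gt_eqF// mulr1 scaleNr opprK.
exists U'; split=> //; exists (lift_base (fun q => c *: G q)), (lift_normal (fun q => c *: G q)).
split=> // q /U'U Uq; rewrite gauss_map_lift vline_scale ?Gf//.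
exact: phase_neq0 gd.
Qed.

End Rotations.

(** * Hypersurfaces with the same Gauss map *)

Section Nonuniqueness.
Context {R : realType} {n : nat} {M : manifold R n}.
Local Notation W := 'rV[R]_n.+2.
Local Notation s2 := (Num.sqrt (2 : R)).

Variables (U : set M) (a b : M -> W) (oU : open U).
Hypothesis ab : spacelike_hypersurface U a b.

Lemma eigenvalue_shape_chart (phi psi : chart R n M) p lambda :
  atlas phi -> atlas psi -> U p -> cdom phi p -> cdom psi p ->
  eigenvalue (hypersurface_shape phi a b p) lambda ->
  eigenvalue (hypersurface_shape psi a b p) lambda.
Proof.
move=> aphi apsi Up pp pq /(eigenvalue_shapeP oU ab aphi Up pp)[v v0 dbv].
apply/(eigenvalue_shapeP oU ab apsi Up pq); exists (dmap phi (cmap psi) p v).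
  by apply: contra_neq v0; exact: dmap_transition_inj.
have [[sa _ _] [sb _ _]] := ab.
have da := dmap_change v aphi apsi pp pq (smooth_map_diff sa apsi Up pq).
have db := dmap_change v aphi apsi pp pq (smooth_map_diff sb apsi Up pq).
exact: etrans (esym db) (etrans dbv (congr1 (fun x => - (lambda *: x)) da)).
Qed.

Variables (g d : R) (gd : g ^+ 2 + d ^+ 2 = 1).
Local Notation c := (g +i* d).
Local Notation G' := (fun q => c *: gauss_lift a b q).

Lemma rotated_base q : lift_base G' q = g *: a q - d *: b q.
Proof.
rewrite /lift_base -[(realify _).1]/(real_part _) real_partZ /real_part /imag_part.
rewrite realify_gauss /= scalerBr !scalerA.
by congr (_ *: _ - _ *: _); rewrite mulrAC mulfV ?s2_neq0// mul1r.
Qed.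

Variables (phi : chart R n M) (p : M) (aphi : atlas phi) (Up : U p) (pp : cdom phi p).

Let sG : smooth_cmap U (gauss_lift a b).
Proof. by have [] := hypersurface_lift oU ab. Qed.

Let sG' : smooth_cmap U G'.
Proof. by have [] := horizontal_lift_phase (phase_norm gd) (hypersurface_lift oU ab). Qed.

Lemma dmap_rotated_base v :
  dmap phi (lift_base G') p v = g *: dmap phi a p v - d *: dmap phi b p v.
Proof.
apply: etrans (dmap_lift_base v oU sG' aphi Up pp) _.
apply: etrans (congr1 (fun w => s2 *: (realify w).1) (dcmapZc c v oU sG aphi Up pp)) _.
apply: etrans (congr1 (fun w => s2 *: (realify (c *: w)).1) (dcmap_gauss oU ab aphi Up pp v)) _.
move: (dmap phi a p v) (dmap phi b p v) => x y.
rewrite -[(realify _).1]/(real_part _) real_partZ /real_part /imag_part realifyZ cplxK /=.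
rewrite scalerBr !scalerA.
by congr (_ *: _ - _ *: _); rewrite mulrCA mulfV ?s2_neq0// mulr1.
Qed.

Lemma dmap_rotated_normal v :
  dmap phi (lift_normal G') p v = d *: dmap phi a p v + g *: dmap phi b p v.
Proof.
apply: etrans (dmap_lift_normal v oU sG' aphi Up pp) _.
apply: etrans (congr1 (fun w => s2 *: (realify w).2) (dcmapZc c v oU sG aphi Up pp)) _.
apply: etrans (congr1 (fun w => s2 *: (realify (c *: w)).2) (dcmap_gauss oU ab aphi Up pp v)) _.
move: (dmap phi a p v) (dmap phi b p v) => x y.
rewrite -[(realify _).2]/(imag_part _) imag_partZ /real_part /imag_part realifyZ cplxK /=.
rewrite addrC scalerDr !scalerA.
by congr (_ *: _ + _ *: _); rewrite mulrCA mulfV ?s2_neq0// mulr1.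
Qed.

(** Rotating by the phase [g + i d] moves the angle of each principal curvature
    by the same amount: an eigenvalue [l] of the new shape operator comes from
    the eigenvalue [(d + g l) / (g - d l)] of the old one. *)
Lemma rotated_eigenvalue (U' : set M) l : open U' -> U' p ->
  spacelike_hypersurface U' (lift_base G') (lift_normal G') -> g - d * l != 0 ->
  eigenvalue (hypersurface_shape phi (lift_base G') (lift_normal G') p) l ->
  eigenvalue (hypersurface_shape phi a b p) ((d + g * l) / (g - d * l)).
Proof.
move=> oU' U'p sh gl /(eigenvalue_shapeP oU' sh aphi U'p pp)[v v0 h].
apply/(eigenvalue_shapeP oU ab aphi Up pp); exists v => //; move: h.
move=> /(etrans (esym (dmap_rotated_normal v))) h.
have {h} := etrans h (congr1 (fun x => - (l *: x)) (dmap_rotated_base v)).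
move: (dmap phi a p v) (dmap phi b p v) => x y h.
apply/rowP => j; move/rowP: h => /(_ j); rewrite !mxE => h.
have e : (g - d * l) * y 0 j = - ((d + g * l) * x 0 j) by move: h; lra.
by apply: (mulfI gl); rewrite e; field.
Qed.

End Nonuniqueness.

Section OtherHypersurface.
Context {R : realType} {n : nat} {M : manifold R n}.
Local Notation W := 'rV[R]_n.+2.

(** Rotating by a small positive phase [g + i d] preserves the immersion
    condition and lowers the principal curvatures: if the largest one were
    still an eigenvalue of the new shape operator, it would come from a larger
    eigenvalue of the old one. *)
Lemma other_hypersurface (hn : (0 < n)%N) (U : set M) (a b : M -> W) (p : M) :
  open U -> U p -> spacelike_hypersurface U a b ->
  exists U' : set M, [/\ open U', U' p, U' `<=` U & exists a' b',
        [/\ spacelike_hypersurface U' a' b',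
            forall q, U' q -> gauss_map a' b' q = gauss_map a b q,
            a' p != a p &
            forall phi, atlas phi -> cdom phi p -> exists lambda,
              eigenvalue (hypersurface_shape phi a b p) lambda /\
              ~~ eigenvalue (hypersurface_shape phi a' b' p) lambda]].
Proof.
move=> oU Up ab; have [phi0 aphi0 pp0] := @atlas_cover R n M p.
have [C C0 CP] := spectrum_bound (hypersurface_shape phi0 a b p).
(* with this slope, [g - d l] is positive for each principal curvature [l] *)
have [g [d [g0 dE gd]]] := circle_slope C^-1.
have d0 : 0 < d by rewrite dE mulr_gt0// invr_gt0.
have gC : g = C * d by rewrite dE mulrA mulfV ?gt_eqF// mul1r.
have small l : `|l| < C -> 0 < g - d * l.
  by rewrite ltr_norml => /andP[_ lC]; rewrite gC [C * d]mulrC -mulrBr mulr_gt0// subr_gt0.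
pose G' := fun q => (g +i* d) *: gauss_lift a b q.
have hl := hypersurface_lift oU ab.
have [_ sG _ _] := hl.
have hl' := horizontal_lift_phase (phase_norm gd) hl.
have [U' [oU' U'p U'U sh]] : exists U' : set M, [/\ open U', U' p, U' `<=` U &
    spacelike_hypersurface U' (lift_base G') (lift_normal G')].
  apply: (horizontal_lift_near hl' aphi0 Up pp0) => v.
  move=> h; apply/eqP; apply: contraT => v0.
  have := dmap_rotated_base oU ab gd aphi0 Up pp0 v.
  rewrite (dmap_lift_base v oU _ aphi0 Up pp0); last by case: hl'.
  rewrite -[(realify _).1]/(real_part _) h scaler0 => /esym e.
  have : eigenvalue (hypersurface_shape phi0 a b p) (- C).
    apply/(eigenvalue_shapeP oU ab aphi0 Up pp0); exists v => //; move: e.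
    move: (dmap phi0 a p v) (dmap phi0 b p v) => x y e; apply/rowP => j.
    move/rowP: e => /(_ j); rewrite !mxE gC => e.
    by apply: (mulfI (lt0r_neq0 d0)); move: e; lra.
  by move=> /CP; rewrite normrN gtr0_norm// ltxx.
exists U'; split=> //; exists (lift_base G'), (lift_normal G'); split=> //.
- move=> q _; rewrite gauss_map_lift -gauss_lift_line vline_scale//.
  exact: phase_neq0 gd.
- apply/eqP => aE; have [aa bb ba] := rform_ab ab Up.
  have := congr1 (rform ^~ (b p)) aE.
  rewrite rotated_base rformDl rformZl -scaleNr rformZl bb rformC ba mulr0 add0r mulrN1 opprK.
  by move/eqP; rewrite gt_eqF.
- move=> phi aphi pp; have [l0 el0] := shape_eigenvalue oU ab aphi Up pp hn.
  have [l el lmax] := max_eigenvalue el0; exists l; split=> //; apply/negP => el'.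
  have lC := CP _ (eigenvalue_shape_chart oU ab aphi aphi0 Up pp pp0 el).
  have gl := small _ lC.
  have := lmax _ (rotated_eigenvalue oU ab gd aphi Up pp oU' U'p sh (lt0r_neq0 gl) el').
  rewrite ler_pdivrMr//; apply/negP; rewrite -ltNge.
  have : 0 < d * (1 + l ^+ 2) by rewrite mulr_gt0// ltr_wpDr// sqr_ge0.
  by rewrite expr2; lra.
Qed.

End OtherHypersurface.

(** * Almost product structures along a Gauss map *)

Section Composition.
Context {R : realType} {n : nat} {X : normedModType R}.
Local Notation V := 'rV[R[i]]_n.+2.
Local Notation VR := ('rV[R]_n.+2 * 'rV[R]_n.+2)%type.
Implicit Types (D : set X) (H : X -> V) (F : VR -> V).

Lemma vsmooth_comp D (D' : set VR) H F : open D -> open D' ->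
  (forall x, D x -> D' (realify (H x))) -> vsmooth D H -> vsmooth D' F ->
  vsmooth D (fun x => F (realify (H x))).
Proof.
move=> oD oD' HD sH sF; apply/(vsmoothP _ oD) => j.
have [s1 s2] := (vsmoothP _ oD').1 sF j.
by split=> k; [exact: (Ck_comp VR_coordinates oD HD (sH k) (s1 k))
  | exact: (Ck_comp VR_coordinates oD HD (sH k) (s2 k))].
Qed.

Lemma vder_comp D (D' : set VR) H F x v : D x -> D' (realify (H x)) -> vsmooth D H -> vsmooth D' F ->
  vder v (fun y => F (realify (H y))) x = vder (realify (vder v H x)) F (realify (H x)).
Proof.
move=> Dx D'x sH sF.
have dH : differentiable (fun y => realify (H y)) x := smooth_diff sH Dx.
have dF : differentiable (fun y => realify (F y)) (realify (H x)) := smooth_diff sF D'x.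
have dC := differentiable_comp dH dF.
have e : realify (vder v H x) = 'D_v (fun y => realify (H y)) x.
  by rewrite vder.unlock cplxK.
rewrite e [in LHS]vder.unlock [in RHS]vder.unlock; apply: (congr1 (@cplx R n)).
apply: etrans (deriveE v dC) _; rewrite (diff_comp dH dF).
apply: etrans _ (esym (deriveE _ dF)).
by rewrite (deriveE v dH).
Qed.

End Composition.

Section LiftedConnection.
Context {R : realType} {n : nat}.
Local Notation V := 'rV[R[i]]_n.+2.
Implicit Types (O : set {vspace V}) (X Z : {vspace V} -> 'M[R[i]]_n.+2).

Lemma fliftZ Z (c : R[i]) (z : V) : c != 0 ->
  flift Z (realify (c *: z)) = c *: flift Z (realify z).
Proof. by move=> c0; rewrite /flift !realifyK vline_scale// scalemxAl. Qed.

Lemma coneZ O (c : R[i]) (z : V) : c != 0 -> cone O (realify (c *: z)) = cone O (realify z).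
Proof. by move=> c0; rewrite /cone /= !realifyK vline_scale. Qed.

(** The lift is homogeneous, and so is its derivative. *)
Lemma vder_flift_scale O Z (c : R[i]) (z u : V) : openCH O -> smooth_field O Z ->
  cone O (realify z) -> c != 0 ->
  vder (realify (c *: u)) (flift Z) (realify (c *: z)) =
  c *: vder (realify u) (flift Z) (realify z).
Proof.
move=> oO [_ sZ] Oz c0; have oD := cone_open oO.
have sI := vsmooth_cplx oD.
have sT : vsmooth (cone O) (fun w => c *: cplx w).
  exact: (vsmoothZ oD (csmooth_cst _ c) sI).
have dT : vder (realify u) (fun w => c *: cplx w) (realify z) = c *: u.
  have := vderZ oD Oz (realify u) (csmooth_cst _ c) sI.
  by rewrite cder_cst scale0r add0r vder_cplx realifyK.
have OT : cone O (realify (c *: cplx (realify z))).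
  by rewrite coneZ// realifyK.
have E := vder_comp (realify u) Oz OT sT sZ.
rewrite dT realifyK in E; rewrite -E.
have := vderZ oD Oz (realify u) (csmooth_cst _ c) sZ.
rewrite cder_cst scale0r add0r => <-.
congr (vder _ _ _); apply/funext => w.
exact: etrans (fliftZ Z (cplx w) c0) (congr1 (fun x => c *: flift Z x) (cplxK w)).
Qed.

(** Two points of the fibre differ by a phase, by which the derivative of the
    homogeneous lift is multiplied. *)
Lemma DconnE O X Z (z : V) : openCH O -> Hsphere z -> O <[z]>%VS -> smooth_field O Z ->
  Dconn X Z <[z]>%VS =
  dhopf z (vder (realify (z *m X <[z]>%VS)) (flift Z) (realify z)).
Proof.
move=> oO zH Oz sZ; have [fH fL Of] := cone_fibre oO Oz.
have [c cc fE] := Hsphere_phase zH fH (esym fL).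
have c0 : c != 0.
  by apply/eqP => c0; move: cc; rewrite c0 mul0r => /eqP; rewrite eq_sym oner_eq0.
rewrite /Dconn fE -scalemxAl (vder_flift_scale _ oO sZ _ c0).
  rewrite -[X in dhopf _ X]addr0 -(scale0r z); exact: dhopf_phase.
by rewrite /cone /= realifyK.
Qed.

(** The product with [conjv z] shows that the normal components agree. *)
Lemma tangential_part (z w y : V) (c k r : R[i]) : Hsphere z -> hform w z = 0 ->
  hform y (conjv z) = 0 -> k *: conjv z + c *: conjv w = - y + r *: conjv z ->
  y = - c *: conjv w.
Proof.
move=> zH wz yz E.
have zz : hform (conjv z) (conjv z) = -1 by rewrite hformJJ hform_Hsphere// conjcN conjc1.
have wz' : hform (conjv w) (conjv z) = 0 by rewrite hformJJ wz conjc0.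
have := congr1 (hform^~ (conjv z)) E.
rewrite !hformDl hformNl !hformZl zz wz' yz mulr0 addr0 oppr0 add0r => /mulIf e.
have kr : k = r by apply: e; rewrite oppr_eq0 oner_eq0.
by move: E; rewrite kr addrC => /addIr e'; rewrite scaleNr e' opprK.
Qed.

End LiftedConnection.

Section ProductStructureAlongGauss.
Context {R : realType} {n : nat} {M : manifold R n}.
Local Notation V := 'rV[R[i]]_n.+2.
Local Notation W := 'rV[R]_n.+2.

Lemma smooth_map_continuous (X : normedModType R) (U : set M) (F : M -> X) p :
  open U -> U p -> smooth_map U F -> {for p, continuous F}.
Proof.
move=> oU Up sF; have [phi aphi pp] := @atlas_cover R n M p.
have cF := sF phi aphi 0%N (cmap phi p) (cimg_mem Up pp).
have cc : {for p, continuous ((F \o cinv phi) \o cmap phi)}.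
  by apply: continuous_comp; [exact: cmap_cont|].
move: cc; rewrite /prop_for /continuous_at /= cmapK// => cc.
apply: cvg_trans cc; apply: near_eq_cvg.
have := open_nbhs_nbhs (conj (cdom_open phi) pp).
by apply: filterS => q qq /=; rewrite cmapK.
Qed.

Variables (U : set M) (a b : M -> W) (f : M -> {vspace V}) (oU : open U).
Hypothesis ab : spacelike_hypersurface U a b.
Hypothesis fE : forall q, U q -> gauss_map a b q = f q.
Local Notation G := (gauss_lift a b).
Variables (O : set {vspace V}) (A : {vspace V} -> 'M[R[i]]_n.+2 -> 'M[R[i]]_n.+2).

Let hl : horizontal_lift U G. Proof. exact: hypersurface_lift. Qed.

(** The lift of a unit normal is a unit multiple of [conjv G]. The factor is
    smooth, since it is minus the Hermitian product of the lift with [conjv G].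
    *)
Lemma normal_phase (D : set M) zeta p : unit_normal_field O zeta -> open D -> D `<=` U ->
  (forall q, D q -> O (f q)) -> D p ->
  exists (D' : set M) (c : M -> R[i]), [/\ open D', D' p, D' `<=` D, csmooth_map D' c &
    exists (N : set {vspace V}) Z, local_extension O zeta N Z /\
    forall q, D' q -> [/\ N (f q), c q * conjc (c q) = 1 &
      flift Z (realify (G q)) = c q *: conjv (G q)]].
Proof.
move=> [un ext] oD DU DO Dp; have [_ sG HG _] := hl.
have [N Np [Z le]] := ext _ (DO p Dp); have [oN sZ ZE] := le.
have lE q : D q -> <[G q]>%VS = f q by move=> /DU Uq; exact: (gauss_line fE).
pose D' := [set q | D q /\ cone N (realify (G q))].
have D'E q : D' q -> D q /\ N (f q).
  by move=> [Dq]; rewrite /cone /= realifyK lE.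
have oD' : open D'.
  rewrite openE => q [Dq Oq]; apply: filterI; first exact: open_nbhs_nbhs (conj oD Dq).
  apply: (smooth_map_continuous oU (DU _ Dq) sG).
  exact: open_nbhs_nbhs (conj (cone_open oN) Oq).
have D'D : D' `<=` D by move=> q [].
have sG' : smooth_cmap D' G by apply: smooth_cmap_sub sG => q /D'D/DU.
have sF : smooth_cmap D' (fun q => flift Z (realify (G q))).
  move=> phi aphi; have oI := open_cimg (phi := phi) oD'.
  apply: (vsmooth_comp oI (cone_open oN) _ (sG' phi aphi) (proj2 sZ)).
  move=> _ [q [[Dq Oq] qq] <-]; rewrite /= cmapK//.
pose cf q := - hform (flift Z (realify (G q))) (conjv (G q)).
exists D', cf; split=> //.
- by split=> //; rewrite /cone /= realifyK lE.
- apply: csmooth_mapN => //; apply: csmooth_map_hform => //.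
  exact: smooth_cmapJ.
exists N, Z; split=> // q D'q; have [Dq Nq] := D'E q D'q.
have [GH qG] := HG q (DU q Dq).
have Oq := DO q Dq.
have un' : unit_normal <[G q]>%VS (zeta <[G q]>%VS) by rewrite (lE q Dq); exact: un.
have [c cc czeta] := unit_normalE GH qG un'.
have E : flift Z (realify (G q)) = c *: conjv (G q).
  by rewrite /flift realifyK -czeta (lE q Dq) ZE.
have e : cf q = c.
  by rewrite /cf E hformZl hformJJ hform_Hsphere// conjcN conjc1 mulrN1 opprK.
by split; rewrite ?e.
Qed.

(** The lift of the normal field along the Gauss map is [c (conjv G)], whose
    derivative is [c] times the conjugate of the derivative of [G], up to
    normal components. By uniqueness of the Levi-Civita connection this
    derivative computes the shape operator. *)
Lemma product_structure_phase (D : set M) p : almost_product O A -> open D -> D `<=` U ->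
  (forall q, D q -> O (f q)) -> D p ->
  exists (D' : set M) (c : M -> R[i]), [/\ open D', D' p, D' `<=` D, csmooth_map D' c &
    forall q, D' q -> c q * conjc (c q) = 1 /\
    forall (phi : chart R n M) v, atlas phi -> cdom phi q ->
      tangentCH (f q) (A (f q) (dCH phi f q v)) /\
      G q *m A (f q) (dCH phi f q v) = - c q *: conjv (dcmap phi G q v)].
Proof.
move=> [_ [zeta [nf [nabla lc so]]]] oD DU DO Dp; have [_ sG HG _] := hl.
have [D' [c [oD' D'p D'D sc [N [Z [le H]]]]]] := normal_phase nf oD DU DO Dp.
have [oN sZ ZE] := le.
exists D', c; split=> // q D'q; have [Nq cc FE] := H q D'q; split=> // phi v aphi qq.
have Dq := D'D _ D'q; have Uq := DU _ Dq; have Oq := DO _ Dq; have [GH qG] := HG q Uq.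
set X := dCH phi f q v.
have lE : <[G q]>%VS = f q by exact: (gauss_line fE).
have tX : tangentQ (f q) X by exact: (dCH_tangentQ oU ab fE aphi Uq qq).
have [tA [s sE]] := so (f q) X Oq tX.
have [tA' hA] : tangentCH <[G q]>%VS (A (f q) X) /\ hform (G q *m A (f q) X) (conjv (G q)) = 0.
  by apply/(tangentQE _ GH); rewrite lE.
split; first by rewrite lE in tA'.
have E := sE N (projected_field X) Z Nq (smooth_projected_field X oN)
  (projected_fieldE oN Nq (proj1 tX)) le.
have {}E := etrans (esym (levi_civitaE lc oN Nq (smooth_projected_field X oN) sZ)) E.
rewrite -lE in Nq.
have Nc : cone N (realify (G q)) by rewrite /cone /= realifyK.
have E2 := DconnE (projected_field X) oN GH Nq sZ.
have pX : G q *m projected_field X <[G q]>%VS = dcmap phi G q v.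
  rewrite (projected_fieldE oN Nq); last by rewrite lE; exact: (proj1 tX).
  exact: (dCH_dcmap oU ab fE aphi Uq qq v).
rewrite pX lE in E2.
have sG' : smooth_cmap D' G by apply: smooth_cmap_sub sG => r /D'D/DU.
have Dx := cimg_mem D'q qq.
have OT : cone N (realify ((G \o cinv phi) (cmap phi q))) by rewrite /= cmapK.
have E3 := vder_comp v Dx OT (sG' phi aphi) (proj2 sZ).
rewrite [(G \o cinv phi) (cmap phi q)]/= cmapK// in E3.
have E4 : dcmap phi (fun r => flift Z (realify (G r))) q v =
    dc phi c q v *: conjv (G q) + c q *: conjv (dcmap phi G q v).
  have FGE r : D' r -> flift Z (realify (G r)) = c r *: conjv (G r) by case/H.
  rewrite (dcmap_eq v oD' D'q qq FGE).
  have := dcmapZ oD' aphi D'q qq v sc (smooth_cmapJ oD' sG') => ->.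
  by congr (_ + _ *: _); exact: (dcmapJ oD' aphi D'q qq v sG').
have E5 : vder (realify (dcmap phi G q v)) (flift Z) (realify (G q)) =
    dc phi c q v *: conjv (G q) + c q *: conjv (dcmap phi G q v).
  apply: etrans (congr1 (fun w => vder (realify w) (flift Z) (realify (G q)))
    (dcmapE phi G q v)) _.
  exact: etrans (esym E3)
    (etrans (esym (dcmapE phi (fun r => flift Z (realify (G r))) q v)) E4).
have hw := hlift_horizontal hl aphi Uq qq v.
have hwc := hlift_conj hl aphi Uq qq v.
have zE : G q *m zeta (f q) = c q *: conjv (G q).
  rewrite lE in Nq; rewrite -FE /flift realifyK lE.
  by congr (_ *m _); rewrite ZE.
move: E E2; rewrite E5; move: (dcmap phi G q v) (dc phi c q v) hw hwc => w k hw hwc -> E2.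
have {E2} := congr1 (mulmx (G q)) E2; rewrite dhopf_lift// mulmxDr mulmxN -!scalemxAr zE.
have -> : hform (k *: conjv (G q) + c q *: conjv w) (G q) = 0.
    have hJ y : hform (conjv y) (G q) = conjc (hform y (conjv (G q))).
    by rewrite -hformJJ conjvK.
  by rewrite hformDl !hformZl !hJ hwc hform_quad qG conjc0 !mulr0 addr0.
rewrite scale0r addr0 !scalerA => /esym; exact: tangential_part.
Qed.

End ProductStructureAlongGauss.

(** * Angle functions for an arbitrary almost product structure *)

Section UnitCircle.
Context {R : realType}.
Local Notation Re := (@complex.Re R).
Local Notation Im := (@complex.Im R).

Lemma unit_norm (u : R[i]) : u * conjc u = 1 -> Re u ^+ 2 + Im u ^+ 2 = 1.
Proof. by rewrite conjc_normE => /(congr1 Re). Qed.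

Lemma expi_surj (u : R[i]) : u * conjc u = 1 -> exists t, u = expi t.
Proof.
move=> /unit_norm; case: u => x y /= xy.
have x1 : -1 <= x <= 1 by apply/andP; split; nra.
have sE : sin (acos x) = `|y|.
  rewrite sin_acos//; have -> : 1 - x ^+ 2 = y ^+ 2 by lra.
  exact: sqrtr_sqr.
have cE : cos (acos x) = x by apply: acosK; rewrite in_itv.
have [y0|y0] := leP 0 y.
  by exists (acos x); rewrite /expi cE sE ger0_norm.
by exists (- acos x); rewrite /expi cosN sinN cE sE ltr0_norm// opprK.
Qed.

Lemma expi_atan (u : R[i]) : u * conjc u = 1 -> 0 < Re u -> u = expi (atan (Im u / Re u)).
Proof.
move=> /unit_norm; case: u => x y /= xy x0.
have x0' : x != 0 by rewrite gt_eqF.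
have cE : cos (atan (y / x)) = x.
  rewrite cos_atan; have -> : 1 + (y / x) ^+ 2 = x^-1 ^+ 2.
    have -> : 1 + (y / x) ^+ 2 = (x ^+ 2 + y ^+ 2) / x ^+ 2 by field.
    by rewrite xy div1r exprVn.
  by rewrite sqrtr_sqr ger0_norm ?invrK// invr_ge0 ltW.
rewrite /expi cE; congr (_ +i* _).
have : tan (atan (y / x)) * x = y by rewrite atanK divfK.
by rewrite /tan cE divfK.
Qed.

(** The factor by which complex conjugation acts on the multiples of [1 - i l]
    by real vectors. *)
Definition cayley (l : R) : R[i] := (1 +i* l) / (1 -i* l).

Lemma cayley_den (l : R) : (1 -i* l) != 0.
Proof. by rewrite eq_complex /= oner_eq0. Qed.

Lemma cayley_norm l : cayley l * conjc (cayley l) = 1.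
Proof.
rewrite /cayley conjcM conjc_inv /= opprK.
have h1 := cayley_den l; have h2 := cayley_den (- l); rewrite opprK in h2.
by field; rewrite h1 h2.
Qed.

(** The phase [c] cancels in the quotient of the two relations, which is [expi
    (- 2 (s - t)) (P - i Q) = P + i Q] with [P = l m + 1] and [Q = l - m]; this
    amounts to [sin (s - t) P + cos (s - t) Q = 0]. *)
Lemma angle_difference (c : R[i]) (s t l m : R) : c * conjc c = 1 ->
  expi (- (2 * s)) = - c * cayley l -> expi (- (2 * t)) = - c * cayley m -> l != m ->
  sin (s - t) != 0 /\ cot (s - t) = -1 * ((l * m + 1) / (l - m)).
Proof.
move=> cc es et lm; have lm0 : l - m != 0 by rewrite subr_eq0.
have E : expi (- (2 * (s - t))) * ((1 -i* l) * (1 +i* m)) = (1 +i* l) * (1 -i* m).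
  have -> : - (2 * (s - t)) = - (2 * s) + - - (2 * t) by ring.
  rewrite expiD (expiN (- (2 * t))) es et /cayley !conjcM conjc_inv conjcN /= opprK.
  have h1 := cayley_den l; have h2 := cayley_den (- m); rewrite opprK in h2.
  have -> : - c * ((1 +i* l) / (1 -i* l)) * (- conjc c * ((1 -i* m) / (1 +i* m))) *
      ((1 -i* l) * (1 +i* m)) = (c * conjc c) * ((1 +i* l) * (1 -i* m)).
    by field; rewrite h1 h2.
  by rewrite cc mul1r.
move: (s - t) E => d; rewrite expiN /expi cos2 sin2 => E.
have e1 := congr1 Re E; have e2 := congr1 Im E; rewrite /= in e1 e2.
have tr := cos2Dsin2 d; rewrite /cot; move: (cos d) (sin d) tr e1 e2 {E} => x y tr e1 e2.
have tr' : x ^+ 2 = 1 - y ^+ 2 by lra.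
have k1 : y * (y * (1 + l * m) + x * (l - m)) = 0.
  by move: e1; rewrite tr'; nra.
have k2 : x * (y * (1 + l * m) + x * (l - m)) = 0.
  by move: e2; rewrite tr'; nra.
have y0 : y != 0.
  apply/eqP => y0; move: k2; rewrite y0 mul0r add0r mulrA -expr2 tr' y0.
  by rewrite expr0n /= subr0 mul1r => /eqP; rewrite (negPf lm0).
split=> //; have /eqP := k1; rewrite mulf_eq0 (negPf y0) /= => /eqP k.
have -> : x = - (y * (1 + l * m)) / (l - m).
  by apply: (mulIf lm0); rewrite divfK//; lra.
by field; rewrite y0 lm0.
Qed.

End UnitCircle.

Section PrincipalAngleFunctions.
Context {R : realType} {n : nat} {M : manifold R n}.
Local Notation V := 'rV[R[i]]_n.+2.
Local Notation W := 'rV[R]_n.+2.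
Local Notation s2 := (Num.sqrt (2 : R)).

Variables (U : set M) (a b : M -> W) (f : M -> {vspace V}) (oU : open U).
Hypothesis ab : spacelike_hypersurface U a b.
Hypothesis fE : forall q, U q -> gauss_map a b q = f q.
Local Notation G := (gauss_lift a b).

Let hl : horizontal_lift U G. Proof. exact: hypersurface_lift. Qed.

Section AtPoint.
Variables (phi : chart R n M) (p : M) (aphi : atlas phi) (Up : U p) (pp : cdom phi p).
Local Notation dG := (dcmap phi G p).
Local Notation S := (hypersurface_shape phi a b p).

Lemma conj_principal e l : e *m S = l *: e -> conjv (dG e) = cayley l *: dG e.
Proof.
move=> eS; rewrite (dcmap_gauss_shape oU ab aphi Up pp) eS (daZ ab aphi Up pp).
move: (dmap phi a p e) => x; rewrite conjvZ conjv_cplx conjc_real opprK.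
rewrite [RHS]scalerA [_ * (s2^-1)%:C]mulrC -[RHS]scalerA; congr (_ *: _).
apply: (scalerI (cayley_den l)); rewrite scalerA /cayley [_ * (_ / _)]mulrC divfK ?cayley_den//.
apply/rowP => j; rewrite !mxE; apply: complexP; rewrite !ReImE /=; ring.
Qed.

Lemma hform_gauss_neq0 e l : e *m S = l *: e -> e != 0 -> hform (dG e) (dG e) != 0.
Proof.
move=> eS e0; rewrite (dcmap_gauss_shape oU ab aphi Up pp) eS (daZ ab aphi Up pp).
have := da_pos ab aphi Up pp e0; move: (dmap phi a p e) => x x0.
rewrite hformZl hformZr hform_cplx !rformE.
have h : 0 < rform x x + - (l * - (l * rform x x)).
  by rewrite -mulrN opprK ltr_wpDr// mulrA -expr2 mulr_ge0// ?sqr_ge0// ltW.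
rewrite !mulf_neq0 ?conjc_eq0 ?s2VC_neq0// eq_complex /= negb_and.
by apply/orP; left; rewrite gt_eqF.
Qed.

(** In a principal direction [dG e] is a multiple of [1 - i l] by a real
    vector, so that conjugation multiplies it by [cayley l]. *)
Lemma angle_phase (A : 'M[R[i]]_n.+2 -> 'M[R[i]]_n.+2) (c : R[i]) e l t :
  tangentCH (f p) (A (dCH phi f p e)) ->
  G p *m A (dCH phi f p e) = - c *: conjv (dG e) ->
  e *m S = l *: e -> e != 0 ->
  A (dCH phi f p e) =
    (cos (2 * t))%:C *: dCH phi f p e - (sin (2 * t))%:C *: ('i *: dCH phi f p e) <->
  expi (- (2 * t)) = - c * cayley l.
Proof.
move=> tA Ae eS e0; have g0 := hform_gauss_neq0 eS e0.
rewrite (angle_lift oU ab fE aphi Up pp e t tA) Ae (dCH_dcmap oU ab fE aphi Up pp).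
rewrite (conj_principal eS) scalerA; move: (dG e) g0 => g g0.
split=> [h|->//]; apply: (mulIf g0).
by rewrite -!hformZl h.
Qed.

End AtPoint.

Lemma smooth_principal_differential (phi : chart R n M) (D : set M) (e : M -> 'rV[R]_n) :
  atlas phi -> open D -> D `<=` U -> D `<=` cdom phi -> smooth_map D e ->
  smooth_cmap D (fun q => dcmap phi G q (e q)).
Proof.
move=> aphi oD DU Dphi se; have [_ sG _ _] := hl.
have oI := open_cimg (phi := phi) oD.
have sG' : smooth_cmap D G by exact: smooth_cmap_sub sG.
apply: (smooth_map_chart VR_coordinates aphi oD Dphi).
have H : vsmooth (cimg phi D) (fun x =>
    \sum_i (e (cinv phi x) 0 i)%:C *: vder (delta_mx 0 i) (G \o cinv phi) x).
  elim: (index_enum _) => [|i s IH].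
    by apply: vsmooth_eq oI _ (vsmooth_cst _ 0) => x _; rewrite big_nil.
  have sc : csmooth (cimg phi D) (fun x => (e (cinv phi x) 0 i)%:C).
    apply: csmoothR => k.
    exact: (Ck_lin oI (@coor_cont _ _ (row_coordinates n) i) (se phi aphi k)).
  have sv := vsmooth_vder (delta_mx 0 i) (sG' phi aphi).
  have H := vsmoothD oI (vsmoothZ oI sc sv) IH.
  by apply: vsmooth_eq oI _ H => x _; rewrite big_cons.
apply: smooth_eq oI _ H => _ [q [Dq qq] <-] /=.
rewrite cmapK// (dcmapE phi G q) -(vder_dir (e q) (cimg_mem Dq qq) (sG' phi aphi)).
by [].
Qed.

End PrincipalAngleFunctions.

Section AngleFunctions.
Context {R : realType} {n : nat} {M : manifold R n}.
Local Notation V := 'rV[R[i]]_n.+2.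
Local Notation W := 'rV[R]_n.+2.
Local Notation Re := (@complex.Re R).
Local Notation Im := (@complex.Im R).

Variables (U : set M) (a b : M -> W) (f : M -> {vspace V}) (oU : open U).
Hypothesis ab : spacelike_hypersurface U a b.
Hypothesis fE : forall q, U q -> gauss_map a b q = f q.
Variables (phi : chart R n M) (D : set M) (e : 'I_n -> M -> 'rV[R]_n).
Variables (lambda : 'I_n -> M -> R) (aphi : atlas phi) (oD : open D).
Hypothesis DU : D `<=` U `&` cdom phi.
Hypothesis pf : forall q, D q -> principal_frame phi a b q (e^~ q) (lambda^~ q).
Variables (O : set {vspace V}) (A : {vspace V} -> 'M[R[i]]_n.+2 -> 'M[R[i]]_n.+2).
Hypotheses (apA : almost_product O A) (DO : forall q, D q -> O (f q)).
Local Notation G := (gauss_lift a b).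

Lemma angle_relation_phase p : D p -> exists (D' : set M) (c : M -> R[i]),
  [/\ open D', D' p, D' `<=` D, csmooth_map D' c & forall q, D' q ->
    c q * conjc (c q) = 1 /\
    forall theta : 'I_n -> R, angle_relation A phi f q (e^~ q) theta <->
      forall j, expi (- (2 * theta j)) = - c q * cayley (lambda j q)].
Proof.
move=> Dp; have DU1 : D `<=` U by move=> q /DU[].
have [D' [c [oD' D'p D'D sc H]]] := product_structure_phase oU ab fE apA oD DU1 DO Dp.
exists D', c; split=> // q D'q; have [cc AE] := H q D'q; split=> // theta.
have Dq := D'D q D'q; have [Uq qq] := DU Dq; have [fr eS] := pf Dq.
have eq j t := angle_phase oU ab fE aphi Uq qq t
  (proj1 (AE phi (e j q) aphi qq)) (proj2 (AE phi (e j q) aphi qq)) (eS j) (frame_neq0 j fr).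
by split=> h j; apply/eq; exact: h.
Qed.

Lemma angle_functions_exist : exists theta : 'I_n -> M -> R,
  forall q, D q -> angle_relation A phi f q (e^~ q) (theta^~ q).
Proof.
have pt q : exists th : 'I_n -> R, D q -> angle_relation A phi f q (e^~ q) th.
  have [Dq|nDq] := pselect (D q); last by exists (fun=> 0).
  have [D' [c [_ D'q _ _ H]]] := angle_relation_phase Dq.
  have [cc AE] := H q D'q.
  have ex j : exists t, expi (- (2 * t)) = - c q * cayley (lambda j q).
    have [|t tE] := expi_surj (u := - c q * cayley (lambda j q)).
      by rewrite conjcM conjcN mulrACA mulrNN cc cayley_norm mulr1.
    by exists (- t / 2); rewrite tE; congr expi; field.
  by have [th thE] := choice ex; exists th => _; apply/AE.
by have [th thE] := choice pt; exists (fun j q => th q j) => q; exact: thE.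
Qed.

Lemma angle_functions_difference (theta : 'I_n -> M -> R) q : D q ->
  angle_relation A phi f q (e^~ q) (theta^~ q) ->
  forall j k, lambda j q != lambda k q ->
    sin (theta j q - theta k q) != 0 /\
    cot (theta j q - theta k q) =
      -1 * ((lambda j q * lambda k q + 1) / (lambda j q - lambda k q)).
Proof.
move=> Dq + j k; have [D' [c [_ D'q _ _ H]]] := angle_relation_phase Dq.
have [cc AE] := H q D'q => /AE h; exact: angle_difference cc (h j) (h k).
Qed.

(** The phases of the angle relations are smooth functions, and near a point
    the arctangent provides smooth angles for them. *)
Lemma smooth_angle_functions p : (forall j, smooth_map D (e j)) -> D p ->
  exists D' : set M, [/\ open D', D' p, D' `<=` D &
    exists theta : 'I_n -> M -> R, (forall j, smooth_map D' (theta j)) /\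
      forall q, D' q -> angle_relation A phi f q (e^~ q) (theta^~ q)].
Proof.
move=> se Dp; have [E [c [oE Ep ED sc H]]] := angle_relation_phase Dp.
have [th thE] := angle_functions_exist.
have {}thE : forall j, expi (- (2 * th j p)) = - c p * cayley (lambda j p).
  by have [_ h] := H p Ep; exact: (h (th^~ p)).1 (thE p Dp).
have DU1 : D `<=` U by move=> q /DU[].
have EU : E `<=` U by move=> q /ED/DU1.
have Ephi : E `<=` cdom phi by move=> q /ED/DU[].
pose g j q := dcmap phi G q (e j q).
have sg j : smooth_cmap E (g j).
  by apply: (smooth_principal_differential oU ab aphi oE EU Ephi); exact: smooth_map_sub (se j).
have g0 j q : E q -> hform (g j q) (g j q) != 0.
  move=> Eq; have [fr eS] := pf (ED _ Eq).
  exact: (hform_gauss_neq0 oU ab aphi (EU _ Eq) (Ephi _ Eq) (eS j) (frame_neq0 j fr)).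
(* the phases of the angle relations divided by their values at [p] *)
pose nu j q := - c q * (hform (conjv (g j q)) (g j q) * (hform (g j q) (g j q))^-1) *
  expi (2 * th j p).
have nuE j q : E q -> nu j q = - c q * cayley (lambda j q) * expi (2 * th j p).
  move=> Eq; have [fr eS] := pf (ED _ Eq); rewrite /nu; congr (_ * _ * _).
  rewrite [in X in X * _](conj_principal oU ab aphi (EU _ Eq) (Ephi _ Eq) (eS j)).
  by rewrite hformZl mulfK// g0.
have nu1 j q : E q -> nu j q * conjc (nu j q) = 1.
  move=> Eq; have [cc _] := H q Eq; rewrite nuE//.
  rewrite conjcM [conjc (_ * cayley _)]conjcM conjcN.
  by rewrite mulrACA expi_norm mulr1 mulrACA mulrNN cc cayley_norm mulr1.
have snu j : csmooth_map E (nu j).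
  apply: csmooth_mapM => //; last by move=> psi _; exact: csmooth_cst.
  apply: csmooth_mapM => //; first exact: csmooth_mapN.
  apply: csmooth_mapM => //.
    by apply: csmooth_map_hform => //; exact: smooth_cmapJ.
  move=> psi apsi; apply: (csmoothV (open_cimg (phi := psi) oE)).
    by move=> _ [q [Eq qq] <-]; rewrite /= cmapK//; exact: g0.
  exact: (csmooth_map_hform oE (sg j) (sg j) apsi).
have nup j : nu j p = 1 by rewrite nuE// -thE -expiD addNr expi0.
have near_p : \forall q \near p, E q /\ forall j, 0 < Re (nu j q).
  apply: filterI; first exact: open_nbhs_nbhs (conj oE Ep).
  apply: filter_forall => j.
  have sR : smooth_map E (fun q => Re (nu j q)) by move=> psi /(snu j)[].
  have := smooth_map_continuous oE Ep sR; rewrite /prop_for /continuous_at nup /= => cR.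
  move/cvgrPdist_lt: cR => /(_ 1 ltr01); apply: filterS => q.
  by rewrite ltr_norml => /andP[_]; lra.
pose D' := interior [set q | E q /\ forall j, 0 < Re (nu j q)].
have D'E q : D' q -> E q /\ forall j, 0 < Re (nu j q) by move=> /interior_subset.
exists D'; split=> //; first exact: open_interior.
  by move=> q /D'E[/ED].
exists (fun j q => th j p - 2^-1 * atan (Im (nu j q) / Re (nu j q))); split=> [j psi apsi k|q D'q].
  have oI := open_cimg (phi := psi) (open_interior _ : open D').
  have sub : cimg psi D' `<=` cimg psi E by apply: cimg_sub => q /D'E[].
  have [s1 s2] := snu j psi apsi.
  have r0 x : cimg psi D' x -> Re (nu j (cinv psi x)) != 0.
    by move=> [q [/D'E[Eq nu0] qq] <-]; rewrite cmapK// gt_eqF.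
  have C1 := Ck_sub sub (s1 k); have C2 := Ck_sub sub (s2 k).
  have C3 := Ck_atan oI (CkM oI C2 (CkV oI r0 C1)).
  have C4 := CkM oI (Ck_cst k (cimg psi D') (2^-1 : R)) C3.
  have C5 := CkD oI (Ck_cst k (cimg psi D') (th j p)) (CkN oI C4).
  by apply: Ck_eq oI _ C5 => x _.
have [Eq nu0] := D'E q D'q; have [_ AE] := H q Eq; apply/AE => j.
have -> : - (2 * (th j p - 2^-1 * atan (Im (nu j q) / Re (nu j q)))) =
    - (2 * th j p) + atan (Im (nu j q) / Re (nu j q)) by field.
rewrite expiD -expi_atan ?nu1// nuE//.
by rewrite mulrCA -expiD addNr expi0 mulr1.
Qed.

End AngleFunctions.

(** * Gauss maps and Lagrangian immersions *)

Theorem theorem4p4 (R : realType) (n : nat) (hn : (0 < n)%N) (M : manifold R n) :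
  (forall a b : M -> 'rV[R]_n.+2, spacelike_hypersurface setT a b ->
    lagrangian_immersion (gauss_map a b) /\
    forall (W : set M) (O : set {vspace 'rV[R[i]]_n.+2})
           (A : {vspace 'rV[R[i]]_n.+2} -> 'M[R[i]]_n.+2 -> 'M[R[i]]_n.+2),
      open W -> almost_product O A ->
      (forall p, W p -> O (gauss_map a b p)) ->
      (forall phi p v, atlas phi -> W p -> cdom phi p ->
        A (gauss_map a b p) (dCH phi (gauss_map a b) p v) =
        - dhopf (gauss_lift a b p) (dcmap phi (conjv \o gauss_lift a b) p v)) ->
      forall phi p, atlas phi -> W p -> cdom phi p ->
        (forall e theta, orthonormal_family phi (gauss_map a b) p e ->
          angle_relation A phi (gauss_map a b) p e theta ->
          exists2 lambda, principal_frame phi a b p e lambda &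
            forall j, sin (theta j) != 0 /\ lambda j = cot (theta j)) /\
        (forall e lambda, principal_frame phi a b p e lambda ->
          (exists theta, angle_relation A phi (gauss_map a b) p e theta) /\
          (forall theta, angle_relation A phi (gauss_map a b) p e theta ->
            forall j, sin (theta j) != 0 /\ lambda j = cot (theta j)))) /\
  (forall f : M -> {vspace 'rV[R[i]]_n.+2}, lagrangian_immersion f ->
    (forall p : M, exists U : set M, [/\ open U, U p & exists a b,
      spacelike_hypersurface U a b /\ forall q, U q -> gauss_map a b q = f q]) /\
    (forall (p : M) (U : set M) a b, open U -> U p ->
      spacelike_hypersurface U a b -> (forall q, U q -> gauss_map a b q = f q) ->
      exists U' : set M, [/\ open U', U' p, U' `<=` U & exists a' b',
        [/\ spacelike_hypersurface U' a' b',
            forall q, U' q -> gauss_map a' b' q = f q,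
            a' p != a p &
            forall phi, atlas phi -> cdom phi p -> exists lambda,
              eigenvalue (hypersurface_shape phi a b p) lambda /\
              ~~ eigenvalue (hypersurface_shape phi a' b' p) lambda]]) /\
    (forall (U : set M) a b, open U -> spacelike_hypersurface U a b ->
      (forall q, U q -> gauss_map a b q = f q) ->
      forall (phi : chart R n M) (W : set M) (e : 'I_n -> M -> 'rV[R]_n)
             (lambda : 'I_n -> M -> R),
      atlas phi -> open W -> W `<=` U `&` cdom phi ->
      (forall q, W q -> principal_frame phi a b q (e^~ q) (lambda^~ q)) ->
      forall (O : set {vspace 'rV[R[i]]_n.+2})
             (A : {vspace 'rV[R[i]]_n.+2} -> 'M[R[i]]_n.+2 -> 'M[R[i]]_n.+2),
      almost_product O A -> (forall q, W q -> O (f q)) ->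
      [/\ exists theta : 'I_n -> M -> R,
            forall q, W q -> angle_relation A phi f q (e^~ q) (theta^~ q),
          (forall j, smooth_map W (e j)) ->
          forall p, W p -> exists W' : set M, [/\ open W', W' p, W' `<=` W &
            exists theta : 'I_n -> M -> R,
              (forall j, smooth_map W' (theta j)) /\
              forall q, W' q -> angle_relation A phi f q (e^~ q) (theta^~ q)] &
          exists2 sign : R, sign = 1 \/ sign = -1 &
            forall (theta : 'I_n -> M -> R) q, W q ->
            angle_relation A phi f q (e^~ q) (theta^~ q) ->
            forall j k, lambda j q != lambda k q ->
              sin (theta j q - theta k q) != 0 /\
              cot (theta j q - theta k q) =
                sign * ((lambda j q * lambda k q + 1) /
                        (lambda j q - lambda k q))])).
Proof.
split=> [a b ab|f lag].
  split=> [|D O A oD apA DO AE phi p aphi Dp pp]; first exact: gauss_lagrangian_immersion.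
  have AEp v := AE phi p v aphi Dp pp.
  split=> [e theta|e lambda].
    exact: (principal_of_angles openT ab aphi (I : setT p) pp AEp).
  exact: (angles_of_principal openT ab aphi (I : setT p) pp AEp).
split; first by move=> p; exact: lagrangian_local_gauss.
split=> [p U a b oU Up ab fE|U a b oU ab fE phi D e lambda aphi oD DU pf O A apA DO].
  have [U' [oU' U'p U'U [a' [b' [ab' fE' ne ev]]]]] := other_hypersurface hn oU Up ab.
  exists U'; split=> //; exists a', b'; split=> // q U'q.
  by rewrite fE' ?fE//; exact: U'U.
split.
- exact: (angle_functions_exist oU ab fE aphi oD DU pf apA DO).
- by move=> se p Dp; exact: (smooth_angle_functions oU ab fE aphi oD DU pf apA DO se Dp).
exists (-1); first by right.
by move=> theta q Dq; exact: (angle_functions_difference oU ab fE aphi oD DU pf apA DO Dq).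
Qed.
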